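(* Let $N\ge2$ and let $\phi:\mathbb R\to\mathbb R$ satisfy $\phi\in C^2(\mathbb R)$, $\phi(0)=0$ and $0<\delta_1\le\phi'(s)\le\delta_2$ for all $s\in\mathbb R$, where $\delta_1,\delta_2$ are positive constants. Let $\Omega\subset\mathbb R^N$ be any domain with nonempty boundary $\partial\Omega$ of class $C^2$ ($\partial\Omega$ not necessarily bounded), and let $u$ be the solution of either problem (IBVP) or problem (CP) described in the context. Then $$\lim_{t\to0^+}-4t\,\Phi(u(x,t))=d(x)^2\quad\text{uniformly on every compact subset of }\Omega,$$ where $\Phi(s)=\int_1^s\frac{\phi'(\xi)}{\xi}\,d\xi$ for $s>0$ and $d(x)=\mathrm{dist}(x,\partial\Omega)$ for $x\in\Omega$.
   Context: The two problems are as follows. (IBVP) The initial-boundary value problem: $\partial_t u=\Delta\phi(u)$ in $\Omega\times(0,+\infty)$, $u=1$ on $\partial\Omega\times(0,+\infty)$, $u=0$ on $\Omega\times\{0\}$. Its solution is the unique bounded solution $u\in C^{2,1}(\Omega\times(0,+\infty))\cap L^\infty(\Omega\times(0,+\infty))\cap C^0(\overline\Omega\times(0,+\infty))$, the initial condition being understood as $u(\cdot,t)\to0$ in $L^1_{loc}(\Omega)$ as $t\to0^+$. (CP) The Cauchy problem: $\partial_t u=\Delta\phi(u)$ in $\mathbb R^N\times(0,+\infty)$, $u=\chi_{\Omega^c}$ on $\mathbb R^N\times\{0\}$, where $\chi_{\Omega^c}$ is the characteristic function of $\Omega^c=\mathbb R^N\setminus\Omega$. Its solution is the unique bounded solution $u\in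 C^{2,1}(\mathbb R^N\times(0,+\infty))\cap L^\infty(\mathbb R^N\times(0,+\infty))$, the initial condition being understood as $u(\cdot,t)\to\chi_{\Omega^c}$ in $L^1_{loc}(\mathbb R^N)$ as $t\to0^+$. Here $C^{2,1}$ means twice continuously differentiable in $x$ and once in $t$. By the strong comparison principle $0<u<1$ (in $\Omega\times(0,+\infty)$ for (IBVP), in $\mathbb R^N\times(0,+\infty)$ for (CP)), so $\Phi(u)$ is well defined. *)

(* Defs.v *)
From HB Require Import structures.
From mathcomp Require Import all_boot all_order all_algebra.
From mathcomp Require Import all_classical all_reals all_analysis.
Set Implicit Arguments.
Unset Strict Implicit.
Unset Printing Implicit Defensive.
Import Order.TTheory GRing.Theory Num.Theory.
Import numFieldNormedType.Exports.
Local Open Scope classical_set_scope.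
Local Open Scope ring_scope.

Lemma sigma_finite_product d1 d2 (T1 : measurableType d1)
    (T2 : measurableType d2) (R : realType)
    (m1 : {sigma_finite_measure set T1 -> \bar R})
    (m2 : {sigma_finite_measure set T2 -> \bar R}) :
  sigma_finite [set: T1 * T2] (m1 \x m2)%E.
Proof.
have /sigma_finiteP[F [TF ndF Foo]] := sigma_finiteT m1.
have /sigma_finiteP[G [TG ndG Goo]] := sigma_finiteT m2.
exists (fun n => F n `*` G n).
  rewrite -setXTT TF TG predeqE => -[x y]; split.
    move=> [/= [n _ Fnx] [k _ Gky]]; exists (maxn n k) => //; split.
    - by move: x Fnx; exact/subsetPset/ndF/leq_maxl.
    - by move: y Gky; exact/subsetPset/ndG/leq_maxr.
  by move=> [n _ []/= ? ?]; split; exists n.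
move=> k; have [? ?] := Foo k; have [? ?] := Goo k.
split; first exact: measurableX.
by rewrite product_measure1E// lte_mul_pinfty// ge0_fin_numE.
Qed.

Section cons_measure.
Context d (T : measurableType d) (R : realType) (n : nat).
Variables (m1 : {sigma_finite_measure set T -> \bar R})
  (m2 : {sigma_finite_measure set (n.-tuple T) -> \bar R}).

Let tuple_cons (p : T * n.-tuple T) : n.+1.-tuple T := [tuple of p.1 :: p.2].

Let measurable_tuple_cons : measurable_fun [set: T * n.-tuple T] tuple_cons.
Proof.
by apply: measurable_cons; [exact: measurable_fst|exact: measurable_snd].
Qed.

Definition cons_measure : set (n.+1.-tuple T) -> \bar R :=
  pushforward (m1 \x m2)%E tuple_cons.

Let cons_measure0 : cons_measure set0 = 0%E.
Proof. by rewrite /cons_measure /pushforward preimage_set0 measure0. Qed.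

Let cons_measure_ge0 A : (0 <= cons_measure A)%E.
Proof. by rewrite /cons_measure /pushforward measure_ge0. Qed.

Let cons_measure_sigma_additive : semi_sigma_additive cons_measure.
Proof.
have mf := measurable_tuple_cons.
move=> F mF tF mUF; rewrite /cons_measure /pushforward preimage_bigcup.
apply: measure_semi_sigma_additive.
- by move=> i; rewrite -[X in measurable X]setTI; exact: mf.
- apply/trivIsetP => /= i j _ _ ij; rewrite -preimage_setI.
  by move/trivIsetP : tF => /(_ _ _ _ _ ij) ->//; rewrite preimage_set0.
- by rewrite -preimage_bigcup -[X in measurable X]setTI; exact: mf.
Qed.

HB.instance Definition _ := isMeasure.Build _ _ _ cons_measure
  cons_measure0 cons_measure_ge0 cons_measure_sigma_additive.

Let cons_measure_sigma_finite : sigma_finite setT cons_measure.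
Proof.
have [F FT mF] := sigma_finite_product m1 m2.
pose g (v : n.+1.-tuple T) := (thead v, [tuple of behead v] : n.-tuple T).
have mg : measurable_fun setT g.
  apply: measurable_fun_pair; last exact: measurable_behead.
  exact: measurable_tnth.
have gK p : g (tuple_cons p) = p.
  by case: p => x v; rewrite /g; congr pair; apply/val_inj.
exists (fun i => g @^-1` F i).
  by rewrite -preimage_bigcup -FT preimage_setT.
move=> i; have [mFi Foo] := mF i; split.
  by rewrite -[X in measurable X]setTI; exact: mg.
rewrite /cons_measure /pushforward (_ : _ @^-1` _ = F i)//.
by apply/seteqP; split => p /=; rewrite gK.
Qed.

HB.instance Definition _ := Measure_isSigmaFinite.Build _ _ _ cons_measure
  cons_measure_sigma_finite.

End cons_measure.

(* The n-fold product measure on n-tuples; the library only has binary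
   products. *)
Section tuple_measure.
Context d (T : measurableType d) (R : realType).
Variable mu : {sigma_finite_measure set T -> \bar R}.

Fixpoint tuple_measure n : {sigma_finite_measure set (n.-tuple T) -> \bar R} :=
  match n with
  | 0 => \d_[tuple]
  | n'.+1 => cons_measure mu (tuple_measure n')
  end.

End tuple_measure.

Definition lebesgue_tuple (R : realType) (n : nat) :
    {sigma_finite_measure set (n.-tuple (measurableTypeR R)) -> \bar R} :=
  tuple_measure (@lebesgue_measure R) n.

Section euclidean_space.
Context {R : realType}.

(* The library norm on 'rV[R]_n is the sup norm: it induces the usual topology,
   but distances have to be computed with the Euclidean norm below. *)
Definition enorm n (x : 'rV[R]_n) : R := Num.sqrt (\sum_(i < n) x 0 i ^+ 2).

Definition edistance n (x : 'rV[R]_n) (A : set 'rV[R]_n) : R :=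
  inf [set enorm (x - y) | y in A].

Definition boundary (T : topologicalType) (A : set T) : set T :=
  closure A `\` interior A.

Definition partial n (i : 'I_n) (f : 'rV[R]_n -> R) : 'rV[R]_n -> R :=
  'D_(delta_mx 0 i) f.

Definition laplacian n (f : 'rV[R]_n -> R) (x : 'rV[R]_n) : R :=
  \sum_(i < n) partial i (partial i f) x.

Definition classC1_line (f : R -> R) :=
  (forall s, derivable f s 1) /\ continuous (derive1 f).

Definition classC2_line (f : R -> R) := classC1_line f /\ classC1_line (derive1 f).

Definition classC1 n (f : 'rV[R]_n -> R) :=
  continuous f /\
  forall i, (forall x, derivable f x (delta_mx 0 i)) /\
            continuous (partial i f).

Definition classC2 n (f : 'rV[R]_n -> R) :=
  classC1 f /\ forall i, classC1 (partial i f).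

(* Near each of its boundary points, and up to the choice of a coordinate axis
   and of its orientation, A is the strict epigraph of a C^2 function of the
   n - 1 other coordinates (those of col' i x). *)
Definition boundary_classC2 n (A : set 'rV[R]_n) :=
  forall p, boundary A p ->
  exists (i : 'I_n) (b : bool) (g : 'rV[R]_n.-1 -> R), classC2 g /\
    \forall x \near p, A x <-> g (col' i x) < (-1) ^+ b * x 0 i.

Definition continuous_cyl n (A : set 'rV[R]_n) (f : 'rV[R]_n -> R -> R) :=
  {within A `*` [set t | 0 < t], continuous (fun p => f p.1 p.2)}.

(* The class C^{2,1} on A x (0, +oo); meaningful for A open, since the
   derivatives below are two-sided. *)
Definition classC21 n (A : set 'rV[R]_n) (u : 'rV[R]_n -> R -> R) :=
  [/\ continuous_cyl A u,
      forall i,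
        (forall x t, A x -> 0 < t -> derivable (u^~ t) x (delta_mx 0 i)) /\
        continuous_cyl A (fun x t => partial i (u^~ t) x),
      forall i j,
        (forall x t, A x -> 0 < t ->
          derivable (partial i (u^~ t)) x (delta_mx 0 j)) /\
        continuous_cyl A (fun x t => partial j (partial i (u^~ t)) x)
    & (forall x t, A x -> 0 < t -> derivable (u x) t 1) /\
      continuous_cyl A (fun x t => derive1 (u x) t) ].

Definition row_of_tuple n (v : n.-tuple (measurableTypeR R)) : 'rV[R]_n :=
  \row_i tnth v i.

(* Points of R^n are row vectors, while the library has a product
   sigma-algebra on n-tuples only: hence the integral over tuples. *)
Definition cvg_L1loc n (A : set 'rV[R]_n) (u : 'rV[R]_n -> R -> R)
    (g : 'rV[R]_n -> R) :=
  forall K : set 'rV[R]_n, compact K -> K `<=` A ->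
    (\int[lebesgue_tuple R n]_(v in @row_of_tuple n @^-1` K)
       (`|u (row_of_tuple v) t - g (row_of_tuple v)|%:E))%E
    @[t --> 0^'+] --> 0%E.

End euclidean_space.

Section nonlinear_diffusion.
Context {R : realType} (phi : R -> R) (n : nat).
Implicit Types (A : set 'rV[R]_n) (u : 'rV[R]_n -> R -> R).

Definition bounded_solution A u :=
  [/\ classC21 A u,
      exists M, forall x t, A x -> 0 < t -> `|u x t| <= M
    & forall x t, A x -> 0 < t ->
        derive1 (u x) t = laplacian (fun y => phi (u y t)) x].

Definition IBVP_solution A u :=
  [/\ bounded_solution A u,
      continuous_cyl (closure A) u,
      forall x t, boundary A x -> 0 < t -> u x t = 1
    & cvg_L1loc A u (fun=> 0)].

Definition CP_solution A u :=
  bounded_solution [set: 'rV[R]_n] u /\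
  cvg_L1loc [set: 'rV[R]_n] u (\1_(~` A)).

(* Oriented integral from 1 to s; used for s > 0 only. *)
Definition Phi (s : R) : R :=
  if 1 <= s then \int[lebesgue_measure]_(xi in `[1, s]) (derive1 phi xi / xi)
  else - \int[lebesgue_measure]_(xi in `[s, 1]) (derive1 phi xi / xi).

End nonlinear_diffusion.

(* Main.v *)
Require Import Defs.
From HB Require Import structures.
From mathcomp Require Import all_boot all_order all_algebra.
From mathcomp Require Import all_classical all_reals all_analysis.
From mathcomp Require Import measurable_realfun ring lra.
Set Implicit Arguments.
Unset Strict Implicit.
Unset Printing Implicit Defensive.
Import Order.TTheory GRing.Theory Num.Theory.
Import numFieldNormedType.Exports.
Local Open Scope classical_set_scope.
Local Open Scope ring_scope.

(** The equation is governed at short times by its eikonal part. The pressure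
    p = Phi(u) satisfies p_t = phi'(u) Delta p + |grad p|^2, and - |x - y|^2 / (4 t)
    solves p_t = |grad p|^2; the theorem says that p behaves like the largest of
    these functions with y outside Omega. Paraboloids A(t) |x - y|^2 + B(t) with
    A' = 4 A^2 and B' = 2 n delta2 A take the diffusion into account: they are the
    pressures of supersolutions when A > 0 ([barrier_super]) and of subsolutions
    when A < 0 ([barrier_sub]), and B is only logarithmic in t.

    For the upper bound on p, take A = 1 / (4 (T0 - t)) in a ball of radius r around
    x contained in Omega, with B such that the barrier exceeds u on the sphere. At
    the centre this gives p <= - r^2 / (4 T0) + O(1) ([upper_estimate]), where r can
    be close to d(x) and T0 to t ([upper_asymptotics]). For the lower bound, take
    A = - 1 / (4 t) and y exterior to Omega: the barrier vanishes initially in Omega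
    and is small on the boundary for short times, whence
    p >= - |x - y|^2 / (4 t) - O(1) ([lower_estimate], [pressure_lower_bound]). As
    the boundary is locally a graph, y can be close to a nearest boundary point of x
    ([boundary_exterior], [lower_asymptotics]). Both bounds are uniform near each
    point of Omega, and compactness concludes.

    The initial condition holds in L^1_loc only, so barriers are compared with
    solutions through the energy, the integral of the cube of the positive part of
    the difference: integration by parts bounds its derivative by a multiple of
    itself, and it tends to 0 with t ([comparison], [small_initial_energy]).

    The class of equations is stable under u -> sg u + b with sg = 1 or - 1
    ([flux_solution_affine]). The upper estimate for - u gives u >= 0
    ([solution_ge0]); the one for 1 - u gives, in the Cauchy problem, u >= 1 / 2 near
    exterior points ([exterior_ge_half]), which plays the part of the boundary
    condition; and the lower estimate, which needs a positive solution, is applied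
    to u + e with e tending to 0. The pressures of the modified equations are
    compared through Phi(s) = phi'(0) ln s + O(1) as s tends to 0 ([pressure_ln]). *)

(** * Lebesgue measure on tuples *)

Section lebesgue_on_tuples.
Context {R : realType}.
Local Notation mR := (measurableTypeR R).

Lemma lebesgue_measure_shift (h : R) (A : set mR) : measurable A ->
  lebesgue_measure ((fun x : mR => x + h : mR) @^-1` A) = lebesgue_measure A.
Proof.
have mh : measurable_fun setT (fun x : mR => x + h : mR).
  by apply: measurable_funD => //; exact: measurable_cst.
move=> mA; apply/esym.
apply: (@lebesgue_measure_unique _ (pushforward lebesgue_measure (fun x : mR => x + h : mR))) => //.
move=> X [[a b] /= ab <-]; rewrite /pushforward.
have -> : (fun x : mR => x + h : mR) @^-1` `]a, b] = `](a - h), (b - h)]%classic.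
  by apply/seteqP; split => x /=; rewrite !in_itv/= ltrBlDr lerBrDr.
rewrite !lebesgue_measure_itv/= !lte_fin ltrD2r.
by case: ifPn => // _; rewrite -!EFinD; congr EFin; ring.
Qed.

Lemma ge0_integral_lebesgue_shift (h : R) (f : mR -> \bar R) :
  measurable_fun setT f -> (forall x, (0 <= f x)%E) ->
  (\int[lebesgue_measure]_x f (x + h)%R = \int[lebesgue_measure]_x f x)%E.
Proof.
move=> mf f0.
have mh : measurable_fun setT (fun x : mR => x + h : mR).
  by apply: measurable_funD => //; exact: measurable_cst.
rewrite -[LHS](@ge0_integral_pushforward _ _ _ _ _ _ mh _ setT f)//.
by apply: eq_measure_integral => A mA _; exact: lebesgue_measure_shift.
Qed.

Definition tuple_shift n (i : 'I_n) (h : R) (v : n.-tuple mR) : n.-tuple mR :=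
  [tuple tnth v j + h *+ (j == i) | j < n].

Lemma measurable_tuple_shift n (i : 'I_n) (h : R) :
  measurable_fun setT (tuple_shift i h).
Proof.
apply/measurable_fun_tnthP => j.
rewrite (_ : _ \o _ = fun v : n.-tuple mR => tnth v j + h *+ (j == i) : mR); last first.
  by apply/funext => v /=; rewrite tnth_mktuple.
apply: measurable_funD; first exact: measurable_tnth.
exact: measurable_cst.
Qed.

Lemma tuple_shift_cons n (i : 'I_n) h (x : mR) (v : n.-tuple mR) :
  tuple_shift (lift ord0 i) h [tuple of x :: v] = [tuple of x :: tuple_shift i h v].
Proof.
apply: eq_from_tnth => k; rewrite tnth_mktuple.
case: (unliftP ord0 k) => [l ->|->].
  by rewrite !tnthS tnth_mktuple (inj_eq lift_inj).
by rewrite !tnth0 eq_liftF mulr0n addr0.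
Qed.

Lemma tuple_shift_cons0 n h (x : mR) (v : n.-tuple mR) :
  tuple_shift ord0 h [tuple of x :: v] = [tuple of (x + h) :: v].
Proof.
apply: eq_from_tnth => k; rewrite tnth_mktuple.
case: (unliftP ord0 k) => [l ->|->]; last by rewrite !tnth0.
by rewrite !tnthS eq_sym eq_liftF mulr0n addr0.
Qed.

(** Translation invariance passes from the line to the product one factor at a
    time, by slicing along the head coordinate. It is the only property of the
    measure behind the integration by parts below. *)
Lemma lebesgue_tuple_shift n (i : 'I_n) (h : R) (A : set (n.-tuple mR)) :
  measurable A -> lebesgue_tuple R n (tuple_shift i h @^-1` A) = lebesgue_tuple R n A.
Proof.
elim: n i A => [[]//|n IH] i A mA.
have mc : measurable_fun [set: mR * n.-tuple mR]
    (fun p : mR * n.-tuple mR => [tuple of p.1 :: p.2] : n.+1.-tuple mR).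
  by apply: measurable_cons; [exact: measurable_fst|exact: measurable_snd].
have mB : measurable ((fun p : mR * n.-tuple mR => [tuple of p.1 :: p.2] : n.+1.-tuple mR) @^-1` A).
  by rewrite -[X in measurable X]setTI; exact: mc.
set B := _ @^-1` A in mB.
rewrite /lebesgue_tuple /= /cons_measure /pushforward /= -/(lebesgue_tuple R n).
rewrite -/B /product_measure1 /=.
case: (unliftP ord0 i) => [j ->|->].
  apply: eq_integral => x _ /=.
  have mx : measurable (xsection B x) by exact: measurable_xsection.
  rewrite -(IH j _ mx); congr (lebesgue_tuple R n _).
  by apply/seteqP; split => v; rewrite /xsection /= !inE /B /= tuple_shift_cons.
rewrite -[RHS](@ge0_integral_lebesgue_shift h)//.
  apply: eq_integral => x _ /=; congr (lebesgue_tuple R n _).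
  by apply/seteqP; split => v; rewrite /xsection /= !inE /B /= tuple_shift_cons0.
exact: measurable_fun_xsection.
Qed.

Lemma row_of_tuple_shift n (i : 'I_n) h (v : n.-tuple mR) :
  row_of_tuple (tuple_shift i h v) = row_of_tuple v + h *: delta_mx 0 i.
Proof. by apply/rowP => j; rewrite !mxE tnth_mktuple eqxx/= mulr_natr. Qed.

(** The topology of rows has no a priori relation to the product sigma-algebra
    of tuples. They meet because an open set is a countable union of cubes
    with rational centres, and a cube is a finite intersection of conditions
    on the coordinates. *)
Lemma measurable_row_of_tuple n (U : set 'rV[R]_n) : open U ->
  measurable (@row_of_tuple R n @^-1` U).
Proof.
move=> oU.
pose c (q : 'rV[rat]_n) : 'rV[R]_n := \row_i ratr (q 0 i).
pose B (p : 'rV[rat]_n * nat) : set (n.-tuple mR) :=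
  if `[< ball (c p.1) p.2.+1%:R^-1 `<=` U >] then
    \bigcap_(i in [set: 'I_n]) ((@tnth n mR ^~ i) @^-1` [set x : mR | `|ratr (p.1 0 i) - x| < p.2.+1%:R^-1])
  else set0.
have -> : @row_of_tuple R n @^-1` U = \bigcup_p B p.
  apply/seteqP; split => [v /= Uv|v [[q k] _]]; last first.
    rewrite /B /=; case: asboolP => // sub H; apply: sub; split=> // i j.
    by rewrite !mxE; exact: H.
  have /nbhs_ballP[e /= e0 He] := open_nbhs_nbhs (conj oU Uv).
  have e20 : 0 < e / 2 by apply: divr_gt0.
  have [k] := ltr_add_invr e20; rewrite add0r => hk.
  have k0 : 0 < k.+1%:R^-1 :> R by rewrite invr_gt0.
  have /choice[q hq] : forall i : 'I_n, exists q : rat, `|ratr q - tnth v i| < k.+1%:R^-1.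
    move=> i; have tri (a b : R) : 0 < b -> a - b < a + b by move=> ?; lra.
    have [q] := @rat_in_itvoo R (tnth v i - k.+1%:R^-1) (tnth v i + k.+1%:R^-1) (tri _ _ k0).
    by rewrite in_itv/= => ?; exists q; rewrite ltr_distl.
  exists (\row_i q i, k) => //; rewrite /B /=.
  have sub : ball (c (\row_i q i)) k.+1%:R^-1 `<=` U.
    move=> y [_ hy]; apply: He; split=> // i j; rewrite ord1.
    move: (hy 0 j) (hq j); rewrite /c !mxE /ball /= => H1 H2.
    rewrite (_ : _ - _ = (ratr (q j) - y 0 j) - (ratr (q j) - tnth v j)); last by ring.
    rewrite (le_lt_trans (ler_normB _ _))// (splitr e).
    by apply: ltrD; apply: lt_trans hk.
  by rewrite (asboolT sub) => i _ /=; rewrite mxE /ball /=; exact: hq.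
apply: countable_bigcupT_measurable; first exact: countableP.
move=> [q k]; rewrite /B; case: ifP => // _.
apply: fin_bigcap_measurable; first exact: finite_finset.
move=> i _; rewrite -[X in measurable X]setTI; apply: measurable_tnth => //.
rewrite (_ : [set x | _] = `](ratr (q 0 i) - k.+1%:R^-1), (ratr (q 0 i) + k.+1%:R^-1)[%classic); first exact: measurable_itv.
by apply/seteqP; split => x /=; rewrite in_itv/= ltr_distlC.
Qed.

Lemma measurable_closed_row_of_tuple n (A : set 'rV[R]_n) : closed A ->
  measurable (@row_of_tuple R n @^-1` A).
Proof.
move=> cA; rewrite -[A]setCK preimage_setC; apply: measurableC.
by have /measurable_row_of_tuple := closed_openC cA.
Qed.

Lemma measurable_continuous_row n (f : 'rV[R]_n -> R) : continuous f ->
  measurable_fun setT (f \o @row_of_tuple R n).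
Proof.
move=> cf; apply: (measurability _ (RGenOpens.measurableE R)) => _ [_ [a [b ->]] <-].
rewrite setTI comp_preimage.
have /measurable_row_of_tuple : open (f @^-1` `]a, b[%classic).
  by move/continuousP: cf; apply; exact: interval_open.
by [].
Qed.

End lebesgue_on_tuples.

(** * Integration of functions of rows *)

Section integral_on_rows.
Context {R : realType}.
Local Notation mR := (measurableTypeR R).

Lemma ler_rV_norm n (x : 'rV[R]_n) (r : R) : 0 <= r ->
  (`|x| <= r) <-> (forall i, `|x 0 i| <= r).
Proof.
move=> r0; rewrite {1}/Num.norm /= mx_normrE; split=> [/bigmax_leP[_ H] i|H].
  exact: (H (0, i)).
by apply/bigmax_leP; split=> // -[i j] _ /=; rewrite ord1.
Qed.

Lemma ler_coord_norm n (x : 'rV[R]_n) i : `|x 0 i| <= `|x|.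
Proof. by apply: (ler_rV_norm x (normr_ge0 x)).1. Qed.

(** The closed ball of the sup norm, whose preimage among tuples is a product
    of intervals. *)
Definition cube n (c : 'rV[R]_n) (r : R) : set 'rV[R]_n := [set x | `|x - c| <= r].

Lemma continuous_addr n (c : 'rV[R]_n) : continuous (fun x : 'rV[R]_n => x + c).
Proof.
by move=> x; apply: (@continuousD _ _ _ id (cst c)); [exact: cvg_id|exact: cst_continuous].
Qed.

Lemma closed_cube n (c : 'rV[R]_n) r : closed (cube c r).
Proof.
rewrite (_ : cube c r = (fun x => `|x - c|) @^-1` [set t | t <= r])//.
apply: closed_comp; last exact: closed_le.
by move=> x _; apply: (continuous_comp (@continuous_addr n (- c) x)); exact: norm_continuous.
Qed.

Lemma compact_cube n (c : 'rV[R]_n) r : compact (cube c r).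
Proof.
apply: bounded_closed_compact; last exact: closed_cube.
exists (`|c| + r); split=> [|M hM x /= xr]; first exact: num_real.
rewrite (le_trans _ (ltW hM))// -[x](subrK c) addrC.
by rewrite (le_trans (ler_normD _ _))// lerD2l.
Qed.

Lemma compact_sub_cube n (K : set 'rV[R]_n) : compact K ->
  exists2 r : R, 0 < r & K `<=` cube 0 r.
Proof.
move=> /compact_bounded[M [_ hM]]; exists (`|M| + 1); first by rewrite ltr_wpDl.
move=> x /hM; rewrite /cube /= subr0; apply.
by rewrite (le_lt_trans (ler_norm _))// ltrDl.
Qed.

Lemma lebesgue_tuple_cube n (c : 'rV[R]_n) (r : R) : 0 < r ->
  lebesgue_tuple R n (@row_of_tuple R n @^-1` cube c r) = ((r *+ 2) ^+ n)%:E.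
Proof.
move=> r0.
have cubeE m (a : 'rV[R]_m) : @row_of_tuple R m @^-1` cube a r =
    [set v | forall i, `|tnth v i - a 0 i| <= r].
  apply/seteqP; split=> v; rewrite /cube /= (ler_rV_norm _ (ltW r0)) => H i;
  by move: (H i); rewrite !mxE.
elim: n c => [|n IH] c.
  rewrite expr0 /lebesgue_tuple /= diracE mem_set// cubeE.
  by move=> -[].
rewrite /lebesgue_tuple /= /cons_measure /pushforward /= -/(lebesgue_tuple R n).
rewrite (_ : _ @^-1` _ = `[(c 0 0 - r), (c 0 0 + r)]%classic `*`
  (@row_of_tuple R n @^-1` cube (\row_j c 0 (lift 0 j)) r)).
  rewrite product_measure1E//; last first.
    by apply: measurable_closed_row_of_tuple; exact: closed_cube.
  rewrite IH exprS EFinM; congr (_ * _)%E.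
  rewrite [LHS]lebesgue_measure_itv/= lte_fin ltrD2l gtrN// -EFinB.
  by congr EFin; ring.
rewrite cubeE; apply/seteqP; split=> -[x v]; rewrite cubeE /= in_itv /=.
  move=> H; split; first by move: (H ord0); rewrite tnth0 ler_distl.
  by move=> i; move: (H (lift ord0 i)); rewrite tnthS mxE.
move=> [H1 H2] i; case: (unliftP ord0 i) => [j ->|->]; last by rewrite tnth0 ler_distl.
by move: (H2 j); rewrite tnthS mxE.
Qed.

Lemma lebesgue_tuple_compact n (K : set 'rV[R]_n) : compact K ->
  (lebesgue_tuple R n (@row_of_tuple R n @^-1` K) < +oo)%E.
Proof.
move=> cK; have [r r0 Kr] := compact_sub_cube cK.
have hc : closed K by apply: compact_closed => //; exact: norm_hausdorff.
have := ltry ((r *+ 2) ^+ n); rewrite -(lebesgue_tuple_cube (0 : 'rV[R]_n) r0).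
apply: le_lt_trans; apply: le_measure; rewrite ?inE.
- exact: measurable_closed_row_of_tuple.
- by apply: measurable_closed_row_of_tuple; exact: closed_cube.
- by move=> v; exact: Kr.
Qed.

Definition rowint n (f : 'rV[R]_n -> R) : R :=
  \int[lebesgue_tuple R n]_v f (row_of_tuple v).

Definition row_integrable n (f : 'rV[R]_n -> R) :=
  (lebesgue_tuple R n).-integrable setT (EFin \o (f \o @row_of_tuple R n)).

Lemma bounded_row_integrable n (f : 'rV[R]_n -> R) (K : set 'rV[R]_n) C :
  compact K -> measurable_fun setT (f \o @row_of_tuple R n) ->
  (forall x, `|f x| <= C) -> (forall x, ~ K x -> f x = 0) -> row_integrable f.
Proof.
move=> cK mf fC fK; rewrite /row_integrable.
have hc : closed K by apply: compact_closed => //; exact: norm_hausdorff.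
have mK := measurable_closed_row_of_tuple hc.
rewrite (_ : _ \o _ = (EFin \o (f \o @row_of_tuple R n)) \_ (@row_of_tuple R n @^-1` K)); last first.
  apply/funext => v; rewrite patchE; case: ifPn => // /negP; rewrite inE => nK.
  by rewrite /= fK.
apply/(integrable_mkcond _ mK); apply: measurable_bounded_integrable => //.
- exact: lebesgue_tuple_compact.
- exact: measurable_funTS.
- exists C; split; first exact: num_real.
  by move=> M CM v _ /=; rewrite (le_trans (fC _))// ltW.
Qed.

Lemma continuous_compact_bounded (T : topologicalType) (K : set T) (f : T -> R) :
  compact K -> {within K, continuous f} -> exists2 C : R, 0 < C & forall x, K x -> `|f x| <= C.
Proof.
move=> cK cf; have /compact_bounded[M [_ hM]] := continuous_compact cf cK.
exists (`|M| + 1); first by rewrite ltr_wpDl.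
by move=> x Kx; apply: (hM (`|M| + 1)); [rewrite (le_lt_trans (ler_norm _))// ltrDl|exists x].
Qed.

Lemma continuous_row_integrable n (f : 'rV[R]_n -> R) (K : set 'rV[R]_n) :
  compact K -> continuous f -> (forall x, ~ K x -> f x = 0) -> row_integrable f.
Proof.
move=> cK cf fK.
have [C C0 hC] : exists2 C : R, 0 < C & forall x, K x -> `|f x| <= C.
  by apply: continuous_compact_bounded => //; exact: continuous_subspaceT.
apply: (bounded_row_integrable (C := C) cK) => //.
  exact: measurable_continuous_row.
by move=> x; have [/hC//|/fK->] := pselect (K x); rewrite normr0 ltW.
Qed.

Lemma rowint_shift n (f : 'rV[R]_n -> R) (K : set 'rV[R]_n) i h :
  compact K -> continuous f -> (forall x, ~ K x -> f x = 0) ->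
  rowint (fun x => f (x + h *: delta_mx 0 i)) = rowint f.
Proof.
move=> cK cf fK; rewrite /rowint /Rintegral; congr fine.
pose g : n.-tuple mR -> \bar R := EFin \o (f \o @row_of_tuple R n).
have mg : measurable_fun setT g.
  by apply/measurable_EFinP; exact: measurable_continuous_row.
have mT := measurable_tuple_shift i h.
transitivity (\int[lebesgue_tuple R n]_v (g \o tuple_shift i h) v)%E.
  by apply: eq_integral => v _; rewrite /g /= row_of_tuple_shift.
rewrite -[LHS](@integral_pushforward _ _ _ _ _ _ mT _ setT g)//.
  by apply: eq_measure_integral => A mA _; exact: lebesgue_tuple_shift.
rewrite preimage_setT (_ : g \o tuple_shift i h =
   EFin \o ((fun x => f (x + h *: delta_mx 0 i)) \o @row_of_tuple R n)); last first.
  by apply/funext => v; rewrite /g /= row_of_tuple_shift.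
apply: (@continuous_row_integrable _ _ ((fun x : 'rV[R]_n => x - h *: delta_mx 0 i) @` K)).
- by apply: continuous_compact => //; apply: continuous_subspaceT; exact: continuous_addr.
- by move=> x; apply: continuous_comp; [exact: continuous_addr|exact: cf].
- move=> x nK; apply: fK => Kx; apply: nK; exists (x + h *: delta_mx 0 i) => //.
  by rewrite addrK.
Qed.

(** By continuity f stays above half of its value at x0 on a cube, which has
    positive measure. *)
Lemma rowint_gt0 n (f : 'rV[R]_n -> R) (K : set 'rV[R]_n) x0 :
  compact K -> continuous f -> (forall x, ~ K x -> f x = 0) ->
  (forall x, 0 <= f x) -> 0 < f x0 -> 0 < rowint f.
Proof.
move=> cK cf fK f0 fx0.
have intf := continuous_row_integrable cK cf fK.
have [r r0 hr] : exists2 r : R, 0 < r & forall x, cube x0 r x -> f x0 / 2 <= f x.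
  have := cf x0; rewrite /continuous_at => /cvgrPdist_lt /(_ (f x0 / 2)).
  rewrite divr_gt0// => /(_ isT) /nbhs_ballP[e /= e0 He].
  exists (e / 2); first exact: divr_gt0.
  move=> x xe; have : ball x0 e x.
    rewrite -ball_normE /= distrC (le_lt_trans xe)// ltr_pdivrMr// ltr_pMr//.
    by rewrite (ltr_nat _ 1 2).
  by move=> /He /=; rewrite ltr_distl => /andP[]; lra.
have mc : measurable (@row_of_tuple R n @^-1` cube x0 r).
  by apply: measurable_closed_row_of_tuple; exact: closed_cube.
apply: (@lt_le_trans _ _ (f x0 / 2 * (r *+ 2) ^+ n)).
  by rewrite mulr_gt0// ?divr_gt0// exprn_gt0// mulrn_wgt0.
rewrite -lee_fin /rowint /Rintegral fineK; last exact: integrable_fin_num.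
rewrite EFinM -(lebesgue_tuple_cube x0 r0) -integral_cst//.
apply: (@le_trans _ _ (\int[lebesgue_tuple R n]_(v in @row_of_tuple R n @^-1` cube x0 r) (f (row_of_tuple v))%:E)%E).
  apply: ge0_le_integral => //.
  - by move=> v _; rewrite lee_fin divr_ge0// ltW.
  - apply/measurable_EFinP; apply: measurable_funTS; exact: measurable_continuous_row.
  - by move=> v /hr; rewrite lee_fin.
apply: ge0_subset_integral => //.
- by apply/measurable_EFinP; exact: measurable_continuous_row.
- by move=> v _; rewrite lee_fin.
Qed.

(** Differentiation under the integral sign, dominated by the constant C on
    the common compact support K. *)
Lemma rowint_is_derive n (f df : R -> 'rV[R]_n -> R) (K : set 'rV[R]_n) (a b C : R) :
  compact K ->
  (forall t, t \in `]a, b[ -> continuous (f t)) ->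
  (forall t x, t \in `]a, b[ -> ~ K x -> f t x = 0) ->
  (forall t x, t \in `]a, b[ -> is_derive t 1 (f ^~ x) (df t x)) ->
  (forall t x, t \in `]a, b[ -> `|df t x| <= C) ->
  (forall t x, t \in `]a, b[ -> ~ K x -> df t x = 0) ->
  forall t, t \in `]a, b[ -> is_derive t 1 (fun t => rowint (f t)) (rowint (df t)).
Proof.
move=> cK cf fK fd dC dK t tab.
pose g (s : R) (v : n.-tuple mR) : R := f s (row_of_tuple v).
have hc : closed K by apply: compact_closed => //; exact: norm_hausdorff.
have mK := measurable_closed_row_of_tuple hc.
pose G (v : n.-tuple mR) : R := C * \1_(@row_of_tuple R n @^-1` K) v.
have C0 : 0 <= C by apply: le_trans (dC t 0 tab).
have G0 v : 0 <= G v by rewrite mulr_ge0.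
have intG : (lebesgue_tuple R n).-integrable setT (EFin \o G).
  rewrite (_ : EFin \o G = fun v => (C%:E * (\1_(@row_of_tuple R n @^-1` K) v)%:E)%E)//.
  apply: integrableZl => //.
  apply/integrableP; split; first by apply/measurable_EFinP.
  rewrite (eq_integral (fun v => (\1_(@row_of_tuple R n @^-1` K) v)%:E)); last first.
    by move=> v _; rewrite gee0_abs// lee_fin.
  by rewrite integral_indic// setIT; exact: lebesgue_tuple_compact.
have intg x : `]a, b[%classic x -> (lebesgue_tuple R n).-integrable setT (EFin \o g x).
  move=> xab; apply: (continuous_row_integrable cK); [exact: cf|].
  by move=> y; exact: fK.
have dg x y : `]a, b[%classic x -> setT y -> derivable (g ^~ y) x 1.
  by move=> xab _; exact: (@ex_derive _ _ _ _ _ _ _ (fd _ _ xab)).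
have dgE x y : `]a, b[%classic x -> partial1of2 g x y = df x (row_of_tuple y).
  move=> xab; rewrite partial1of2E; exact: (@derive_val _ _ _ _ _ _ _ (fd _ _ xab)).
have dgG x y : `]a, b[%classic x -> setT y -> `|partial1of2 g x y| <= G y.
  move=> xab _; rewrite dgE// /G indicE; case: (boolP (_ \in _)) => [_|/negP].
    by rewrite mulr1; exact: dC.
  by rewrite inE => nK; rewrite dK// normr0 mulr0.
apply: DeriveDef.
  exact: (@derivable_under_integral _ _ _ _ _ _ measurableT t a b tab intg dg G G0 intG dgG).
rewrite -derive1E.
rewrite (@differentiation_under_integral _ _ _ _ _ _ measurableT t a b tab intg dg G G0 intG dgG).
by apply: eq_Rintegral => v _; exact: dgE.
Qed.

Lemma is_derive_line n (f : 'rV[R]_n -> R) (x v : 'rV[R]_n) (h d : R) :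
  is_derive (x + h *: v) v f d -> is_derive h 1 (fun h => f (x + h *: v)) d.
Proof.
move=> [fd fdE].
have E : (fun k : R => k^-1 *: (((fun h => f (x + h *: v)) \o shift h) (k *: (1 : R)) - f (x + h *: v)))
   = (fun k : R => k^-1 *: ((f \o shift (x + h *: v)) (k *: v) - f (x + h *: v))).
  apply/funext => k /=; congr (_ *: (f _ - _)).
  by rewrite [k *: 1]mulr1 scalerDl addrCA.
split; first by rewrite /derivable E.
by rewrite /derive E.
Qed.

Lemma normr_delta_mx n (i : 'I_n) : `|delta_mx 0 i : 'rV[R]_n| <= 1.
Proof.
apply/ler_rV_norm => // j; rewrite mxE eqxx /=.
by case: eqP => _; rewrite ?normr1 ?normr0.
Qed.

(** Integration by parts without boundary: the integral of a translate of f
    along a coordinate axis does not depend on the step, so the derivative in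
    the step vanishes, and at 0 it is the integral of the partial derivative.
    *)
Lemma rowint_partial n (f df : 'rV[R]_n -> R) (K : set 'rV[R]_n) i :
  compact K -> continuous f -> continuous df ->
  (forall x, ~ K x -> f x = 0) ->
  (forall x, is_derive x (delta_mx 0 i) f (df x)) -> rowint df = 0.
Proof.
move=> cK cf cdf fK fd.
have hc : closed K by apply: compact_closed => //; exact: norm_hausdorff.
have dK x : ~ K x -> df x = 0.
  move=> nKx; rewrite -(@derive_val _ _ _ _ _ _ _ (fd x)).
  rewrite (@near_eq_derive _ _ _ f (cst 0)) ?derive_cst//.
  apply: filterS (open_nbhs_nbhs (conj (closed_openC hc) nKx)).
  by move=> y /fK.
have [r r0 Kr] := compact_sub_cube cK.
have [C C0 hC] : exists2 C : R, 0 < C & forall x, K x -> `|df x| <= C.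
  by apply: continuous_compact_bounded => //; exact: continuous_subspaceT.
have out (h : R) (x : 'rV[R]_n) : h \in `]-1, 1[ -> ~ cube 0 (r + 1) x -> ~ K (x + h *: delta_mx 0 i).
  rewrite in_itv/= -ltr_norml => h1; apply: contra_not => /Kr.
  rewrite /cube /= !subr0 => H; rewrite -[x](addrK (h *: delta_mx 0 i)).
  rewrite (le_trans (ler_normB _ _))// lerD// normrZ -[leRHS]mulr1.
  by apply: ler_pM => //; [exact: ltW|exact: normr_delta_mx].
pose F (h : R) := rowint (fun x => f (x + h *: delta_mx 0 i)).
have I0 : (0 : R) \in `]-1, 1[ by rewrite in_itv/= ltrN10 ltr01.
have : is_derive (0 : R) 1 F (rowint (fun x => df (x + 0 *: delta_mx 0 i))).
  apply: (@rowint_is_derive n (fun h x => f (x + h *: delta_mx 0 i))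
    (fun h x => df (x + h *: delta_mx 0 i)) (cube 0 (r + 1)) (-1) 1 C) => //.
  - exact: compact_cube.
  - by move=> t _ x; apply: continuous_comp; [exact: continuous_addr|exact: cf].
  - by move=> t x t1 ?; apply: fK; exact: out.
  - by move=> t x t1; exact: is_derive_line.
  - move=> t x t1; have [/hC//|/dK->] := pselect (K (x + t *: delta_mx 0 i)).
    by rewrite normr0 ltW.
  - by move=> t x t1 ?; apply: dK; exact: out.
have -> : F = cst (rowint f) by apply/funext => h; rewrite /F (rowint_shift i h cK cf fK).
move=> [_]; rewrite derive_cst => /esym.
by under eq_fun do rewrite scale0r addr0.
Qed.

End integral_on_rows.

(** * Calculus on rows and the Gronwall inequality *)

Section calculus.
Context {R : realType}.

Lemma is_derive_lineP n (f : 'rV[R]_n -> R) (x v : 'rV[R]_n) (d : R) :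
  is_derive x v f d <-> is_derive (0 : R) 1 (fun h => f (x + h *: v)) d.
Proof.
have E : (fun k : R => k^-1 *: (((fun h => f (x + h *: v)) \o shift 0) (k *: (1 : R)) - f (x + 0 *: v)))
   = (fun k : R => k^-1 *: ((f \o shift x) (k *: v) - f x)).
  apply/funext => k /=; rewrite scale0r !addr0 [k *: 1]mulr1.
  by congr (_ *: (f _ - _)); exact: addrC.
split=> [H|[fd fdE]]; first by apply: is_derive_line; rewrite scale0r addr0.
split.
  by move: fd; rewrite /derivable E.
by move: fdE; rewrite /derive E.
Qed.

Lemma is_derive_comp n (f : R -> R) (g : 'rV[R]_n -> R) (x v : 'rV[R]_n) (a b : R) :
  is_derive (g x) 1 f a -> is_derive x v g b -> is_derive x v (f \o g) (a * b).
Proof.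
move=> fa /is_derive_lineP gb; apply/is_derive_lineP.
apply: (@is_derive1_comp _ f (fun h => g (x + h *: v)) 0 a b) => //.
by rewrite scale0r addr0.
Qed.

Definition pos (r : R) : R := Num.max 0 r.

Lemma pos_ge0 (r : R) : 0 <= pos r.
Proof. by rewrite /pos le_max lexx. Qed.

Lemma pos_le0 (r : R) : r <= 0 -> pos r = 0.
Proof. exact: max_l. Qed.

Lemma pos_id (r : R) : 0 <= r -> pos r = r.
Proof. exact: max_r. Qed.

Lemma posXS k (r : R) : pos r ^+ k.+2 = pos r ^+ k.+1 * r.
Proof.
by rewrite [LHS]exprSr /pos; case: (leP 0 r) => // _; rewrite exprS !mul0r.
Qed.

Lemma continuous_pos : continuous pos.
Proof.
move=> r; apply: (@continuous_max _ _ (cst 0) id); first exact: cst_continuous.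
exact: cvg_id.
Qed.

Lemma continuous_posX k : continuous (fun r : R => pos r ^+ k).
Proof. move=> r; apply: (@continuous_comp _ _ _ pos (fun r : R => r ^+ k)).
  exact: continuous_pos.
exact: exprn_continuous. Qed.

(** From the square on, the powers of the positive part are C^1: at the corner
    0 the difference quotient is the previous power, which is continuous. *)
Lemma is_derive_posX k (x : R) :
  is_derive x 1 (fun r : R => pos r ^+ k.+2) (k.+2%:R * pos x ^+ k.+1).
Proof.
have [x0|x0|->] := ltgtP x 0.
- rewrite (pos_le0 (ltW x0)) expr0n mulr0.
  apply: (@near_eq_is_derive _ _ _ (cst (0 : R))).
  by near=> y; rewrite /cst pos_le0 ?expr0n// ltW//; near: y; exact: lt_nbhsl.
- rewrite (pos_id (ltW x0)).
  apply: (@near_eq_is_derive _ _ _ (fun y : R => y ^+ k.+2 : R)).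
    by near=> y; rewrite pos_id// ltW//; near: y; exact: lt_nbhsr.
  rewrite (_ : (fun y : R => y ^+ k.+2) = id ^+ k.+2); last by apply/funext => y; rewrite exprfctE.
  apply: (is_derive_eq (is_deriveX k.+2 (is_derive_id _ _))).
  by rewrite /GRing.scale /= mulr1.
rewrite (pos_le0 (lexx _)) expr0n mulr0; apply/is_derive1_caratheodory.
exists (fun y => pos y ^+ k.+1); split.
- by move=> y; rewrite posXS (pos_le0 (lexx _)) expr0n !subr0.
- exact: continuous_posX.
- by rewrite (pos_le0 (lexx _)) expr0n.
Unshelve. all: by end_near. Qed.

Lemma near_eq_continuous_at (T U : topologicalType) (f g : T -> U) (x : T) :
  (\forall y \near x, f y = g y) -> {for x, continuous g} -> {for x, continuous f}.
Proof.
move=> fg cg; have E : f x = g x := nbhs_singleton fg.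
change (f @ x --> f x); rewrite E.
apply: cvg_trans cg; apply: near_eq_cvg.
by apply: filterS fg => y ->.
Qed.

Lemma continuous_pairl (T U : topologicalType) (y : U) :
  continuous (fun x : T => (x, y)).
Proof.
move=> x A /= [[V W] /= [HV HW] VWA]; apply: filterS HV => z Vz.
by apply: VWA; split => //=; exact: nbhs_singleton.
Qed.

Lemma continuous_slicel (T U V : topologicalType) (u : T -> U -> V) x t :
  {for (x, t), continuous (fun p => u p.1 p.2)} -> {for x, continuous (u ^~ t)}.
Proof. exact: (@continuous_comp _ _ _ (fun y => (y, t)) _ x (@continuous_pairl _ _ t x)). Qed.

Lemma within_continuousB (T : topologicalType) (A : set T) (f g : T -> R) :
  {within A, continuous f} -> {within A, continuous g} ->
  {within A, continuous (fun p => f p - g p)}.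
Proof.
move=> cf cg p; exact: (@continuousB R R (subspace A) f g p (cf p) (cg p)).
Qed.

(** Functions on an open set D are integrated over the whole space after
    extension by 0. No regularity is lost when they vanish off a compact
    subset of D, since then each point has a neighbourhood inside D or one
    where the extension is 0. *)
Lemma continuous_restrict0 n (D K : set 'rV[R]_n) (g : 'rV[R]_n -> R) :
  open D -> compact K -> K `<=` D ->
  (forall x, D x -> {for x, continuous g}) ->
  (forall x, D x -> ~ K x -> g x = 0) -> continuous (g \_ D).
Proof.
move=> oD cK KD cg gK x.
have hc : closed K by apply: compact_closed => //; exact: norm_hausdorff.
have [Dx|nDx] := pselect (D x).
  apply: (@near_eq_continuous_at _ _ _ g); last exact: cg.
  apply: filterS (open_nbhs_nbhs (conj oD Dx)) => y Dy.
  by rewrite patchE mem_set.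
have nKx : ~ K x by move/KD.
apply: (@near_eq_continuous_at _ _ _ (cst 0)); last exact: cst_continuous.
apply: filterS (open_nbhs_nbhs (conj (closed_openC hc) nKx)) => y nKy.
by rewrite patchE; case: ifPn => //; rewrite inE => Dy; rewrite gK.
Qed.

Lemma is_derive_restrict0 n (D K : set 'rV[R]_n) (g dg : 'rV[R]_n -> R) v x :
  open D -> compact K -> K `<=` D ->
  (forall x, D x -> is_derive x v g (dg x)) ->
  (forall x, D x -> ~ K x -> g x = 0) -> is_derive x v (g \_ D) ((dg \_ D) x).
Proof.
move=> oD cK KD gd gK.
have hc : closed K by apply: compact_closed => //; exact: norm_hausdorff.
have [Dx|nDx] := pselect (D x).
  rewrite patchE mem_set//; apply: (@near_eq_is_derive _ _ _ g); last exact: gd.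
  apply: filterS (open_nbhs_nbhs (conj oD Dx)) => y Dy.
  by rewrite patchE mem_set.
have nKx : ~ K x by move/KD.
rewrite patchE memNset//; apply: (@near_eq_is_derive _ _ _ (cst (0 : R))).
apply: filterS (open_nbhs_nbhs (conj (closed_openC hc) nKx)) => y nKy.
by rewrite patchE; case: ifPn => //; rewrite inE => Dy; rewrite gK.
Qed.

(** The product of E with the exponential of - k t is nonincreasing. The
    hypotheses are on an open interval, as E is only controlled at positive
    times. *)
Lemma gronwall (E dE : R -> R) (a b k s t : R) :
  (forall t, t \in `]a, b[ -> is_derive t 1 E (dE t)) ->
  (forall t, t \in `]a, b[ -> dE t <= k * E t) ->
  a < s -> s <= t -> t < b -> E t * expR (- k * t) <= E s * expR (- k * s).
Proof.
move=> Ed Ek sa st tb.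
pose F x := E x * expR (- k * x).
have Fd x : x \in `]a, b[ -> is_derive x 1 F ((dE x - k * E x) * expR (- k * x)).
  move=> xab; have H1 := Ed _ xab.
  have H2 : is_derive x 1 (fun y : R => expR (- k * y)) (expR (- k * x) * - k).
    apply: (@is_derive1_comp R expR (fun y => - k * y) x (expR (- k * x)) (- k)).
    have := @is_deriveZ _ _ _ id (- k) x 1 1 (is_derive_id _ _).
    by rewrite -[_ *: 1]/(_ * 1) mulr1.
  apply: (is_derive_eq (is_deriveM H1 H2)).
  by rewrite /GRing.scale /=; ring.
have H := @ler0_derive1_le_oo _ F a b.
apply: H => //.
- by move=> x xab; exact: (@ex_derive _ _ _ _ _ _ _ (Fd _ xab)).
- move=> x xab; rewrite derive1E (@derive_val _ _ _ _ _ _ _ (Fd _ xab)).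
  by rewrite mulr_le0_ge0// ?expR_ge0// subr_le0; exact: Ek.
- move=> x xab; apply: differentiable_continuous; apply/derivable1_diffP.
  rewrite inE in xab; exact: (@ex_derive _ _ _ _ _ _ _ (Fd _ xab)).
- by rewrite in_itv/= (lt_le_trans sa st).
- by rewrite in_itv/= sa (le_lt_trans st).
Qed.

Lemma ler_rowint n (f g : 'rV[R]_n -> R) : row_integrable f -> row_integrable g ->
  (forall x, f x <= g x) -> rowint f <= rowint g.
Proof. by move=> If Ig fg; apply: le_Rintegral => // v _; exact: fg. Qed.

Lemma rowintD n (f g : 'rV[R]_n -> R) : row_integrable f -> row_integrable g ->
  row_integrable (fun x => f x + g x) /\ rowint (fun x => f x + g x) = rowint f + rowint g.
Proof.
move=> If Ig; split; last by rewrite /rowint -RintegralD.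
rewrite /row_integrable (_ : _ \o _ =
  (EFin \o (f \o @row_of_tuple R n)) \+ (EFin \o (g \o @row_of_tuple R n)))%E//.
exact: integrableD.
Qed.

Lemma rowintZ n (k : R) (f : 'rV[R]_n -> R) : row_integrable f ->
  row_integrable (fun x => k * f x) /\ rowint (fun x => k * f x) = k * rowint f.
Proof.
move=> If; split; last by rewrite /rowint -RintegralZl.
rewrite /row_integrable (_ : _ \o _ =
  (fun v => k%:E * (EFin \o (f \o @row_of_tuple R n)) v)%E)//.
exact: integrableZl.
Qed.

Lemma rowint_sum0 n (I : Type) (s : seq I) (f : I -> 'rV[R]_n -> R) :
  (forall i, row_integrable (f i)) -> (forall i, rowint (f i) = 0) ->
  row_integrable (fun x => \sum_(i <- s) f i x) /\
  rowint (fun x => \sum_(i <- s) f i x) = 0.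
Proof.
move=> If f0; elim: s => [|i s [IH1 IH2]].
  have E : (fun x : 'rV[R]_n => \sum_(i <- [::]) f i x) = cst 0.
    by apply/funext => x; rewrite big_nil.
  rewrite E; split; last by rewrite /rowint /Rintegral integral0.
  by rewrite /row_integrable; exact: integrable0.
have E : (fun x => \sum_(j <- i :: s) f j x) = (fun x => f i x + \sum_(j <- s) f j x).
  by apply/funext => x; rewrite big_cons.
rewrite E; have [H1 H2] := rowintD (If i) IH1.
by split => //; rewrite H2 f0 IH2 addr0.
Qed.

End calculus.

(** * The comparison principle *)

Section comparison.
Context {R : realType} (n : nat).
Implicit Types (D : set 'rV[R]_n) (u w : 'rV[R]_n -> R -> R).
Local Notation e_ i := (delta_mx 0 i : 'rV[R]_n).

(** The functions ut, ui and zi stand for the time derivative of u, its i-th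
    partial derivative, and the i-th derivative of the i-th component a(u) d_i
    u of the flux. The equation is then ut = sum of the zi, in divergence
    form: it integrates by parts without differentiating a, and solutions and
    barriers fit it alike. *)
Record flux_regular (a : R -> R) D (T : R) u (ut : 'rV[R]_n -> R -> R)
    (ui zi : 'I_n -> 'rV[R]_n -> R -> R) : Prop := FluxRegular {
  flux_continuous : forall x t, D x -> 0 < t < T ->
    {for (x, t), continuous (fun p => u p.1 p.2)} ;
  flux_continuous_t : forall x t, D x -> 0 < t < T ->
    {for (x, t), continuous (fun p => ut p.1 p.2)} ;
  flux_derive_t : forall x t, D x -> 0 < t < T -> is_derive t 1 (u x) (ut x t) ;
  flux_derive : forall i x t, D x -> 0 < t < T ->
    is_derive x (e_ i) (u ^~ t) (ui i x t) ;
  flux_continuous_derive : forall i x t, D x -> 0 < t < T ->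
    {for x, continuous (ui i ^~ t)} ;
  flux_derive2 : forall i x t, D x -> 0 < t < T ->
    is_derive x (e_ i) (fun y => a (u y t) * ui i y t) (zi i x t) ;
  flux_continuous_derive2 : forall i x t, D x -> 0 < t < T ->
    {for x, continuous (zi i ^~ t)} }.

(** The dissipation estimate, for one coordinate: p1 and p2 are the
    derivatives of the two functions, q > 0 is their difference. In a1 p1 - a2
    p2 = a2 (p1 - p2) + (a1 - a2) p1 the first term is coercive and the second
    is at most L q C, so that the product with p1 - p2 is bounded from below
    by completing the square. The symmetric splitting puts p2 in the last
    term: a bound on one of the two gradients is enough, which is essential
    because the gradient of a solution is not controlled as t goes to 0,
    whereas that of a barrier is explicit. *)
Lemma energy_pointwise (d L C a1 a2 q p1 p2 : R) :
  0 < d -> 0 < q -> 0 <= L -> 0 <= C -> d <= a1 -> d <= a2 ->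
  `|a1 - a2| <= L * q -> `|p1| <= C \/ `|p2| <= C ->
  - (2 * q * (p1 - p2) * (a1 * p1 - a2 * p2)) <= (L * C) ^+ 2 / d * q ^+ 3.
Proof.
move=> d0 q0 L0 C0 da1 da2 aL H.
have key (a b c g : R) : d <= a -> `|b| <= L * q -> `|c| <= C ->
    - (2 * q * g * (a * g + b * c)) <= (L * C) ^+ 2 / d * q ^+ 3.
  move=> da bL cC.
  have bc : `|b * c| <= L * q * C by rewrite normrM ler_pM.
  have bc2 : (b * c) ^+ 2 <= (L * q * C) ^+ 2.
    by rewrite -(real_normK (num_real (b * c))) ler_sqr ?nnegrE ?mulr_ge0// ltW.
  have H1 : - (g * (a * g + b * c)) * d <= (b * c) ^+ 2 / 2.
    have : 0 <= (2 * (d * g) + b * c) ^+ 2 by exact: sqr_ge0.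
    have : 0 <= d * ((a - d) * g ^+ 2) by apply: mulr_ge0; [exact: ltW|apply: mulr_ge0; rewrite ?subr_ge0 ?sqr_ge0].
    have : 0 <= (b * c) ^+ 2 by exact: sqr_ge0.
    by move=> h1 h2 h3; lra.
  rewrite -(ler_pM2r d0).
  have -> : (L * C) ^+ 2 / d * q ^+ 3 * d = q * (L * q * C) ^+ 2.
    by field; rewrite gt_eqF.
  have -> : - (2 * q * g * (a * g + b * c)) * d = q * (2 * (- (g * (a * g + b * c)) * d)).
    by ring.
  by rewrite ler_pM2l//; lra.
case: H => [pC|pC].
  have := key a2 (a1 - a2) p1 (p1 - p2) da2 aL pC.
  by apply: le_trans; rewrite le_eqVlt; apply/orP; left; apply/eqP; ring.
have := key a1 (a1 - a2) p2 (p1 - p2) da1 aL pC.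
by apply: le_trans; rewrite le_eqVlt; apply/orP; left; apply/eqP; ring.
Qed.

(** Let q = u - w and let E(t) be the integral of the cube of the positive
    part of q. Its derivative is at most three times the integral of pos q ^ 2
    times the divergence of the difference of the fluxes. Integrating by parts
    against the C^1 function pos q ^ 2 and using energy_pointwise gives E' <=
    k E. By the Gronwall inequality E stays below any number it is close to at
    arbitrarily small times, hence E = 0. The power 3 is the smallest that
    makes the test function C^1. The initial condition enters only through E,
    and the boundary condition only through the compactness of the support of
    pos q. *)
Theorem comparison (a : R -> R) (d L C T : R) D u w ut wt ui wi zu zw :
  open D -> continuous a -> 0 < d -> (forall s, d <= a s) -> 0 <= L -> 0 <= C ->
  flux_regular a D T u ut ui zu -> flux_regular a D T w wt wi zw ->
  (forall x t, D x -> 0 < t < T -> w x t < u x t ->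
    ut x t <= \sum_i zu i x t /\ \sum_i zw i x t <= wt x t) ->
  (forall x t, D x -> 0 < t < T -> w x t < u x t ->
    `|a (u x t) - a (w x t)| <= L * (u x t - w x t)) ->
  (forall i x t, D x -> 0 < t < T -> w x t < u x t ->
    `|ui i x t| <= C \/ `|wi i x t| <= C) ->
  (forall s s', 0 < s -> s' < T -> exists K, [/\ compact K, K `<=` D &
    forall x t, D x -> s <= t <= s' -> w x t < u x t -> K x]) ->
  (forall e s, 0 < e -> 0 < s -> exists t, [/\ 0 < t, t < s &
    rowint ((fun x => pos (u x t - w x t) ^+ 3) \_ D) < e]) ->
  forall x t, D x -> 0 < t < T -> u x t <= w x t.
Proof.
move=> oD ca d0 da L0 C0 ru rw sub aL uwC supp init x0 t0 Dx0 /andP[t00 t0T].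
rewrite leNgt; apply/negP => wu.
pose q x t := u x t - w x t.
pose P t := (fun x => pos (q x t) ^+ 3) \_ D.
pose dP t := (fun x => 3 * (pos (q x t) ^+ 2 * (ut x t - wt x t))) \_ D.
pose E t := rowint (P t).
have contP t : 0 < t < T -> forall x, D x -> {for x, continuous (q ^~ t)}.
  move=> tT x Dx.
  apply: continuousB; apply: continuous_slicel; first exact: (flux_continuous ru).
  exact: (flux_continuous rw).
have suppP s s' : 0 < s -> s' < T -> exists K, [/\ compact K, K `<=` D &
    forall x t, D x -> s <= t <= s' -> ~ K x -> pos (q x t) = 0].
  move=> s0 s'T; have [K [cK KD HK]] := supp s s' s0 s'T.
  exists K; split => // x t Dx st nKx; apply: pos_le0; rewrite subr_le0 leNgt.
  by apply/negP => /(HK _ _ Dx st).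
have contPt t : 0 < t < T -> continuous (P t).
  move=> /andP[tp tT]; have [K [cK KD HK]] := suppP t t tp tT.
  apply: (continuous_restrict0 oD cK KD) => x Dx.
    have cq : {for x, continuous (q ^~ t)} by apply: contP => //; rewrite tp.
    by apply: (@continuous_comp _ _ _ (q ^~ t) (fun r => pos r ^+ 3) x cq); exact: continuous_posX.
  by move=> nKx; rewrite HK ?lexx// expr0n.
have intP t : 0 < t < T -> row_integrable (P t).
  move=> /andP[tp tT]; have [K [cK KD HK]] := suppP t t tp tT.
  apply: (continuous_row_integrable cK); first by apply: contPt; rewrite tp.
  move=> x nKx; rewrite /P patchE; case: ifPn => //; rewrite inE => Dx.
  by rewrite HK ?lexx// expr0n.
pose k := 3 * (n%:R * ((L * C) ^+ 2 / d)).
have k0 : 0 <= k by rewrite !mulr_ge0// ?sqr_ge0// invr_ge0 ltW.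
have dE t : 0 < t < T -> row_integrable (dP t) -> rowint (dP t) <= k * E t.
  move=> /andP[tp tT] IdP; have tT' : 0 < t < T by rewrite tp.
  have [K [cK KD HK]] := suppP t t tp tT.
  (* G is the vector field whose divergence, the sum of the S i, has integral
     0: this is the integration by parts. *)
  pose Zi i x := a (u x t) * ui i x t - a (w x t) * wi i x t.
  pose qi i x := ui i x t - wi i x t.
  pose S i x := pos (q x t) ^+ 2 * (zu i x t - zw i x t) +
                 Zi i x * (2 * pos (q x t) * qi i x).
  pose G i x := pos (q x t) ^+ 2 * Zi i x.
  have cu x : D x -> {for x, continuous (u ^~ t)}.
    by move=> Dx; apply: continuous_slicel; exact: (flux_continuous ru).
  have cw x : D x -> {for x, continuous (w ^~ t)}.
    by move=> Dx; apply: continuous_slicel; exact: (flux_continuous rw).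
  have cZ i x : D x -> {for x, continuous (Zi i)}.
    move=> Dx; apply: continuousB; apply: continuousM.
    - by apply: (@continuous_comp _ _ _ (u ^~ t) a x (cu x Dx)); exact: ca.
    - exact: (flux_continuous_derive ru).
    - by apply: (@continuous_comp _ _ _ (w ^~ t) a x (cw x Dx)); exact: ca.
    - exact: (flux_continuous_derive rw).
  have cpos m x : D x -> {for x, continuous (fun y => pos (q y t) ^+ m)}.
    move=> Dx; apply: (@continuous_comp _ _ _ (q ^~ t) (fun r => pos r ^+ m) x (contP t tT' x Dx)).
    exact: continuous_posX.
  have cG i : continuous (G i \_ D).
    apply: (continuous_restrict0 oD cK KD) => x Dx.
      by apply: continuousM; [exact: cpos|exact: cZ].
    by move=> nKx; rewrite /G HK ?lexx// expr0n mul0r.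
  have GK i x : ~ K x -> (G i \_ D) x = 0.
    move=> nKx; rewrite patchE; case: ifPn => //; rewrite inE => Dx.
    by rewrite /G HK ?lexx// expr0n mul0r.
  have S0 i x : D x -> ~ K x -> S i x = 0.
    by move=> Dx nKx; rewrite /S HK ?lexx// expr0n mulr0 !mul0r mulr0 addr0.
  have cS i : continuous (S i \_ D).
    apply: (continuous_restrict0 oD cK KD) => x Dx; last exact: S0.
    apply: continuousD; apply: continuousM.
    - exact: cpos.
    - apply: continuousB; first exact: (flux_continuous_derive2 ru).
      exact: (flux_continuous_derive2 rw).
    - exact: cZ.
    - apply: continuousM; first by apply: continuousM; [exact: cst_continuous|exact: (cpos 1%N)].
      apply: continuousB; first exact: (flux_continuous_derive ru).
      exact: (flux_continuous_derive rw).
  have SK i x : ~ K x -> (S i \_ D) x = 0.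
    by move=> nKx; rewrite patchE; case: ifPn => //; rewrite inE => Dx; exact: S0.
  have dG i x : is_derive x (e_ i) (G i \_ D) ((S i \_ D) x).
    apply: (@is_derive_restrict0 _ n D K (G i) (S i) (e_ i) x oD cK KD) => [y Dy|y Dy nKy]; last first.
      by rewrite /G HK ?lexx// expr0n mul0r.
    have H1 : is_derive y (e_ i) (fun x => pos (q x t) ^+ 2) (2 * pos (q y t) * qi i y).
      apply: (@is_derive_comp _ _ (fun r => pos r ^+ 2) (q ^~ t)).
        exact: (is_derive_posX 0).
      by apply: is_deriveB; [exact: (flux_derive ru)|exact: (flux_derive rw)].
    have H2 : is_derive y (e_ i) (Zi i) (zu i y t - zw i y t).
      by apply: is_deriveB; [exact: (flux_derive2 ru)|exact: (flux_derive2 rw)].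
    exact: (is_derive_eq (is_deriveM H1 H2)).
  have intS i : row_integrable (S i \_ D).
    exact: (continuous_row_integrable cK (cS i) (SK i)).
  have intS0 i : rowint (S i \_ D) = 0.
    exact: (rowint_partial cK (cG i) (cS i) (GK i) (dG i)).
  have [H1 H2] := rowint_sum0 (index_enum 'I_n) intS intS0.
  have [H3 H4] := rowintZ 3 H1.
  have [H5 H6] := rowintZ k (intP t tT').
  have [H7 H8] := rowintD H3 H5.
  rewrite -[leRHS]add0r -[X in X + _](mulr0 3) -[X in 3 * X]H2 -H4 -H6 -H8.
  apply: ler_rowint => // x; rewrite /dP /P !patchE.
  case: ifPn => [|nDx]; last first.
    rewrite mulr0 addr0 big1 ?mulr0// => i _.
    by rewrite patchE (negbTE nDx).
  move=> /[dup] iDx; rewrite inE => Dx.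
  rewrite (eq_bigr (S ^~ x)); last by move=> i _; rewrite patchE iDx.
  have [q0|q0] := leP (q x t) 0.
    rewrite /S (pos_le0 q0) !expr0n /= !mul0r !mulr0 big1// => i _.
    by rewrite !mul0r mulr0 addr0.
  rewrite (pos_id (ltW q0)).
  have wux : w x t < u x t by rewrite -subr_gt0.
  have [s1 s2] := sub x t Dx tT' wux.
  have B1 : q x t ^+ 2 * (ut x t - wt x t) <= \sum_(i < n) q x t ^+ 2 * (zu i x t - zw i x t).
    by rewrite -mulr_sumr sumrB ler_pM2l ?exprn_gt0// lerB.
  have B2 : - (n%:R * ((L * C) ^+ 2 / d * q x t ^+ 3)) <=
      \sum_(i < n) Zi i x * (2 * q x t * qi i x).
    have -> : n%:R * ((L * C) ^+ 2 / d * q x t ^+ 3) =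
        \sum_(i < n) (L * C) ^+ 2 / d * q x t ^+ 3.
      by rewrite sumr_const card_ord mulr_natl.
    rewrite lerNl -sumrN; apply: ler_sum => i _; rewrite mulrC.
    exact: (energy_pointwise d0 q0 L0 C0 (da _) (da _) (aL _ _ Dx tT' wux) (uwC i _ _ Dx tT' wux)).
  have -> : \sum_(i < n) S i x = \sum_(i < n) q x t ^+ 2 * (zu i x t - zw i x t) +
      \sum_(i < n) Zi i x * (2 * q x t * qi i x).
    by rewrite -big_split; apply: eq_bigr => i _; rewrite /S (pos_id (ltW q0)).
  by rewrite /k; move: B1 B2; rewrite !mulrA => B1 B2; lra.
have Et0 : 0 < E t0.
  have [K [cK KD HK]] := suppP t0 t0 t00 t0T.
  apply: (@rowint_gt0 _ _ _ K x0 cK).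
  - by apply: contPt; rewrite t00.
  - move=> x nKx; rewrite /P patchE; case: ifPn => //; rewrite inE => Dx.
    by rewrite HK ?lexx// expr0n.
  - by move=> x; rewrite /P patchE; case: ifPn => // _; rewrite exprn_ge0// pos_ge0.
  - by rewrite /P patchE mem_set// exprn_gt0// pos_id ?subr_gt0// subr_ge0 ltW.
have [t1 [t10 t1t0]] := init (E t0 * expR (- k * t0)) t0 (mulr_gt0 Et0 (expR_gt0 _)) t00.
rewrite -/(P t1) -/(E t1) => Et1.
(* Differentiating E needs a bound on the integrand, which holds on compact
   subintervals of the time interval only. *)
pose T' := (t0 + T) / 2.
have [t0T' T'T] : t0 < T' /\ T' < T by rewrite /T'; split; lra.
have t12 : 0 < t1 / 2 < t1 by apply/andP; split; lra.
have [K [cK KD HK]] := suppP (t1 / 2) T' ltac:(lra) T'T.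
have sub' t : t \in `](t1 / 2), T'[ -> 0 < t < T /\ t1 / 2 <= t <= T'.
  rewrite in_itv/= => /andP[h1 h2]; rewrite (ltW h1) (ltW h2).
  by rewrite (lt_trans (andP t12).1 h1) (lt_trans h2 T'T).
have cdP x t : D x -> 0 < t < T ->
    {for (x, t), continuous (fun p => 3 * (pos (q p.1 p.2) ^+ 2 * (ut p.1 p.2 - wt p.1 p.2)))}.
  move=> Dx tT; apply: continuousM; first exact: cst_continuous.
  apply: continuousM.
    apply: (@continuous_comp _ _ _ (fun p => q p.1 p.2) (fun r => pos r ^+ 2) (x, t)).
      by apply: continuousB; [exact: (flux_continuous ru)|exact: (flux_continuous rw)].
    exact: continuous_posX.
  by apply: continuousB; [exact: (flux_continuous_t ru)|exact: (flux_continuous_t rw)].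
have [M M0 HM] : exists2 M : R, 0 < M & forall p, (K `*` `[t1 / 2, T']%classic) p ->
    `|3 * (pos (q p.1 p.2) ^+ 2 * (ut p.1 p.2 - wt p.1 p.2))| <= M.
  apply: continuous_compact_bounded.
    by apply: compact_setX => //; exact: segment_compact.
  apply: continuous_in_subspaceT => -[x t]; rewrite inE /= in_itv/= => -[Kx /andP[h1 h2]].
  apply: cdP; first exact: KD.
  by rewrite (lt_le_trans (andP t12).1 h1) (le_lt_trans h2 T'T).
have cdPx t : 0 < t < T -> continuous (dP t).
  move=> tT; have [K1 [cK1 K1D HK1]] := suppP t t (andP tT).1 (andP tT).2.
  apply: (continuous_restrict0 oD cK1 K1D) => x Dx.
    exact: (@continuous_slicel _ _ _ (fun x t => 3 * (pos (q x t) ^+ 2 * (ut x t - wt x t))) x t (cdP x t Dx tT)).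
  by move=> nKx; rewrite HK1 ?lexx// expr0n mul0r mulr0.
have Ed t : t \in `](t1 / 2), T'[ -> is_derive t 1 E (rowint (dP t)).
  apply: (@rowint_is_derive _ _ P dP K (t1 / 2) T' M cK).
  - by move=> s /sub'[sT _]; exact: contPt.
  - move=> s x /sub'[_ sT'] nKx; rewrite /P patchE; case: ifPn => //; rewrite inE => Dx.
    by rewrite (HK _ _ Dx sT' nKx) expr0n.
  - move=> s x /sub'[sT _]; rewrite /P /dP; have [Dx|nDx] := pselect (D x).
      rewrite patchE mem_set//.
      rewrite (_ : (fun _ => _) = (fun r => pos r ^+ 3) \o q x); last first.
        by apply/funext => r; rewrite patchE mem_set.
      rewrite mulrA; apply: is_derive1_comp; first exact: (is_derive_posX 1).
      by apply: is_deriveB; [exact: (flux_derive_t ru)|exact: (flux_derive_t rw)].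
    rewrite patchE memNset// (_ : (fun _ => _) = cst (0 : R)); first exact: is_derive_cst.
    by apply/funext => r; rewrite patchE memNset.
  - move=> s x /sub'[sT sT']; rewrite /dP patchE; case: ifPn => [|_]; last by rewrite normr0 ltW.
    rewrite inE => Dx; have [Kx|nKx] := pselect (K x).
      by apply: (HM (x, s)); split => //=; rewrite in_itv.
    by rewrite (HK _ _ Dx sT' nKx) expr0n mul0r mulr0 normr0 ltW.
  - move=> s x /sub'[sT sT'] nKx; rewrite /dP patchE; case: ifPn => //; rewrite inE => Dx.
    by rewrite (HK _ _ Dx sT' nKx) expr0n mul0r mulr0.
have IdP t : t \in `](t1 / 2), T'[ -> row_integrable (dP t).
  move=> /sub'[tT tT']; apply: (continuous_row_integrable cK (cdPx _ tT)) => x nKx.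
  rewrite /dP patchE; case: ifPn => //; rewrite inE => Dx.
  by rewrite (HK _ _ Dx tT' nKx) expr0n mul0r mulr0.
have := @gronwall _ E (fun t => rowint (dP t)) (t1 / 2) T' k t1 t0 Ed.
have dEk t : t \in `](t1 / 2), T'[ -> rowint (dP t) <= k * E t.
  by move=> tt; apply: dE; [exact: (sub' _ tt).1|exact: IdP].
move=> /(_ dEk (andP t12).2 (ltW t1t0) t0T').
have Et1' : E t1 * expR (- k * t1) <= E t1.
  rewrite ler_piMr//.
    apply: Rintegral_ge0 => v _; rewrite /P patchE; case: ifPn => // _.
    by rewrite exprn_ge0// pos_ge0.
  by rewrite -expR0 ler_expR mulNr oppr_le0 mulr_ge0// ltW.
by move=> /le_trans/(_ Et1'); rewrite leNgt Et1.
Qed.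

End comparison.

(** * The pressure and its inverse *)

Section pressure.
Context {R : realType}.
Local Notation mu := (@lebesgue_measure R).

(** The diffusivity a is a parameter, instead of the derivative of a fixed
    phi, because an affine change of the solution changes a. *)
Definition pressure (a : R -> R) (s : R) : R :=
  if 1 <= s then \int[mu]_(xi in `[1, s]) (a xi / xi)
  else - \int[mu]_(xi in `[s, 1]) (a xi / xi).

Lemma le_of_derive_ge0 (g dg : R -> R) (s r : R) :
  (forall x, s <= x <= r -> is_derive x 1 g (dg x)) ->
  (forall x, s <= x <= r -> 0 <= dg x) -> s <= r -> g s <= g r.
Proof.
move=> gd g0 sr.
have H := @ger0_derive1_le_cc _ g s r.
apply: H => //.
- by move=> x; rewrite in_itv/= => /andP[sx xr]; apply: (@ex_derive _ _ _ _ _ _ _ (gd x _)); rewrite !ltW.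
- move=> x; rewrite in_itv/= => /andP[sx xr]; have sxr : s <= x <= r by rewrite !ltW.
  by rewrite derive1E (@derive_val _ _ _ _ _ _ _ (gd x sxr)); exact: g0.
- apply: derivable_within_continuous => x; rewrite in_itv/= => sxr.
  exact: (@ex_derive _ _ _ _ _ _ _ (gd x sxr)).
- by rewrite in_itv/= lexx.
- by rewrite in_itv/= sr lexx.
Qed.

Variables (a : R -> R) (d1 d2 : R).
Hypothesis ca : continuous a.
Hypothesis d10 : 0 < d1.
Hypothesis ab : forall s, d1 <= a s <= d2.

Lemma flux_gt0 s : 0 < a s.
Proof. by case/andP: (ab s) => + _; exact: lt_le_trans. Qed.

Lemma flux_neq0 s : a s != 0.
Proof. by rewrite gt_eqF// flux_gt0. Qed.

Lemma continuous_ratio (x : R) : 0 < x -> {for x, continuous (fun xi => a xi / xi)}.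
Proof.
move=> x0; apply: continuousM; first exact: ca.
by apply: inv_continuous; rewrite gt_eqF.
Qed.

Lemma integrable_ratio (c x : R) : 0 < c ->
  mu.-integrable `[c, x] (EFin \o (fun xi => a xi / xi)).
Proof.
move=> c0; apply: continuous_compact_integrable; first exact: segment_compact.
apply: continuous_in_subspaceT => y; rewrite inE /= in_itv/= => /andP[cy _].
by apply: continuous_ratio; exact: lt_le_trans cy.
Qed.

Lemma Rintegral_ratioB (c x y : R) : 0 < c -> c <= x -> x <= y ->
  \int[mu]_(xi in `[c, y]) (a xi / xi) - \int[mu]_(xi in `[c, x]) (a xi / xi) =
  \int[mu]_(xi in `[x, y]) (a xi / xi).
Proof.
move=> c0 cx xy; rewrite Rintegral_itvB//; [|exact: integrable_ratio].
rewrite Rintegral_itv_obnd_cbnd//.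
apply: integrableS (integrable_ratio y c0) => //.
by apply: subset_itvr; rewrite bnd_simp.
Qed.

(** With a base point c below both 1 and s, the two orientations of the
    integral are given by a single primitive, whose derivative can be taken
    across 1. *)
Lemma pressureE (c s : R) : 0 < c -> c <= 1 -> c <= s ->
  pressure a s = \int[mu]_(xi in `[c, s]) (a xi / xi) -
                 \int[mu]_(xi in `[c, 1]) (a xi / xi).
Proof.
move=> c0 c1 cs; rewrite /pressure; case: ifPn => [s1|].
  by rewrite Rintegral_ratioB.
by rewrite -ltNge => /ltW s1; rewrite -(Rintegral_ratioB c0 cs s1) opprB.
Qed.

Lemma is_derive_pressure (s : R) : 0 < s -> is_derive s 1 (pressure a) (a s / s).
Proof.
move=> s0; pose c := Num.min s 1 / 2.
have m0 : 0 < Num.min s 1 by rewrite lt_min s0 ltr01.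
have c0 : 0 < c by rewrite divr_gt0.
have cm : c < Num.min s 1 by rewrite /c ltr_pdivrMr// ltr_pMr// (ltr_nat _ 1 2).
have [cs c1] : c < s /\ c < 1 by move: cm; rewrite lt_min => /andP[].
have [H1 H2] := @continuous_FTC1_closed _ _ c s (s + 1) (ltr_pwDr ltr01 (lexx _))
  (integrable_ratio (s + 1) c0) cs (continuous_ratio s0).
pose F x := \int[mu]_(xi in `[c, x]) (a xi / xi) : R.
have HF : is_derive s 1 F (a s / s).
  split; first exact: H1.
  rewrite -derive1E; exact: H2.
have HG : is_derive s 1 (F - cst (F 1)) (a s / s - 0).
  by apply: is_deriveB => //; exact: is_derive_cst.
rewrite subr0 in HG; apply: near_eq_is_derive HG.
by near=> x; apply/esym/pressureE; [by []|exact: ltW|apply: ltW; near: x; exact: lt_nbhsr].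
Unshelve. all: by end_near. Qed.

Lemma pressure1 : pressure a 1 = 0.
Proof. by rewrite /pressure lexx set_itv1 Rintegral_set1. Qed.

Lemma ler_pressureB (k s r : R) : 0 < s -> s <= r ->
  (forall x, s <= x <= r -> k <= a x) ->
  k * (ln r - ln s) <= pressure a r - pressure a s.
Proof.
move=> s0 sr ka.
have : pressure a s - k * ln s <= pressure a r - k * ln r.
  apply: (@le_of_derive_ge0 (fun x => pressure a x - k * ln x) (fun x => a x / x - k * x^-1)) => //.
    move=> x /andP[sx xr]; have x0 : 0 < x by exact: lt_le_trans sx.
    apply: is_deriveB; first exact: is_derive_pressure.
    by apply: is_deriveZ; exact: is_derive1_ln.
  move=> x sxr; have x0 : 0 < x by case/andP: sxr => + _; exact: lt_le_trans.
  by rewrite -mulrBl mulr_ge0 ?invr_ge0 ?(ltW x0)// subr_ge0; exact: ka.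
by lra.
Qed.

Lemma pressure_homo (s r : R) : 0 < s -> s < r -> pressure a s < pressure a r.
Proof.
move=> s0 sr; rewrite -subr_gt0.
have : d1 * (ln r - ln s) <= pressure a r - pressure a s.
  by apply: ler_pressureB => //; [exact: ltW|move=> x _; case/andP: (ab x)].
apply: lt_le_trans; rewrite mulr_gt0// subr_gt0 ltr_ln// posrE//.
exact: lt_trans sr.
Qed.

Lemma pressure_inj (s r : R) : 0 < s -> 0 < r -> pressure a s = pressure a r -> s = r.
Proof.
move=> s0 r0 E; apply/eqP; rewrite eq_le !leNgt; apply/andP; split; apply/negP.
  by move=> /(pressure_homo r0); rewrite E ltxx.
by move=> /(pressure_homo s0); rewrite E ltxx.
Qed.

Lemma pressure_ge (s : R) : 1 <= s -> d1 * ln s <= pressure a s.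
Proof.
move=> s1; have : d1 * (ln s - ln 1) <= pressure a s - pressure a 1.
  by apply: ler_pressureB => // x _; case/andP: (ab x).
by rewrite ln1 pressure1 !subr0.
Qed.

Lemma pressure_le (s : R) : 0 < s -> s <= 1 -> pressure a s <= d1 * ln s.
Proof.
move=> s0 s1; have : d1 * (ln 1 - ln s) <= pressure a 1 - pressure a s.
  by apply: ler_pressureB => // x _; case/andP: (ab x).
by rewrite ln1 pressure1 !sub0r mulrN lerN2.
Qed.

Lemma pressure_lower (s : R) : 0 < s -> s <= 1 -> d2 * ln s <= pressure a s.
Proof.
move=> s0 s1.
have : (fun x => d2 * ln x - pressure a x) s <= (fun x => d2 * ln x - pressure a x) 1.
  apply: (@le_of_derive_ge0 (fun x => d2 * ln x - pressure a x) (fun x => d2 * x^-1 - a x / x)) => //.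
    move=> x /andP[sx xr]; have x0 : 0 < x by exact: lt_le_trans sx.
    apply: is_deriveB; last exact: is_derive_pressure.
    by apply: is_deriveZ; exact: is_derive1_ln.
  move=> x /andP[sx _]; have x0 : 0 < x by exact: lt_le_trans sx.
  rewrite -mulrBl mulr_ge0 ?invr_ge0 ?(ltW x0)// subr_ge0.
  by case/andP: (ab x).
by rewrite /= ln1 mulr0 pressure1 subrr subr_le0.
Qed.

(** The difference is the integral of (a x - a0) / x between s and 1, and the
    integrand is at most L. So the pressure is a0 ln s up to an error that
    does not depend on s. *)
Lemma pressure_ln (a0 L s : R) : 0 < s -> s <= 1 -> 0 <= L ->
  (forall x, s <= x <= 1 -> `|a x - a0| <= L * x) ->
  `|pressure a s - a0 * ln s| <= L.
Proof.
move=> s0 s1 L0 aL.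
have H (e : R) : `|e| = 1 ->
    e * (pressure a s - a0 * ln s) + L * s <= L.
  move=> e1.
  have : (fun x => e * (pressure a x - a0 * ln x) + L * x) s <=
         (fun x => e * (pressure a x - a0 * ln x) + L * x) 1.
    apply: (@le_of_derive_ge0 (fun x => e * (pressure a x - a0 * ln x) + L * x) (fun x => e * (a x / x - a0 * x^-1) + L * 1)) => //.
      move=> x /andP[sx xr]; have x0 : 0 < x by exact: lt_le_trans sx.
      apply: is_deriveD.
        apply: is_deriveZ; apply: is_deriveB; first exact: is_derive_pressure.
        by apply: is_deriveZ; exact: is_derive1_ln.
    move=> x sx; have x0 : 0 < x by case/andP: sx => + _; exact: lt_le_trans.
    have := aL x sx; rewrite -mulrBl mulr1 mulrA => H.
    rewrite -lerBlDr sub0r -(ler_pM2r x0) mulfVK ?gt_eqF// mulNr.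
    by apply: lerNnormlW; rewrite normrM e1 mul1r.
  by rewrite /= ln1 pressure1 mulr0 subr0 mulr0 add0r mulr1.
have Ls : 0 <= L * s by rewrite mulr_ge0// ltW.
rewrite ler_norml; apply/andP; split.
  by have := H (-1); rewrite normrN1 mulN1r => /(_ erefl); lra.
by have := H 1; rewrite normr1 mul1r => /(_ erefl); lra.
Qed.

Lemma continuous_pressure (s : R) : 0 < s -> {for s, continuous (pressure a)}.
Proof.
move=> s0; apply: differentiable_continuous; apply/derivable1_diffP.
exact: (@ex_derive _ _ _ _ _ _ _ (is_derive_pressure s0)).
Qed.

(** The bounds on a compare the pressure with multiples of the logarithm,
    which forces it to go to both infinities. *)
Lemma pressure_surj (p : R) : exists s, 0 < s /\ pressure a s = p.
Proof.
pose y := `|p| / d1; have y0 : 0 <= y by rewrite divr_ge0// ltW.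
have yd : d1 * y = `|p| by rewrite mulrC mulfVK// gt_eqF.
have e1 : expR (- y) <= 1 by rewrite -expR0 ler_expR oppr_le0.
have e2 : 1 <= expR y by rewrite -expR0 ler_expR.
have H1 : pressure a (expR (- y)) <= - `|p|.
  by have := pressure_le (expR_gt0 _) e1; rewrite expRK mulrN yd.
have H2 : `|p| <= pressure a (expR y).
  by have := pressure_ge e2; rewrite expRK yd.
have H3 : pressure a (expR (- y)) <= pressure a (expR y).
  by apply: le_trans H1 (le_trans _ H2); apply: (@le_trans _ _ 0); rewrite ?oppr_le0.
have [] := @IVT _ (pressure a) (expR (- y)) (expR y) p (le_trans e1 e2).
- apply: continuous_in_subspaceT => x; rewrite inE /= in_itv/= => /andP[ex _].
  by apply: continuous_pressure; exact: lt_le_trans (expR_gt0 _) ex.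
- rewrite min_l// max_r//; apply/andP; split.
    by apply: le_trans H1 _; rewrite lerNl -normrN ler_norm.
  by apply: le_trans H2; exact: ler_norm.
- move=> s; rewrite in_itv/= => /andP[es _] E; exists s; split=> //.
  exact: lt_le_trans (expR_gt0 _) es.
Qed.

Definition density (p : R) : R := sval (cid (pressure_surj p)).

Lemma density_gt0 p : 0 < density p.
Proof. by rewrite /density; case: cid => s [] /=. Qed.

Lemma densityK p : pressure a (density p) = p.
Proof. by rewrite /density; case: cid => s [] /=. Qed.

Lemma pressureK s : 0 < s -> density (pressure a s) = s.
Proof. by move=> s0; apply: pressure_inj; rewrite ?density_gt0 ?densityK. Qed.

Lemma density_homo p q : p < q -> density p < density q.
Proof.
move=> pq; rewrite ltNge le_eqVlt; apply/negP => /predU1P[E|].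
  by move: pq; rewrite -[p]densityK -[q]densityK E ltxx.
by move=> /(pressure_homo (density_gt0 _)); rewrite !densityK ltNge (ltW pq).
Qed.

(** In the form a(S) S' = S, with S the density, this makes the flux of S(p)
    equal to S(p) times the gradient of p. *)
Lemma is_derive_density (p : R) :
  is_derive p 1 density (density p / a (density p)).
Proof.
have s0 := density_gt0 p.
rewrite -[X in is_derive X](densityK p) -invf_div.
apply: is_derive_inverse.
- by near=> x; apply: pressureK; near: x; exact: lt_nbhsr.
- by near=> x; apply: continuous_pressure; near: x; exact: lt_nbhsr.
- exact: is_derive_pressure.
- by rewrite mulf_neq0// ?invr_neq0// gt_eqF// flux_gt0.
Unshelve. all: by end_near. Qed.

Lemma continuous_density : continuous density.
Proof.
move=> p; apply: differentiable_continuous; apply/derivable1_diffP.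
exact: (@ex_derive _ _ _ _ _ _ _ (is_derive_density p)).
Qed.

End pressure.

(** * Paraboloid barriers *)

Section barrier.
Context {R : realType} (n : nat).
Variables (a : R -> R) (d1 d2 : R).
Hypothesis ca : continuous a.
Hypothesis d10 : 0 < d1.
Hypothesis ab : forall s, d1 <= a s <= d2.
Local Notation S := (density ca d10 ab).
Local Notation e_ i := (delta_mx 0 i : 'rV[R]_n).

Definition sqdist (y x : 'rV[R]_n) : R := \sum_(i < n) (x 0 i - y 0 i) ^+ 2.

Lemma sqdist_ge0 y x : 0 <= sqdist y x.
Proof. by apply: sumr_ge0 => i _; exact: sqr_ge0. Qed.

Lemma is_derive_coord (x : 'rV[R]_n) i j :
  is_derive x (e_ i) (fun x : 'rV[R]_n => x 0 j) (j == i)%:R.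
Proof.
apply/is_derive_lineP.
rewrite (_ : (fun _ => _) = cst (x 0 j) + (fun h => (j == i)%:R * h)); last first.
  by apply/funext => h; rewrite addrfctE !mxE eqxx /= mulrC.
rewrite -[X in is_derive _ _ _ X]add0r; apply: is_deriveD.
have := @is_deriveZ _ _ _ id ((j == i)%:R) (0 : R) 1 1 (is_derive_id _ _).
by rewrite /GRing.scale /= mulr1.
Qed.

Lemma is_derive_sqdist (y x : 'rV[R]_n) i :
  is_derive x (e_ i) (sqdist y) (2 * (x 0 i - y 0 i)).
Proof.
pose h (j : 'I_n) (x : 'rV[R]_n) : R := (x 0 j - y 0 j) ^+ 2.
have hd j : is_derive x (e_ i) (h j) (2 * (x 0 j - y 0 j) * (j == i)%:R).
  have H : is_derive x (e_ i) (fun x : 'rV[R]_n => x 0 j - y 0 j) ((j == i)%:R - 0).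
    by apply: is_deriveB; exact: is_derive_coord.
  have := is_deriveX 2 H.
  rewrite subr0 (_ : _ ^+ 2 = h j); last by apply/funext => z; rewrite exprfctE.
  by rewrite /GRing.scale /= expr1.
have -> : sqdist y = \sum_(j < n) h j.
  by apply/funext => z; rewrite /sqdist fct_sumE.
apply: (is_derive_eq (is_derive_sum hd)).
rewrite (bigD1 i)//= eqxx mulr1 big1 ?addr0// => j ji.
by rewrite (negbTE ji) mulr0.
Qed.

Lemma continuous_sqdist (y : 'rV[R]_n) : continuous (sqdist y).
Proof.
have cterm i : continuous (fun x : 'rV[R]_n => (x 0 i - y 0 i) ^+ 2).
  move=> x.
  apply: (@continuous_comp _ _ _ (fun x : 'rV[R]_n => x 0 i - y 0 i) (fun r : R => r ^+ 2)).
    by apply: continuousB; [exact: coord_continuous|exact: cst_continuous].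
  exact: exprn_continuous.
rewrite /sqdist => x; elim: (index_enum _) => [|i s IH].
  rewrite (_ : (fun x => _) = cst (0 : R)); first exact: cst_continuous.
  by apply/funext => z; rewrite big_nil.
rewrite (_ : (fun x => _) = (fun x : 'rV[R]_n => (x 0 i - y 0 i) ^+ 2 +
    \sum_(j <- s) (x 0 j - y 0 j) ^+ 2)).
  exact: (@continuousD _ _ _ (fun x : 'rV[R]_n => (x 0 i - y 0 i) ^+ 2) _ x (cterm i x) IH).
by apply/funext => z; rewrite big_cons.
Qed.

(** The pressure p of a solution satisfies p_t = a Delta p + |grad p|^2. For p
    = A(t) |x - y|^2 + B(t) the gradient term is 4 A^2 |x - y|^2, cancelled by
    A' = 4 A^2, and a Delta p = 2 n a A, which B' = 2 n d2 A bounds from above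
    or from below according to the sign of A. *)
Variables (y : 'rV[R]_n) (A B : R -> R) (T : R).
Hypothesis dA : forall t, 0 < t < T -> is_derive t 1 A (4 * A t ^+ 2).
Hypothesis dB : forall t, 0 < t < T -> is_derive t 1 B (2 * n%:R * d2 * A t).

Definition paraboloid x t := A t * sqdist y x + B t.
Definition barrier x t := S (paraboloid x t).
Let S1 (p : R) : R := S p / a (S p).
Definition barrier_t x t :=
  S1 (paraboloid x t) * (4 * A t ^+ 2 * sqdist y x + 2 * n%:R * d2 * A t).
Definition barrier_i (i : 'I_n) (x : 'rV[R]_n) t :=
  S1 (paraboloid x t) * (2 * A t * (x 0 i - y 0 i)).
(** The i-th derivative of the i-th component of the flux of the barrier,
    which is S(p) d_i p. *)
Definition barrier_ii (i : 'I_n) (x : 'rV[R]_n) t :=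
  S1 (paraboloid x t) * (2 * A t * (x 0 i - y 0 i)) ^+ 2 + S (paraboloid x t) * (2 * A t).

Lemma continuous_density1 : continuous S1.
Proof.
move=> p; apply: continuousM; first exact: continuous_density.
apply: (@continuous_comp _ _ _ (fun p => a (S p)) (fun r : R => r^-1)).
  by apply: (@continuous_comp _ _ _ S a); [exact: continuous_density|exact: ca].
by apply: inv_continuous; rewrite gt_eqF// (flux_gt0 d10 ab).
Qed.

Lemma is_derive_continuous (f : R -> R) (t d : R) : is_derive t 1 f d -> {for t, continuous f}.
Proof.
move=> H; apply: differentiable_continuous; apply/derivable1_diffP.
exact: (@ex_derive _ _ _ _ _ _ _ H).
Qed.

Let cA t : 0 < t < T -> {for t, continuous A}.
Proof. by move=> /dA; exact: is_derive_continuous. Qed.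

Let cAxt (x : 'rV[R]_n) (t : R) : 0 < t < T -> {for (x, t), continuous (fun p => A p.2)}.
Proof.
move=> tT; apply: (@continuous_comp _ _ _ snd A (x, t)); last exact: cA.
exact: cvg_snd.
Qed.

Let csxt (x : 'rV[R]_n) (t : R) : {for (x, t), continuous (fun p => sqdist y p.1)}.
Proof.
apply: (@continuous_comp _ _ _ fst (sqdist y) (x, t)); last exact: continuous_sqdist.
exact: cvg_fst.
Qed.

Let cp x t : 0 < t < T -> {for (x, t), continuous (fun p => paraboloid p.1 p.2)}.
Proof.
move=> tT; apply: continuousD.
  by apply: continuousM; [exact: cAxt|exact: csxt].
apply: (@continuous_comp _ _ _ snd B (x, t)); first exact: cvg_snd.
exact: is_derive_continuous (dB tT).
Qed.

Lemma continuous_barrier x t : 0 < t < T ->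
  {for (x, t), continuous (fun p => barrier p.1 p.2)}.
Proof.
move=> tT; apply: (@continuous_comp _ _ _ (fun p => paraboloid p.1 p.2) S (x, t)).
  exact: cp.
exact: continuous_density.
Qed.

Let cpx (x : 'rV[R]_n) t : 0 < t < T -> {for x, continuous (paraboloid ^~ t)}.
Proof. by move=> tT; apply: continuous_slicel; exact: cp. Qed.

Let dpi i (x : 'rV[R]_n) t : is_derive x (e_ i) (paraboloid ^~ t) (2 * A t * (x 0 i - y 0 i)).
Proof.
have H := is_deriveD (is_deriveZ (A t) (is_derive_sqdist y x i)) (is_derive_cst (B t) x (e_ i)).
by apply: (is_derive_eq H); rewrite /GRing.scale /=; ring.
Qed.

Lemma barrier_regular (D : set 'rV[R]_n) :
  flux_regular a D T barrier barrier_t barrier_i barrier_ii.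
Proof.
have cS1 (x : 'rV[R]_n) t : 0 < t < T -> {for x, continuous (fun x => S1 (paraboloid x t))}.
  move=> tT; apply: (@continuous_comp _ _ _ (paraboloid ^~ t) S1 x); first exact: cpx.
  exact: continuous_density1.
have clin i (x : 'rV[R]_n) t : {for x, continuous (fun x : 'rV[R]_n => 2 * A t * (x 0 i - y 0 i))}.
  apply: continuousM; first exact: cst_continuous.
  by apply: continuousB; [exact: coord_continuous|exact: cst_continuous].
split.
- by move=> x t _; exact: continuous_barrier.
- move=> x t _ tT; apply: continuousM.
    apply: (@continuous_comp _ _ _ (fun p => paraboloid p.1 p.2) S1 (x, t)); first exact: cp.
    exact: continuous_density1.
  apply: continuousD; apply: continuousM.
  + apply: continuousM; first exact: cst_continuous.
    apply: (@continuous_comp _ _ _ (fun p => A p.2) (fun r : R => r ^+ 2) (x, t)); first exact: cAxt.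
    exact: exprn_continuous.
  + exact: csxt.
  + exact: cst_continuous.
  + exact: cAxt.
- move=> x t _ tT; apply: (@is_derive1_comp _ S (paraboloid x)).
    exact: is_derive_density.
  apply: is_deriveD; last exact: dB.
  apply: (is_derive_eq (is_deriveM (dA tT) (is_derive_cst (sqdist y x) t 1))).
  by rewrite /GRing.scale /= mulr0 add0r mulrC.
- move=> i x t _ tT; apply: (@is_derive_comp _ _ S (paraboloid ^~ t)).
    exact: is_derive_density.
  exact: dpi.
- by move=> i x t _ tT; apply: continuousM; [exact: cS1|exact: clin].
- move=> i x t _ tT.
  have E : (fun z : 'rV[R]_n => a (barrier z t) * barrier_i i z t) =
      (fun z => S (paraboloid z t)) * (fun z => 2 * A t * (z 0 i - y 0 i)).
    apply/funext => z; rewrite mulrfctE /barrier /barrier_i /S1 mulrCA mulrA mulrA.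
    by rewrite mulfVK ?(flux_neq0 d10 ab)//; ring.
  rewrite E.
  have H1 : is_derive x (e_ i) (fun z => S (paraboloid z t))
      (S1 (paraboloid x t) * (2 * A t * (x 0 i - y 0 i))).
    apply: (@is_derive_comp _ _ S (paraboloid ^~ t)); last exact: dpi.
    exact: is_derive_density.
  have H2 : is_derive x (e_ i) (fun z : 'rV[R]_n => 2 * A t * (z 0 i - y 0 i)) (2 * A t * (1 - 0)).
    apply: (is_deriveZ (2 * A t)); apply: is_deriveB.
    by have := is_derive_coord x i i; rewrite eqxx.
  apply: (is_derive_eq (is_deriveM H1 H2)).
  by rewrite /barrier_ii /GRing.scale /=; ring.
- move=> i x t _ tT; apply: continuousD; apply: continuousM.
  + exact: cS1.
  + apply: (@continuous_comp _ _ _ (fun z : 'rV[R]_n => 2 * A t * (z 0 i - y 0 i)) (fun r : R => r ^+ 2) x); first exact: clin.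
    exact: exprn_continuous.
  + apply: (@continuous_comp _ _ _ (paraboloid ^~ t) S x); first exact: cpx.
    exact: continuous_density.
  + exact: cst_continuous.
Qed.

(** The quadratic terms cancel by the choice of A, and the gap a - d2 <= 0
    left by B has the sign that A gives to it. *)
Lemma barrier_balance x t : \sum_i barrier_ii i x t - barrier_t x t =
  2 * n%:R * S1 (paraboloid x t) * A t * (a (barrier x t) - d2).
Proof.
rewrite /barrier_ii /barrier_t big_split /= sumr_const card_ord -[X in _ + X - _]mulr_natl.
have -> : \sum_(i < n) S1 (paraboloid x t) * (2 * A t * (x 0 i - y 0 i)) ^+ 2 =
    S1 (paraboloid x t) * (4 * A t ^+ 2 * sqdist y x).
  rewrite /sqdist -!mulr_sumr; congr (_ * _); rewrite mulr_sumr.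
  by apply: eq_bigr => i _; ring.
have -> : S (paraboloid x t) = S1 (paraboloid x t) * a (barrier x t).
  by rewrite /S1 /barrier mulfVK// gt_eqF// (flux_gt0 d10 ab).
by ring.
Qed.

Let S1_ge0 p : 0 <= S1 p.
Proof. by rewrite /S1 divr_ge0 ?ltW// ?density_gt0// (flux_gt0 d10 ab). Qed.

Lemma barrier_super x t : 0 <= A t -> \sum_i barrier_ii i x t <= barrier_t x t.
Proof.
move=> A0; rewrite -subr_le0 barrier_balance mulr_ge0_le0 ?subr_le0//.
  by do 3 apply: mulr_ge0 => //.
by case/andP: (ab (barrier x t)).
Qed.

Lemma barrier_sub x t : A t <= 0 -> barrier_t x t <= \sum_i barrier_ii i x t.
Proof.
move=> A0; rewrite -subr_ge0 barrier_balance mulr_le0 ?subr_le0//.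
  by apply: mulr_ge0_le0 => //; do 2 apply: mulr_ge0 => //.
by case/andP: (ab (barrier x t)).
Qed.

(** The gradient bound required by comparison: it holds where the barrier is
    bounded and its slope is controlled. *)
Lemma barrier_gradient i x t (M r : R) : barrier x t <= M -> `|A t| * Num.sqrt (sqdist y x) <= r ->
  `|barrier_i i x t| <= M / d1 * (2 * r).
Proof.
move=> bM Ar; rewrite /barrier_i normrM; apply: ler_pM => //.
  rewrite ger0_norm// /S1 ler_pM ?invr_ge0 ?(ltW (density_gt0 _ _ _ _))//.
    by rewrite ltW// (flux_gt0 d10 ab).
  by rewrite lef_pV2 ?posrE// ?(flux_gt0 d10 ab)//; case/andP: (ab (S (paraboloid x t))).
rewrite !normrM ger0_norm// -mulrA ler_pM2l//; apply: le_trans Ar.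
rewrite ler_wpM2l// -sqrtr_sqr ler_wsqrtr// /sqdist (bigD1 i)//= lerDl.
by apply: sumr_ge0 => j _; exact: sqr_ge0.
Qed.

End barrier.

(** * Compact exhaustion and the initial energy *)

Section domains.
Context {R : realType} (n : nat).
Implicit Types (D A K : set 'rV[R]_n).
Local Notation row' := (@row_of_tuple R n).
Local Notation leb := (lebesgue_tuple R n).

(** The one-sided form of a zero initial condition, all that a bound from
    above can use. *)
Definition vanishes_initially D (u : 'rV[R]_n -> R -> R) :=
   forall K, compact K -> K `<=` D ->
  (\int[lebesgue_tuple R n]_(v in @row_of_tuple R n @^-1` K)
    (pos (u (row_of_tuple v) t))%:E)%E @[t --> 0^'+] --> 0%E.

(** The compactness of supports required by comparison comes from strict
    inequalities on the boundary: the set where f >= 0 is compact in the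
    closed cylinder, and its projection stays off the boundary of A. *)
Lemma compact_nonneg_projection A (f : 'rV[R]_n -> R -> R) (r s s' : R) :
  A `<=` cube 0 r ->
  {within closure A `*` `[s, s']%classic, continuous (fun p => f p.1 p.2)} ->
  (forall x t, closure A x -> s <= t <= s' -> 0 <= f x t -> A x) ->
  exists K, [/\ compact K, K `<=` A &
    forall x t, A x -> s <= t <= s' -> 0 <= f x t -> K x].
Proof.
move=> Ar cf fA.
pose C := closure A `*` `[s, s']%classic.
have cC : compact C.
  apply: compact_setX; last exact: segment_compact.
  apply: (subclosed_compact _ (@compact_cube _ _ 0 r)); first exact: closed_closure.
  by rewrite [X in _ `<=` X](closure_id (cube 0 r)).1; [exact: closure_subset|exact: closed_cube].
pose F (p : 'rV[R]_n * R) := f p.1 p.2.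
have : closed ((F : subspace C -> R) @^-1` [set t | 0 <= t]).
  by apply: closed_comp; [move=> p _; exact: cf|exact: closed_ge].
move=> /closed_subspaceP[V cV VC].
exists (fst @` (C `&` V)); split.
- apply: continuous_compact; last exact: compact_closedI.
  by apply: continuous_subspaceT => p; exact: cvg_fst.
- move=> _ [[x t] [Cxt Vxt] <-] /=.
  have [_ F0] : ((F : subspace C -> R) @^-1` [set t | 0 <= t] `&` C) (x, t) by rewrite -VC; split.
  have F1 : ((F : subspace C -> R) @^-1` [set t | 0 <= t] `&` C) (x, t) by rewrite -VC; split.
  case: Cxt => /= cx; rewrite in_itv/= => st; apply: (fA x t) => //.
  by case: F1.
- move=> x t Ax st f0; have Cxt : C (x, t).
    by split => /=; [exact: subset_closure|rewrite in_itv].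
  exists (x, t) => //; split => //.
  have : (V `&` C) (x, t) by rewrite VC; split.
  by case.
Qed.

Lemma measurable_fun_open_row D (g : 'rV[R]_n -> R) : open D ->
  (forall x, D x -> {for x, continuous g}) ->
  measurable_fun (row' @^-1` D) (g \o row').
Proof.
move=> oD cg; apply: (measurability _ (RGenOpens.measurableE R)) => _ [_ [a [b ->]] <-].
have oU : open (D `&` g @^-1` `]a, b[%classic).
  rewrite openE => x [Dx gx]; rewrite /interior; apply: filterI.
    exact: open_nbhs_nbhs.
  by apply: (cg x Dx); apply: open_nbhs_nbhs; split => //; exact: interval_open.
by have := measurable_row_of_tuple oU.
Qed.

(** The points of A whose distance to the complement is at least 1 / (j + 1)
    form compact sets that increase to A, and the measure of A is finite. *)
Lemma compact_exhaustion A (r e : R) : open A -> A `<=` cube 0 r -> 0 < r -> 0 < e ->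
  exists K, [/\ compact K, K `<=` A & (leb (row' @^-1` A `\` row' @^-1` K) < e%:E)%E].
Proof.
move=> oA Ar r0 e0.
pose K (j : nat) : set 'rV[R]_n :=
  cube 0 r `&` \bigcap_(z in ~` A) [set x | j.+1%:R^-1 <= `|x - z|].
have clK j : closed (\bigcap_(z in ~` A) [set x : 'rV[R]_n | j.+1%:R^-1 <= `|x - z|]).
  apply: closed_bigI => z _.
  rewrite (_ : [set x | _] = (fun x => `|x - z|) @^-1` [set t | j.+1%:R^-1 <= t])//.
  apply: closed_comp; last exact: closed_ge.
  by move=> x _; apply: (continuous_comp (@continuous_addr _ n (- z) x)); exact: norm_continuous.
have cK j : compact (K j) by apply: compact_closedI => //; exact: compact_cube.
have KA j : K j `<=` A.
  move=> x [_ Kx]; apply: contrapT => nAx; have /= := Kx x nAx.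
  by rewrite subrr normr0 leNgt invr_gt0 ltr0Sn.
have mK j : measurable (row' @^-1` K j).
  by apply: measurable_closed_row_of_tuple; apply: closedI => //; exact: closed_cube.
have mA : measurable (row' @^-1` A) by exact: measurable_row_of_tuple.
pose F j := row' @^-1` A `\` row' @^-1` K j.
have mF j : measurable (F j) by exact: measurableD.
have F0 : \bigcap_j F j = set0.
  apply/seteqP; split => // v H.
  have Av : A (row' v) by case: (H 0%N I).
  have /nbhs_ballP[d /= d0 Hd] := open_nbhs_nbhs (conj oA Av).
  have [j] := ltr_add_invr d0; rewrite add0r => jd.
  case: (H j I) => _; apply; split; first exact: Ar.
  move=> z nAz /=; rewrite leNgt; apply/negP => zj; apply: nAz; apply: Hd.
  by rewrite -ball_normE /=; exact: lt_trans jd.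
have : leb \o F @ \oo --> leb (\bigcap_j F j).
  apply: nonincreasing_cvg_mu => //.
  - apply: le_lt_trans (lebesgue_tuple_compact (@compact_cube _ n 0 r)).
    apply: le_measure; rewrite ?inE//.
      by apply: measurable_closed_row_of_tuple; exact: closed_cube.
    by move=> v [/Ar].
  - exact: bigcap_measurable.
  - move=> i j ij; apply/subsetPset => v [Av nKv]; split => //.
    apply: contra_not nKv => -[c Kv]; split => // z nAz.
    apply: le_trans (Kv z nAz) => /=.
    by rewrite lef_pV2 ?posrE// ler_nat.
rewrite F0 measure0 => /fine_cvgP[Ffin /cvgrPdist_lt/(_ e e0) Fe].
have [j [Fj Fje]] : exists j, (leb (F j) \is a fin_num) /\ `|0 - fine (leb (F j))| < e.
  near \oo => j; exists j; split; first by near: j.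
  by near: j; exact: Fe.
exists (K j); split => //; rewrite -/(F j) -[X in (X < _)%E]fineK// lte_fin.
by move: Fje; rewrite sub0r normrN; exact/le_lt_trans/ler_norm.
Unshelve. all: by end_near. Qed.

(** Convergence in L^1_loc says nothing near the boundary of A. There the
    integrand is at most M ^ 3 on a set of small measure, and on the compact
    rest it is at most M ^ 2 pos u, whose integral tends to 0. *)
Lemma small_initial_energy A D (r M : R) (u w : 'rV[R]_n -> R -> R) (T : R) :
  open A -> A `<=` D -> A `<=` cube 0 r -> 0 < r -> 0 < M -> 0 < T ->
  (forall x t, A x -> 0 < t < T -> {for x, continuous (u ^~ t)}) ->
  (forall x t, A x -> 0 < t < T -> {for x, continuous (w ^~ t)}) ->
  (forall x t, A x -> 0 < t < T -> u x t <= M) ->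
  (forall x t, A x -> 0 < t < T -> 0 <= w x t) ->
  vanishes_initially D u ->
  forall e s, 0 < e -> 0 < s -> exists t, [/\ 0 < t, t < s &
    rowint ((fun x => pos (u x t - w x t) ^+ 3) \_ A) < e].
Proof.
move=> oA AD Ar r0 M0 T0 cu cw uM w0 L1 e s e0 s0.
have [K [cK KA HK]] := compact_exhaustion oA Ar r0
  (divr_gt0 e0 (mulr_gt0 (ltr0n R 3) (exprn_gt0 3 M0))).
have KD : K `<=` D by exact: subset_trans AD.
pose d := e / (3 * M ^+ 2).
have d0 : 0 < d by rewrite divr_gt0// mulr_gt0// exprn_gt0.
have [t [t0 ts tT Ht]] : exists t, [/\ 0 < t, t < s, t < T &
    (\int[leb]_(v in row' @^-1` K) (pos (u (row' v) t))%:E < d%:E)%E].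
  have /fine_cvgP[Ffin /cvgrPdist_lt/(_ d d0) Fe] := L1 K cK KD.
  near (0 : R)^'+ => t; exists t; split.
  - by near: t; exact: nbhs_right_gt.
  - by near: t; exact: nbhs_right_lt.
  - by near: t; exact: nbhs_right_lt.
  - have Ft : (\int[leb]_(v in row' @^-1` K) (pos (u (row' v) t))%:E \is a fin_num)%E by near: t.
    rewrite -[X in (X < _)%E]fineK// lte_fin.
    have : `|0 - fine (\int[leb]_(v in row' @^-1` K) (pos (u (row' v) t))%:E)%E| < d by near: t.
    by rewrite sub0r normrN; exact/le_lt_trans/ler_norm.
exists t; split => //.
have tT' : 0 < t < T by rewrite t0.
pose g x := pos (u x t - w x t) ^+ 3.
have gu x : A x -> g x <= M ^+ 2 * pos (u x t).
  move=> Ax; have [q0|q0] := leP (u x t - w x t) 0.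
    by rewrite /g (pos_le0 q0) expr0n mulr_ge0 ?sqr_ge0// pos_ge0.
  have w0x := w0 x t Ax tT'; have uMx := uM x t Ax tT'.
  rewrite /g (pos_id (ltW q0)) pos_id; last by lra.
  by rewrite exprSr ler_pM// ?exprn_ge0 ?lerXn2r ?nnegrE//; lra.
have gM x : A x -> g x <= M ^+ 3.
  move=> Ax; apply: le_trans (gu x Ax) _; rewrite [leRHS]exprSr ler_pM2l ?exprn_gt0//.
  by rewrite /pos ge_max (ltW M0) uM.
have g0 x : 0 <= g x by rewrite exprn_ge0// pos_ge0.
have mA : measurable (row' @^-1` A) by exact: measurable_row_of_tuple.
have hc : closed K by apply: compact_closed => //; exact: norm_hausdorff.
have mK := measurable_closed_row_of_tuple hc.
have mg : measurable_fun (row' @^-1` A) (EFin \o (g \o row')).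
  apply/measurable_EFinP; apply: measurable_fun_open_row => // x Ax.
  apply: (@continuous_comp _ _ _ (fun x => u x t - w x t) (fun r => pos r ^+ 3)).
    by apply: continuousB; [exact: cu|exact: cw].
  exact: continuous_posX.
have mu' : measurable_fun (row' @^-1` K) (EFin \o (fun v => pos (u (row' v) t))).
  apply/measurable_EFinP.
  apply: (@measurable_funS _ _ _ _ (row' @^-1` A)) => //; first by move=> v /KA.
  apply: (@measurable_fun_open_row A (fun x => pos (u x t))) => // x Ax.
  by apply: (@continuous_comp _ _ _ (u ^~ t) pos); [exact: cu|exact: continuous_pos].
have KAv : row' @^-1` K `<=` row' @^-1` A by move=> v /KA.
have E1 : (\int[leb]_v ((g \_ A) (row' v))%:E = \int[leb]_(v in row' @^-1` A) (g (row' v))%:E)%E.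
  rewrite [RHS]integral_mkcond; apply: eq_integral => v _; rewrite !patchE.
  have [Av|nAv] := pselect (A (row' v)); first by rewrite !mem_set.
  by rewrite !memNset.
have E2 : (\int[leb]_v ((g \_ A) (row' v))%:E < e%:E)%E.
  rewrite E1 (_ : row' @^-1` A = row' @^-1` K `|` (row' @^-1` A `\` row' @^-1` K)); last first.
    by rewrite setDUK.
  rewrite ge0_integral_setU//=; [|exact: measurableD|by rewrite setDUK|by move=> v _; rewrite lee_fin|]; last first.
    by apply/disj_setPS => v [Kv []].
  have I1 : (\int[leb]_(v in row' @^-1` K) (g (row' v))%:E <= (e / 3)%:E)%E.
    apply: (@le_trans _ _ (\int[leb]_(v in row' @^-1` K) ((M ^+ 2)%:E * (pos (u (row' v) t))%:E))%E).
      apply: ge0_le_integral => //.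
      - by move=> v _; rewrite lee_fin.
      - exact: measurable_funS mg.
      - exact: measurable_funeM.
      - by move=> v /KA Av; rewrite -EFinM lee_fin; exact: gu.
    rewrite ge0_integralZl//; last 2 first.
      by move=> v _; rewrite lee_fin pos_ge0.
      by rewrite lee_fin exprn_ge0// ltW.
    have -> : (e / 3)%:E = ((M ^+ 2)%:E * d%:E)%E.
      by rewrite -EFinM /d; congr EFin; field; rewrite gt_eqF.
    by rewrite lee_wpmul2l ?lee_fin ?exprn_ge0 ?(ltW M0)// ltW.
  have I2 : (\int[leb]_(v in row' @^-1` A `\` row' @^-1` K) (g (row' v))%:E <= (e / 3)%:E)%E.
    apply: (@le_trans _ _ (\int[leb]_(v in row' @^-1` A `\` row' @^-1` K) (M ^+ 3)%:E)%E).
      apply: ge0_le_integral => //.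
      - exact: measurableD.
      - by move=> v _; rewrite lee_fin.
      - by apply: measurable_funS mg => // v [].
      - by move=> v [Av _]; rewrite lee_fin; exact: gM.
    rewrite integral_cst; last exact: measurableD.
    have -> : (e / 3)%:E = ((M ^+ 3)%:E * (e / (3 * M ^+ 3))%:E)%E.
      by rewrite -EFinM; congr EFin; field; rewrite gt_eqF.
    by rewrite lee_wpmul2l ?lee_fin ?exprn_ge0 ?(ltW M0)// ltW.
  apply: le_lt_trans (leeD I1 I2) _.
  by rewrite -EFinD lte_fin; lra.
have E3 : (0 <= \int[leb]_v ((g \_ A) (row' v))%:E)%E.
  by apply: integral_ge0 => v _; rewrite lee_fin patchE; case: ifP.
rewrite /rowint /Rintegral -lte_fin fineK//.
by rewrite ge0_fin_numE// (lt_trans E2)// ltry.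
Unshelve. all: by end_near. Qed.

End domains.

(** * Upper and lower estimates by barriers *)

Definition locally_lipschitz {R : realType} (a : R -> R) :=
  forall M, exists2 L : R, 0 <= L &
  forall r s, `|r| <= M -> `|s| <= M -> `|a r - a s| <= L * `|r - s|.

Section estimates.
Context {R : realType} (n : nat).
Variables (a : R -> R) (d1 d2 : R).
Hypothesis ca : continuous a.
Hypothesis d10 : 0 < d1.
Hypothesis ab : forall s, d1 <= a s <= d2.
Hypothesis aL : locally_lipschitz a.
Local Notation S := (density ca d10 ab).
Local Notation P := (pressure a).
Let k := n%:R * d2 / 2.

Definition flux_solution (D : set 'rV[R]_n) (u : 'rV[R]_n -> R -> R) :=
  exists ut ui zi, [/\ forall T, flux_regular a D T u ut ui zi &
    forall x t, D x -> 0 < t -> ut x t = \sum_i zi i x t].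

Let d20 : 0 < d2.
Proof. by case/andP: (ab 0) => h1 h2; apply: lt_le_trans h2; exact: lt_le_trans h1. Qed.

Let k0 : 0 <= k.
Proof. by rewrite /k divr_ge0// mulr_ge0// ltW. Qed.

Lemma flux_regularW (D D' : set 'rV[R]_n) T T' u ut ui zi : D' `<=` D -> T' <= T ->
  flux_regular a D T u ut ui zi -> flux_regular a D' T' u ut ui zi.
Proof.
move=> D'D T'T [h1 h2 h3 h4 h5 h6 h7].
have tT t : 0 < t < T' -> 0 < t < T.
  by move=> /andP[tp tT]; rewrite tp (lt_le_trans tT).
split=> *; [exact: h1 (D'D _ _) (tT _ _)|exact: h2 (D'D _ _) (tT _ _)|
  exact: h3 (D'D _ _) (tT _ _)|exact: h4 (D'D _ _) (tT _ _)|
  exact: h5 (D'D _ _) (tT _ _)|exact: h6 (D'D _ _) (tT _ _)|exact: h7 (D'D _ _) (tT _ _)].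
Qed.

Definition sqball (y : 'rV[R]_n) (r : R) : set 'rV[R]_n := [set x | sqdist y x < r ^+ 2].

Lemma open_sqball y r : open (sqball y r).
Proof.
rewrite (_ : sqball y r = sqdist y @^-1` [set t | t < r ^+ 2])//.
by apply: open_comp; [move=> x _; exact: continuous_sqdist|exact: open_lt].
Qed.

Lemma closure_sqball y r : closure (sqball y r) `<=` [set x | sqdist y x <= r ^+ 2].
Proof.
rewrite [X in _ `<=` X](closure_id _).1.
  by apply: closure_subset => x /=; exact: ltW.
rewrite (_ : [set x | _] = sqdist y @^-1` [set t | t <= r ^+ 2])//.
by apply: closed_comp; [move=> x _; exact: continuous_sqdist|exact: closed_le].
Qed.

Lemma sqdist_coord (y x : 'rV[R]_n) i : `|x 0 i - y 0 i| <= Num.sqrt (sqdist y x).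
Proof.
rewrite -sqrtr_sqr ler_wsqrtr// /sqdist (bigD1 i)//= lerDl.
by apply: sumr_ge0 => j _; exact: sqr_ge0.
Qed.

Lemma sqball_sub_cube y r : 0 < r -> exists2 r', 0 < r' & sqball y r `<=` cube 0 r'.
Proof.
move=> r0; exists (`|y| + r); first by rewrite ltr_wpDl.
move=> x xr; rewrite /cube /= subr0 -[x](subrK y) addrC.
apply: le_trans (ler_normD _ _) _; rewrite lerD2l.
apply/ler_rV_norm; first exact: ltW.
move=> i; rewrite !mxE; apply: le_trans (sqdist_coord _ _ _) _.
by rewrite -[leRHS]gtr0_norm// -sqrtr_sqr ler_wsqrtr// ltW.
Qed.

Lemma closureI_boundary D (y : 'rV[R]_n) r x : open D -> closure (D `&` sqball y r) x ->
  ~ (D `&` sqball y r) x ->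
  (boundary D x /\ sqdist y x <= r ^+ 2) \/ (D x /\ sqdist y x = r ^+ 2).
Proof.
move=> oD cx nx.
have [cD cB] : closure D x /\ sqdist y x <= r ^+ 2.
  by move: cx => /closureI[? /closure_sqball].
have [Dx|nDx] := pselect (D x).
  right; split => //; apply/eqP; rewrite eq_le cB /= leNgt; apply/negP => h.
  by apply: nx; split.
by left; split => //; split => // /interior_subset.
Qed.

(** The solutions of A' = 4 A ^ 2. With c > t the paraboloid focuses at time
    c, with c = 0 it is the exponent of the Gaussian of variance 2 t. *)
Definition focusing (c t : R) : R := (4 * (c - t))^-1.

Lemma is_derive_affine (c t : R) : is_derive t 1 (fun t : R => c - t) (-1).
Proof.
have := is_deriveB (is_derive_cst c t 1) (is_derive_id t 1).
by rewrite sub0r.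
Qed.

Lemma is_derive_focusing (c t : R) : c - t != 0 ->
  is_derive t 1 (focusing c) (4 * focusing c t ^+ 2).
Proof.
move=> ct; have H := is_deriveZ 4 (is_derive_affine c t).
have c0 : (4 \*: (fun t : R => c - t)) t != 0 by rewrite /= mulf_neq0.
apply: (is_derive_eq (is_deriveV c0 H)).
have -> : (4 \*: (fun t : R => c - t)) t = 4 * (c - t) by [].
by rewrite /focusing /GRing.scale /=; field.
Qed.

Lemma is_derive_ln_affine (c e t : R) : 0 < c - t ->
  is_derive t 1 (fun t : R => e - k * ln (c - t)) (2 * n%:R * d2 * focusing c t).
Proof.
move=> ct.
have H1 : is_derive t 1 (fun t : R => ln (c - t)) ((c - t)^-1 * -1).
  apply: (@is_derive1_comp _ (@ln R) (fun t : R => c - t) t); last exact: is_derive_affine.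
  exact: is_derive1_ln.
apply: (is_derive_eq (is_deriveB (is_derive_cst e t 1) (is_deriveZ k H1))).
by rewrite /focusing /GRing.scale /= /k; field; rewrite gt_eqF.
Qed.

Lemma is_derive_ln_linear (e t : R) : 0 < t ->
  is_derive t 1 (fun t : R => e - k * ln t) (2 * n%:R * d2 * focusing 0 t).
Proof.
move=> t0.
apply: (is_derive_eq (is_deriveB (is_derive_cst e t 1) (is_deriveZ k (is_derive1_ln t0)))).
by rewrite /focusing /GRing.scale /= /k; field; rewrite gt_eqF.
Qed.

(** Comparison in the ball of radius r around x0 with the barrier focusing at
    time T0. The constant in B is such that the barrier stays above M + 1 on
    the sphere; inside D it is positive, hence above u on the boundary of D
    and above the initial datum 0. At the centre its pressure is B(t0). *)
Lemma upper_estimate (D : set 'rV[R]_n) (u : 'rV[R]_n -> R -> R) (x0 : 'rV[R]_n) (r M T0 t0 : R) :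
  open D -> flux_solution D u -> continuous_cyl (closure D) u ->
  0 < M -> (forall x t, D x -> 0 < t -> u x t <= M) ->
  D x0 -> 0 < r ->
  (forall x t, boundary D x -> sqdist x0 x <= r ^+ 2 -> 0 < t -> u x t <= 0) ->
  vanishes_initially D u ->
  0 < t0 < T0 ->
  u x0 t0 <= S (- r ^+ 2 / (4 * T0) + P (M + 1) + k * (ln T0 - ln (T0 - t0))).
Proof.
move=> oD [ut [ui [zi [ru eq_u]]]] cu M0 uM Dx0 r0 ubd L1 /andP[t00 t0T0].
(* The slope of the barrier is unbounded near its focusing time T0. *)
pose T := (t0 + T0) / 2.
have [t0T TT0] : t0 < T /\ T < T0 by rewrite /T; split; lra.
have T00 : 0 < T0 by exact: lt_trans t0T0.
pose A := focusing T0.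
pose B (t : R) : R := - r ^+ 2 / (4 * T0) + P (M + 1) + k * ln T0 - k * ln (T0 - t).
have sub0 t : t < T -> 0 < T0 - t by move=> tT; rewrite subr_gt0 (lt_trans tT).
have dA t : 0 < t < T -> is_derive t 1 A (4 * A t ^+ 2).
  by move=> /andP[_ tT]; apply: is_derive_focusing; rewrite gt_eqF// sub0.
have dB t : 0 < t < T -> is_derive t 1 B (2 * n%:R * d2 * A t).
  by move=> /andP[_ tT]; apply: is_derive_ln_affine; exact: sub0.
pose w := barrier ca d10 ab x0 A B.
pose wt := barrier_t ca d10 ab x0 A B.
pose wi := barrier_i ca d10 ab x0 A B.
pose wii := barrier_ii ca d10 ab x0 A B.
pose G := D `&` sqball x0 r.
have oG : open G by apply: openI => //; exact: open_sqball.
have GD : G `<=` D by move=> x [].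
have A0' : 0 < A T by rewrite invr_gt0 mulr_gt0// subr_gt0.
have A0 t : t < T -> 0 < A t by move=> tT; rewrite invr_gt0 mulr_gt0// sub0.
have [r' r'0 Gr'] := sqball_sub_cube x0 r0.
have Gr : G `<=` cube 0 r' by move=> x [_ /Gr'].
have wsph x t : 0 < t < T -> sqdist x0 x = r ^+ 2 -> M + 1 <= w x t.
  move=> /andP[tp tT] sx; rewrite /w /barrier -[leLHS](pressureK ca d10 ab); last by rewrite ltr_wpDr.
  have M1 : P (M + 1) <= paraboloid x0 A B x t.
    rewrite /paraboloid sx /A /focusing /B.
    have h1 : r ^+ 2 / (4 * T0) <= (4 * (T0 - t))^-1 * r ^+ 2.
      rewrite [leRHS]mulrC ler_pM2l ?exprn_gt0// lef_pV2 ?posrE ?mulr_gt0// ?sub0//.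
      by rewrite ler_pM2l// gerBl ltW.
    have h2 : 0 <= k * (ln T0 - ln (T0 - t)).
      by rewrite mulr_ge0// subr_ge0 ler_ln ?posrE ?sub0// gerBl ltW.
    by move: h1 h2; rewrite mulNr => h1 h2; lra.
  move: M1; rewrite le_eqVlt => /predU1P[->//|h]; apply: ltW.
  exact: density_homo.
have [L L0 HL] := aL (M + 1).
pose C := M / d1 * (2 * (A T * r)).
have rw : flux_regular a G T w wt wi wii by exact: barrier_regular.
have w0 x t : 0 < w x t by exact: density_gt0.
have uw : forall x t, G x -> 0 < t < T -> u x t <= w x t.
  apply: (@comparison _ _ a d1 L C T G u w ut wt ui wi zi wii) => //.
  - by move=> s; case/andP: (ab s).
  - by rewrite /C mulr_ge0// ?divr_ge0 ?(ltW M0) ?(ltW d10)// mulr_ge0// mulr_ge0// ltW.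
  - exact: flux_regularW GD (lexx T) (ru T).
  - move=> x t [Dx _] /andP[tp tT] _; split; first by rewrite eq_u.
    by apply: barrier_super; exact/ltW/A0.
  - move=> x t [Dx _] /andP[tp tT] wu; have := uM x t Dx tp; have := w0 x t => h1 h2.
    rewrite -[X in L * X]gtr0_norm ?subr_gt0//; apply: HL.
      by rewrite gtr0_norm ?(lt_trans h1)//; lra.
    by rewrite gtr0_norm//; lra.
  - move=> i x t [Dx Bx] /andP[tp tT] wu; right.
    apply: barrier_gradient; first by apply: ltW; apply: lt_le_trans wu (uM _ _ Dx tp).
    rewrite ger0_norm; last exact/ltW/A0.
    apply: ler_pM; rewrite ?sqrtr_ge0// ?(ltW (A0 _ tT))//.
      have p1 : 0 < T0 - T by rewrite subr_gt0.
      rewrite /A /focusing lef_pV2 ?posrE ?mulr_gt0 ?p1 ?(sub0 t tT)//.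
      by rewrite ler_pM2l// lerB// ltW.
    by rewrite -[leRHS]gtr0_norm// -sqrtr_sqr ler_wsqrtr// ltW.
  - move=> s s' s0 s'T.
    have [K [cK KG HK]] : exists K, [/\ compact K, K `<=` G &
        forall x t, G x -> s <= t <= s' -> 0 <= u x t - w x t -> K x].
      have cu' : {within closure G `*` `[s, s']%classic, continuous (fun p => u p.1 p.2)}.
        apply: continuous_subspaceW cu => -[x t] [/= cx].
        rewrite in_itv/= => /andP[st _]; split => /=; last exact: lt_le_trans st.
        by move: x cx; exact: closure_subset.
      have cw' : {within closure G `*` `[s, s']%classic, continuous (fun p => w p.1 p.2)}.
        apply: continuous_in_subspaceT => -[x t]; rewrite inE /= in_itv/= => -[_ /andP[st ts']].
        have tT : 0 < t < T by rewrite (lt_le_trans s0 st) (le_lt_trans ts').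
        exact: (@continuous_barrier _ _ _ _ _ ca d10 ab x0 _ _ _ dA dB x t tT).
      apply: (compact_nonneg_projection Gr).
        exact: within_continuousB.
      move=> x t cx /andP[st ts']; have tT : 0 < t < T.
        by rewrite (lt_le_trans s0 st) (le_lt_trans ts').
      move=> uw0; apply: contrapT => /(closureI_boundary oD cx)[[bx xr]|[Dx xr]].
        have := ubd x t bx xr (andP tT).1; have := w0 x t.
        by rewrite subr_ge0 in uw0 => h1 h2; have := lt_le_trans h1 (le_trans uw0 h2); rewrite ltxx.
      have h1 := wsph x t tT xr; have h2 := uM x t Dx (andP tT).1.
      by rewrite subr_ge0 in uw0; have := le_trans h1 (le_trans uw0 h2); lra.
    exists K; split => // x t Gx st wu; apply: (HK x t) => //.
    by rewrite subr_ge0 ltW.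
  - apply: (small_initial_energy (M := M) (T := T) oG GD Gr) => //.
    + by rewrite (lt_trans t00).
    + move=> x t [Dx _] /andP[tp tT]; apply: continuous_slicel.
      by apply: (flux_continuous (ru T)) => //; rewrite tp.
    + move=> x t Gx tT; apply: continuous_slicel.
      exact: (flux_continuous rw).
    + by move=> x t [Dx _] /andP[tp tT]; exact: uM.
    + by move=> x t _ _; exact: ltW.
have x00 : sqdist x0 x0 = 0 by rewrite /sqdist big1// => i _; rewrite subrr expr0n.
have Gx0 : G x0 by split => //; rewrite /sqball /= x00 exprn_gt0.
have := uw x0 t0 Gx0; rewrite t00 t0T => /(_ isT).
by rewrite /w /barrier /paraboloid x00 mulr0 add0r /B mulrBr addrA.
Qed.

(** As s goes to 0, 1 / s wins over the logarithm. *)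
Lemma gaussian_tail (rho X : R) : 0 < rho ->
  exists2 s0 : R, 0 < s0 & forall s, 0 < s < s0 -> - rho ^+ 2 / (4 * s) - k * ln s < X.
Proof.
move=> rho0; pose c := rho ^+ 2 / (8 * (k + 1)).
have k1 : 0 < k + 1 by rewrite ltr_wpDl.
have c0 : 0 < c by rewrite divr_gt0 ?exprn_gt0// mulr_gt0.
pose Y := `|k * ln c| + `|X| + 1.
have Y0 : 0 < Y by rewrite /Y ltr_wpDl// addr_ge0.
exists (rho ^+ 2 / (8 * Y)); first by rewrite divr_gt0 ?exprn_gt0// mulr_gt0.
move=> s /andP[sp sY].
have H1 : - (k * ln s) <= k * (c / s) - k * ln c.
  have E : ln (c / s) = ln c - ln s by apply: ln_div; rewrite posrE.
  have : ln (c / s) <= c / s by apply/ltW/ln_sublinear; rewrite divr_gt0.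
  by move=> /(ler_wpM2l k0); rewrite E mulrBr; lra.
have H2 : k * (c / s) <= rho ^+ 2 / (8 * s).
  rewrite /c -subr_ge0.
  have -> : rho ^+ 2 / (8 * s) - k * (rho ^+ 2 / (8 * (k + 1)) / s) = rho ^+ 2 / (8 * s * (k + 1)).
    by field; rewrite !gt_eqF.
  by rewrite divr_ge0 ?sqr_ge0// ltW// mulr_gt0// mulr_gt0.
have H3 : Y < rho ^+ 2 / (8 * s).
  rewrite ltr_pdivlMr ?mulr_gt0//; move: sY; rewrite ltr_pdivlMr ?mulr_gt0//.
  by apply: le_lt_trans; rewrite le_eqVlt; apply/orP; left; apply/eqP; ring.
have -> : - rho ^+ 2 / (4 * s) = - (2 * (rho ^+ 2 / (8 * s))) by field; rewrite gt_eqF.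
have := ler_norm (- (k * ln c)); have := ler_norm (- X); rewrite !normrN => H4 H5.
by move: H3; rewrite /Y => H3; lra.
Qed.

(** Comparison with the Gaussian barrier centred at a point y away from D. On
    D it tends uniformly to 0 with t, so it is below eps <= v up to some time
    s0: the initial comparison is trivial, and the barrier exceeds v only at
    times where its gradient is bounded. As D may be unbounded, the comparison
    takes place in a large ball on whose sphere the barrier is below eps until
    T1. *)
Lemma lower_estimate (D : set 'rV[R]_n) (v : 'rV[R]_n -> R -> R) (y x0 : 'rV[R]_n)
    (rho b T1 eps t0 : R) :
  open D -> flux_solution D v -> continuous_cyl (closure D) v ->
  0 < eps -> (forall x t, D x -> 0 < t -> eps <= v x t) ->
  0 < rho -> (forall x, closure D x -> rho ^+ 2 <= sqdist y x) ->
  0 < b -> (forall x t, boundary D x -> 0 < t < T1 -> b <= v x t) ->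
  (forall s, 0 < s < T1 -> - rho ^+ 2 / (4 * s) - k * ln s < P b) ->
  D x0 -> 0 < t0 < T1 ->
  S (- sqdist y x0 / (4 * t0) - k * ln t0) <= v x0 t0.
Proof.
move=> oD [vt [vi [zi [rv eq_v]]]] cv eps0 ve rho0 rhoD b0 vb tail Dx0 t0T.
have T10 : 0 < T1 by case/andP: t0T => ?; exact: lt_trans.
pose A := focusing 0.
pose B (t : R) : R := 0 - k * ln t.
have dA t : 0 < t < T1 -> is_derive t 1 A (4 * A t ^+ 2).
  by move=> /andP[tp _]; apply: is_derive_focusing; rewrite sub0r oppr_eq0 gt_eqF.
have dB t : 0 < t < T1 -> is_derive t 1 B (2 * n%:R * d2 * A t).
  by move=> /andP[tp _]; exact: is_derive_ln_linear.
have AE t (q : R) : 0 < t -> A t * q = - q / (4 * t).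
  by move=> tp; rewrite /A /focusing; field; rewrite gt_eqF.
have A0 t : 0 < t -> A t <= 0.
  by move=> tp; rewrite /A /focusing invr_le0 sub0r mulrN oppr_le0 mulr_ge0// ltW.
pose w := barrier ca d10 ab y A B.
pose wt := barrier_t ca d10 ab y A B.
pose wi := barrier_i ca d10 ab y A B.
pose wii := barrier_ii ca d10 ab y A B.
have wlt x t e : 0 < e -> paraboloid y A B x t < P e -> w x t < e.
  by move=> e0 /(density_homo ca d10 ab); rewrite pressureK.
have w0 x t : 0 < w x t by exact: density_gt0.
have pE x t : 0 < t -> paraboloid y A B x t = - sqdist y x / (4 * t) - k * ln t.
  by move=> tp; rewrite /paraboloid AE// /B sub0r.
have ple x t q : 0 < t -> q <= sqdist y x ->
    paraboloid y A B x t <= - q / (4 * t) - k * ln t.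
  move=> tp h; rewrite pE// lerD2r ler_pM2r ?invr_gt0 ?mulr_gt0//.
  by rewrite lerN2.
have [s0 s00 Hs0] := gaussian_tail (P eps) rho0.
have wb x t : closure D x -> 0 < t < T1 -> w x t < b.
  move=> cx tT; apply: wlt => //; apply: le_lt_trans (tail t tT).
  by apply: ple; [case/andP: tT|exact: rhoD].
have weps x t : closure D x -> 0 < t < s0 -> w x t < eps.
  move=> cx ts; apply: wlt => //; apply: le_lt_trans (Hs0 t ts).
  by apply: ple; [case/andP: ts|exact: rhoD].
(* Nr / (4 T1) outweighs the logarithm and P eps for all times between s0 and
   T1. *)
pose Nr := 4 * T1 * (`|k * ln s0| + `|P eps| + 1).
have N0 : 0 <= Nr by rewrite mulr_ge0 ?mulr_ge0 ?addr_ge0// ltW.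
pose r := sqdist y x0 + Nr + 1.
have r1 : 1 <= r by rewrite /r lerDr addr_ge0// sqdist_ge0.
have r0 : 0 < r by exact: lt_le_trans r1.
have rr : r <= r ^+ 2 by rewrite expr2 ler_peMl// ltW.
have wsph x t : closure D x -> 0 < t < T1 -> sqdist y x = r ^+ 2 -> w x t < eps.
  move=> cx /andP[tp tT] sx; have [ts|st] := ltP t s0.
    by apply: weps => //; rewrite tp.
  apply: wlt => //; rewrite pE// sx.
  have h1 : ln s0 <= ln t by rewrite ler_ln ?posrE.
  have h2 : Nr / (4 * T1) < r ^+ 2 / (4 * t).
    apply: (@le_lt_trans _ _ (Nr / (4 * t))).
      rewrite ler_wpM2l// lef_pV2 ?posrE ?mulr_gt0//.
      by rewrite ler_pM2l// ltW.
    rewrite ltr_pM2r ?invr_gt0 ?mulr_gt0//; apply: lt_le_trans rr.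
    by rewrite /r; have := sqdist_ge0 y x0; lra.
  have h3 : Nr / (4 * T1) = `|k * ln s0| + `|P eps| + 1.
    by rewrite /Nr mulrC mulKf// mulf_neq0// gt_eqF.
  have h4 := ler_wpM2l k0 h1.
  have := ler_norm (- (k * ln s0)); have := ler_norm (- P eps); rewrite !normrN mulNr.
  by rewrite h3 in h2; lra.
pose G := D `&` sqball y r.
have oG : open G by apply: openI => //; exact: open_sqball.
have GD : G `<=` D by move=> x [].
have cGD x : closure G x -> closure D x by exact: closure_subset.
have [r' r'0 Gr'] := sqball_sub_cube y r0.
have Gr : G `<=` cube 0 r' by move=> x [_ /Gr'].
have [L L0 HL] := aL b.
pose C := b / d1 * (2 * ((4 * s0)^-1 * r)).
have rw : flux_regular a G T1 w wt wi wii by exact: barrier_regular.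
have uw : forall x t, G x -> 0 < t < T1 -> w x t <= v x t.
  apply: (@comparison _ _ a d1 L C T1 G w v wt vt wi vi wii zi) => //.
  - by move=> s; case/andP: (ab s).
  - by rewrite /C mulr_ge0 ?divr_ge0 ?(ltW b0) ?(ltW d10)// mulr_ge0// mulr_ge0 ?invr_ge0 ?mulr_ge0 ?(ltW r0)// ltW.
  - exact: flux_regularW GD (lexx T1) (rv T1).
  - move=> x t [Dx _] /andP[tp tT] _; split; last by rewrite eq_v.
    by apply: barrier_sub; exact: A0.
  - move=> x t [Dx _] /[dup] tT /andP[tp _] vw.
    have h1 := wb x t (subset_closure Dx) tT; have h2 := lt_le_trans eps0 (ve x t Dx tp).
    rewrite -[X in L * X]gtr0_norm ?subr_gt0//; apply: HL.
      by rewrite gtr0_norm// ltW.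
    by rewrite gtr0_norm//; lra.
  - move=> i x t [Dx Bx] /[dup] tT /andP[tp _] vw; left.
    have st : s0 <= t.
      rewrite leNgt; apply/negP => ts.
      have h := weps x t (subset_closure Dx); rewrite tp ts in h.
      by have := lt_trans vw (lt_le_trans (h isT) (ve x t Dx tp)); rewrite ltxx.
    apply: barrier_gradient; first exact/ltW/wb/tT/subset_closure.
    rewrite ler0_norm; last exact: A0.
    apply: ler_pM; rewrite ?sqrtr_ge0 ?oppr_ge0 ?A0//.
      rewrite /A /focusing sub0r mulrN invrN opprK lef_pV2 ?posrE ?mulr_gt0//.
      by rewrite ler_pM2l.
    by rewrite -[leRHS]gtr0_norm// -sqrtr_sqr ler_wsqrtr// ltW.
  - move=> s s' sp s'T.
    have [K [cK KG HK]] : exists K, [/\ compact K, K `<=` G &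
        forall x t, G x -> s <= t <= s' -> 0 <= w x t - v x t -> K x].
      have cv' : {within closure G `*` `[s, s']%classic, continuous (fun p => v p.1 p.2)}.
        apply: continuous_subspaceW cv => -[x t] [/= cx].
        by rewrite in_itv/= => /andP[st _]; split => /=; [exact: cGD|exact: lt_le_trans st].
      have cw' : {within closure G `*` `[s, s']%classic, continuous (fun p => w p.1 p.2)}.
        apply: continuous_in_subspaceT => -[x t]; rewrite inE /= in_itv/= => -[_ /andP[st ts']].
        have tT : 0 < t < T1 by rewrite (lt_le_trans sp st) (le_lt_trans ts').
        exact: (@continuous_barrier _ _ _ _ _ ca d10 ab y _ _ _ dA dB x t tT).
      apply: (compact_nonneg_projection Gr); first exact: within_continuousB.
      move=> x t cx /andP[st ts']; have tT : 0 < t < T1.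
        by rewrite (lt_le_trans sp st) (le_lt_trans ts').
      rewrite subr_ge0 => vw; apply: contrapT => /(closureI_boundary oD cx)[[bx xr]|[Dx xr]].
        have := lt_le_trans (wb x t (cGD _ cx) tT) (vb x t bx tT).
        by rewrite ltNge vw.
      have := lt_le_trans (wsph x t (cGD _ cx) tT xr) (ve x t Dx (andP tT).1).
      by rewrite ltNge vw.
    exists K; split => // x t Gx st vw; apply: (HK x t) => //.
    by rewrite subr_ge0 ltW.
  - move=> e s e0 sp; pose m := Num.min s s0 / 2.
    have m0 : 0 < Num.min s s0 by rewrite lt_min sp.
    have mm : m < Num.min s s0 by rewrite /m ltr_pdivrMr// ltr_pMr// (ltr_nat _ 1 2).
    have [ms ms0] : m < s /\ m < s0 by move: mm; rewrite lt_min => /andP[].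
    have mp : 0 < m by rewrite divr_gt0.
    exists m; split => //.
    rewrite (_ : _ \_ G = cst 0); first by rewrite /rowint /Rintegral integral0.
    apply/funext => x; rewrite patchE; case: ifPn => //; rewrite inE => -[Dx _].
    rewrite pos_le0 ?expr0n// subr_le0.
    have h := weps x m (subset_closure Dx); rewrite mp ms0 in h.
    by apply: ltW; apply: lt_le_trans (h isT) (ve x m Dx mp).
have Gx0 : G x0.
  split => //; rewrite /sqball /=; apply: lt_le_trans rr.
  by rewrite /r; lra.
have := uw x0 t0 Gx0 t0T.
by rewrite /w /barrier pE//; case/andP: t0T.
Qed.

End estimates.

(** * Solutions in flux form and affine changes *)

Section solutions.
Context {R : realType} (n : nat).
Implicit Types (A D K : set 'rV[R]_n) (u : 'rV[R]_n -> R -> R).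

Lemma open_setX (T U : topologicalType) (B : set T) (C : set U) :
  open B -> open C -> open (B `*` C).
Proof.
move=> oB oC; rewrite openE => -[x y] [/= Bx Cy].
by exists (B, C) => //; split; exact: open_nbhs_nbhs.
Qed.

Lemma within_continuous_comp (T : topologicalType) (B : set T) (f : T -> R) (g : R -> R) :
  {within B, continuous f} -> continuous g -> {within B, continuous (fun x => g (f x))}.
Proof.
by move=> cf cg x; apply: (@continuous_comp (subspace B) R R f g x); [exact: cf|exact: cg].
Qed.

Lemma boundary_notin A x : open A -> boundary A x -> ~ A x.
Proof. by move=> oA [_ nAx] Ax; apply: nAx; exact: open_nbhs_nbhs. Qed.

Lemma continuous_cyl_at A (f : 'rV[R]_n -> R -> R) x t : open A ->
  continuous_cyl A f -> A x -> 0 < t -> {for (x, t), continuous (fun p => f p.1 p.2)}.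
Proof.
move=> oA cf Ax t0.
have oC : open (A `*` [set t : R | 0 < t]).
  by apply: open_setX => //; exact: open_gt.
move: cf; rewrite /continuous_cyl continuous_open_subspace// => cf.
by apply: cf; rewrite inE; split.
Qed.

Lemma continuous_cylW A D (f : 'rV[R]_n -> R -> R) : D `<=` A ->
  continuous_cyl A f -> continuous_cyl D f.
Proof. by move=> DA; apply: continuous_subspaceW => -[x t] [/= /DA]. Qed.

Lemma bounded_solutionW phi A D u : D `<=` A ->
  bounded_solution phi A u -> bounded_solution phi D u.
Proof.
move=> DA [[c1 c2 c3 c4] [M uM] eq_u]; split.
- split.
  + exact: continuous_cylW c1.
  + by move=> i; have [h1 h2] := c2 i; split; [move=> x t /DA; exact: h1|exact: continuous_cylW h2].
  + by move=> i j; have [h1 h2] := c3 i j; split; [move=> x t /DA; exact: h1|exact: continuous_cylW h2].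
  + by have [h1 h2] := c4; split; [move=> x t /DA; exact: h1|exact: continuous_cylW h2].
- by exists M => x t /DA; exact: uM.
- by move=> x t /DA; exact: eq_u.
Qed.

(** The Laplacian of phi(u) is the divergence of phi'(u) grad u, by the chain
    rule. *)
Lemma flux_solution_of_bounded_solution (phi : R -> R) A u :
  classC2_line phi -> open A -> bounded_solution phi A u ->
  flux_solution (derive1 phi) A u.
Proof.
move=> [[dphi cphi] [ddphi cdphi]] oA [[c1 c2 c3 [c4 c5]] _ eq_u].
pose ui i x t := partial i (u^~ t) x.
pose zi i x t := derive1 (derive1 phi) (u x t) * ui i x t * ui i x t +
  derive1 phi (u x t) * partial i (partial i (u^~ t)) x.
have Du i x t : A x -> 0 < t -> is_derive x (delta_mx 0 i) (u ^~ t) (ui i x t).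
  by move=> Ax t0; apply: DeriveDef => //; have [h _] := c2 i; exact: h.
have D1 (s : R) : is_derive s 1 phi (derive1 phi s).
  by split; [exact: dphi|rewrite -derive1E].
have D2 (s : R) : is_derive s 1 (derive1 phi) (derive1 (derive1 phi) s).
  by split; [exact: ddphi|rewrite -derive1E].
have Dz i x t : A x -> 0 < t -> is_derive x (delta_mx 0 i)
    (fun y => derive1 phi (u y t) * ui i y t) (zi i x t).
  move=> Ax t0.
  have H1 : is_derive x (delta_mx 0 i) (fun y => derive1 phi (u y t))
      (derive1 (derive1 phi) (u x t) * ui i x t).
    exact: (@is_derive_comp _ _ (derive1 phi) (u ^~ t) x _ _ _ (D2 _) (Du i x t Ax t0)).
  have H2 : is_derive x (delta_mx 0 i) (partial i (u ^~ t)) (partial i (partial i (u^~ t)) x).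
    by apply: DeriveDef => //; have [h _] := c3 i i; exact: h.
  apply: (is_derive_eq (is_deriveM H1 H2)).
  by rewrite /zi /ui /GRing.scale /=; ring.
have cu x t : A x -> 0 < t -> {for x, continuous (u ^~ t)}.
  by move=> Ax t0; apply: continuous_slicel; exact: continuous_cyl_at c1 _ _.
exists (fun x t => derive1 (u x) t), ui, zi; split.
- move=> T; split.
  + by move=> x t Ax /andP[t0 _]; exact: continuous_cyl_at c1 _ _.
  + by move=> x t Ax /andP[t0 _]; exact: (continuous_cyl_at oA c5 Ax t0).
  + move=> x t Ax /andP[t0 _]; apply: DeriveDef; first exact: c4.
    by rewrite derive1E.
  + by move=> i x t Ax /andP[t0 _]; exact: Du.
  + move=> i x t Ax /andP[t0 _]; have [_ h] := c2 i.
    exact: (@continuous_slicel _ _ _ (ui i) x t (continuous_cyl_at oA h Ax t0)).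
  + by move=> i x t Ax /andP[t0 _]; exact: Dz.
  + move=> i x t Ax /andP[t0 _]; have [_ h] := c2 i; have [_ h2] := c3 i i.
    have cui := @continuous_slicel _ _ _ (ui i) x t (continuous_cyl_at oA h Ax t0).
    have cuii := @continuous_slicel _ _ _ (fun x t => partial i (partial i (u^~ t)) x) x t
      (continuous_cyl_at oA h2 Ax t0).
    have ca2 := @continuous_comp _ _ _ (u ^~ t) (derive1 (derive1 phi)) x (cu x t Ax t0) (cdphi _).
    have ca1 := @continuous_comp _ _ _ (u ^~ t) (derive1 phi) x (cu x t Ax t0) (cphi _).
    apply: continuousD; apply: continuousM.
    * by apply: continuousM; [exact: ca2|exact: cui].
    * exact: cui.
    * exact: ca1.
    * exact: cuii.
- move=> x t Ax t0; rewrite eq_u// /laplacian; apply: eq_bigr => i _.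
  rewrite /partial -/(partial i _).
  rewrite (@near_eq_derive _ _ _ _ (fun y => derive1 phi (u y t) * ui i y t)).
    exact: (@derive_val _ _ _ _ _ _ _ (Dz i x t Ax t0)).
  apply: filterS (open_nbhs_nbhs (conj oA Ax)) => y Ay.
  rewrite /partial; apply: (@derive_val _ _ _ _ _ _ _
    (@is_derive_comp _ _ phi (u ^~ t) y _ _ _ (D1 _) (Du i y t Ay t0))).
Qed.

(** With sg = -1 upper bounds turn into lower bounds, and a small b > 0 makes
    a nonnegative solution positive. The new diffusivity has the same bounds
    as a. *)
Lemma flux_solution_affine (a : R -> R) (sg b : R) D u : sg * sg = 1 ->
  flux_solution a D u ->
  flux_solution (fun s => a (sg * (s - b))) D (fun x t => sg * u x t + b).
Proof.
move=> sg2 [ut [ui [zi [ru eq_u]]]].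
exists (fun x t => sg * ut x t), (fun i x t => sg * ui i x t), (fun i x t => sg * zi i x t).
split; last by move=> x t Dx t0; rewrite eq_u// mulr_sumr.
move=> T; have [h1 h2 h3 h4 h5 h6 h7] := ru T; split.
- move=> x t Dx tT; apply: continuousD; last exact: cst_continuous.
  by apply: continuousM; [exact: cst_continuous|exact: h1].
- by move=> x t Dx tT; apply: continuousM; [exact: cst_continuous|exact: h2].
- move=> x t Dx tT; rewrite -[sg * ut x t]addr0; apply: is_deriveD.
  exact: (is_deriveZ sg (h3 x t Dx tT)).
- move=> i x t Dx tT; rewrite -[sg * ui i x t]addr0; apply: is_deriveD.
  exact: (is_deriveZ sg (h4 i x t Dx tT)).
- by move=> i x t Dx tT; apply: continuousM; [exact: cst_continuous|exact: h5].
- move=> i x t Dx tT.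
  rewrite (_ : (fun y => _) = (fun y => sg * (a (u y t) * ui i y t))).
    exact: (is_deriveZ sg (h6 i x t Dx tT)).
  by apply/funext => y; rewrite addrK (mulrA sg sg) sg2 mul1r mulrCA.
- by move=> i x t Dx tT; apply: continuousM; [exact: cst_continuous|exact: h7].
Qed.

Lemma continuous_cyl_affine (sg b : R) A u : continuous_cyl A u ->
  continuous_cyl A (fun x t => sg * u x t + b).
Proof.
move=> cu; apply: (within_continuous_comp (g := fun r : R => sg * r + b) cu) => r.
apply: continuousD; last exact: cst_continuous.
by apply: continuousM; [exact: cst_continuous|exact: cvg_id].
Qed.

Lemma classC1_locally_lipschitz (a : R -> R) : classC1_line a -> locally_lipschitz a.
Proof.
move=> [da ca] M.
have [L L0 HL] : exists2 L : R, 0 < L & forall x, `[- M, M]%classic x -> `|derive1 a x| <= L.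
  apply: continuous_compact_bounded; first exact: segment_compact.
  exact: continuous_subspaceT.
exists L; first exact: ltW.
suff H r s : `|r| <= M -> `|s| <= M -> r <= s -> `|a r - a s| <= L * `|r - s|.
  move=> r s rM sM; case: (leP r s) => rs; first exact: H.
  by rewrite distrC (distrC r); apply: H => //; exact: ltW.
move=> rM' sM' rs.
have /andP[Mr rM] : - M <= r <= M by rewrite -ler_norml.
have /andP[Ms sM] : - M <= s <= M by rewrite -ler_norml.
have [||c] := @MVT_segment _ a (derive1 a) r s rs.
- by move=> x _; apply: DeriveDef => //; rewrite derive1E.
- apply: derivable_within_continuous => x _; exact: da.
rewrite in_itv/= => /andP[rc cs] E.
rewrite distrC E normrM (distrC r) ler_wpM2r//; apply: HL.
by rewrite /= in_itv/= (le_trans Mr rc) (le_trans cs sM).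
Qed.

Lemma locally_lipschitz_affine (a : R -> R) (sg b : R) : `|sg| = 1 ->
  locally_lipschitz a -> locally_lipschitz (fun s => a (sg * (s - b))).
Proof.
move=> sg1 aL M; have [L L0 HL] := aL (M + `|b|); exists L => // r s rM sM.
have -> : `|r - s| = `|sg * (r - b) - sg * (s - b)|.
  by rewrite -mulrBr normrM sg1 mul1r; congr `|_|; ring.
by apply: HL; rewrite normrM sg1 mul1r (le_trans (ler_normB _ _))// lerD2r.
Qed.

Lemma continuous_affine (a : R -> R) (sg b : R) : continuous a ->
  continuous (fun s => a (sg * (s - b))).
Proof.
move=> ca s; apply: (@continuous_comp _ _ _ (fun s => sg * (s - b)) a); last exact: ca.
apply: continuousM; first exact: cst_continuous.
by apply: continuousB; [exact: cvg_id|exact: cst_continuous].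
Qed.

(** Passes from convergence in L^1 on K to the one-sided form used in the
    estimates, by squeezing. *)
Lemma pos_L1_cvg D u (g : 'rV[R]_n -> R) K (sg b : R) :
  open D -> (forall x t, D x -> 0 < t -> {for x, continuous (u ^~ t)}) ->
  compact K -> K `<=` D ->
  measurable_fun (@row_of_tuple R n @^-1` K) (g \o @row_of_tuple R n) ->
  (forall x t, K x -> 0 < t -> pos (sg * u x t + b) <= `|u x t - g x|) ->
  (\int[lebesgue_tuple R n]_(v in @row_of_tuple R n @^-1` K)
       (`|u (row_of_tuple v) t - g (row_of_tuple v)|%:E))%E @[t --> 0^'+] --> 0%E ->
  (\int[lebesgue_tuple R n]_(v in @row_of_tuple R n @^-1` K)
       (pos (sg * u (row_of_tuple v) t + b))%:E)%E @[t --> 0^'+] --> 0%E.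
Proof.
move=> oD cu cK KD mg pu ug.
have hc : closed K by apply: compact_closed => //; exact: norm_hausdorff.
have mK := measurable_closed_row_of_tuple hc.
have mu' t : 0 < t -> measurable_fun (@row_of_tuple R n @^-1` K) ((u ^~ t) \o @row_of_tuple R n).
  move=> t0; apply: (@measurable_funS _ _ _ _ (@row_of_tuple R n @^-1` D)).
  - exact: measurable_row_of_tuple.
  - by move=> v /KD.
  - by apply: measurable_fun_open_row => // x Dx; exact: cu.
apply: (@squeeze_cvge _ _ _ _ (cst 0%E) _ _ _ _ _ ug); last exact: cvg_cst.
near=> t; have t0 : 0 < t by near: t; exact: nbhs_right_gt.
apply/andP; split; first by apply: integral_ge0 => v _; rewrite lee_fin pos_ge0.
apply: ge0_le_integral => //.
- by move=> v _; rewrite lee_fin pos_ge0.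
- apply/measurable_EFinP.
  apply: (@measurableT_comp _ _ _ _ _ _ pos _ (fun v => sg * u (row_of_tuple v) t + b)).
    by apply: continuous_measurable_fun; exact: continuous_pos.
  apply: measurable_funD; last exact: measurable_cst.
  by apply: measurable_funM; [exact: measurable_cst|exact: mu'].
- apply/measurable_EFinP; apply: measurableT_comp => //.
  by apply: measurable_funB; [exact: mu'|exact: mg].
- by move=> v Kv; rewrite lee_fin; exact: pu.
Unshelve. all: by end_near. Qed.

End solutions.

(** * Positivity and lower bounds for the pressure *)

Section bounds.
Context {R : realType} (n : nat).
Variables (a : R -> R) (d1 d2 : R).
Hypothesis ca : continuous a.
Hypothesis d10 : 0 < d1.
Hypothesis ab : forall s, d1 <= a s <= d2.
Hypothesis aL : locally_lipschitz a.
Implicit Types (D K : set 'rV[R]_n) (u : 'rV[R]_n -> R -> R).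
Let k := n%:R * d2 / 2.

Let d20 : 0 < d2.
Proof. by case/andP: (ab 0) => h1 h2; apply: lt_le_trans h2; exact: lt_le_trans h1. Qed.

Let k0 : 0 <= k.
Proof. by rewrite /k divr_ge0// mulr_ge0// ltW. Qed.

(** The triangle inequality with squares, the cross term being split with
    weight e. *)
Lemma sqdist_triangle (x y z : 'rV[R]_n) (e : R) : 0 < e ->
  sqdist x z <= (1 + e) * sqdist y z + (1 + e^-1) * sqdist x y.
Proof.
move=> e0; rewrite /sqdist !mulr_sumr -big_split /=; apply: ler_sum => i _.
rewrite -subr_ge0.
set p := x 0 i; set q := y 0 i; set s := z 0 i.
have -> : (1 + e) * (s - q) ^+ 2 + (1 + e^-1) * (q - p) ^+ 2 - (s - p) ^+ 2 =
    e^-1 * (e * (s - q) - (q - p)) ^+ 2.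
  by field; rewrite gt_eqF.
by rewrite mulr_ge0 ?invr_ge0 ?sqr_ge0// ltW.
Qed.

(** The boundary condition allows upper_estimate for - u in arbitrarily large
    balls. If u x0 t0 were negative, the pressure of - u there would be at
    most - r ^ 2 / (8 t0) + Z for all r, and a large r is a contradiction. *)
Lemma solution_ge0 D u M : open D -> flux_solution a D u ->
  continuous_cyl (closure D) u -> 0 < M ->
  (forall x t, D x -> 0 < t -> `|u x t| <= M) ->
  (forall x t, boundary D x -> 0 < t -> 0 <= u x t) ->
  vanishes_initially D (fun x t => -1 * u x t + 0) ->
  forall x t, D x -> 0 < t -> 0 <= u x t.
Proof.
move=> oD su cu M0 uM ub L1 x0 t0 Dx0 t00; rewrite leNgt; apply/negP => u0.
have sg1 : -1 * -1 = 1 :> R by rewrite mulrNN mulr1.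
have ca' := @continuous_affine _ a (-1) 0 ca.
have ab' s : d1 <= a (-1 * (s - 0)) <= d2 by exact: ab.
have aL' := locally_lipschitz_affine 0 (normrN1 R) aL.
pose a' s := a (-1 * (s - 0)).
have su' := flux_solution_affine 0 sg1 su.
have cu' := @continuous_cyl_affine _ _ (-1) 0 _ _ cu.
have v0 : 0 < -1 * u x0 t0 + 0 by rewrite addr0 mulN1r oppr_gt0.
pose Z := pressure a' (M + 1) + k * (ln (2 * t0) - ln (2 * t0 - t0)).
pose r := 8 * t0 * (`|Z| + `|pressure a' (-1 * u x0 t0 + 0)| + 1) + 1.
have r1 : 1 <= r.
  by rewrite /r lerDr mulr_ge0// ?mulr_ge0// ?(ltW t00)// !addr_ge0.
have r0 : 0 < r by exact: lt_le_trans r1.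
have := @upper_estimate _ _ _ _ _ ca' d10 ab' aL' D _ x0 r M (2 * t0) t0 oD su' cu' M0.
have H1 x t : D x -> 0 < t -> -1 * u x t + 0 <= M.
  move=> Dx tp; rewrite addr0 mulN1r; apply: le_trans (uM x t Dx tp).
  by rewrite -normrN; exact: ler_norm.
have H2 x t : boundary D x -> sqdist x0 x <= r ^+ 2 -> 0 < t -> -1 * u x t + 0 <= 0.
  by move=> bx _ tp; rewrite addr0 mulN1r oppr_le0; exact: ub.
have H3 : 0 < t0 < 2 * t0 by rewrite t00/=; lra.
move=> /(_ H1 Dx0 r0 H2 L1 H3); rewrite -/k -addrA -/a' -/Z => H.
have : pressure a' (-1 * u x0 t0 + 0) <= - r ^+ 2 / (4 * (2 * t0)) + Z.
  move: H; rewrite le_eqVlt => /predU1P[->|H]; first by rewrite densityK.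
  by have := pressure_homo ca' d10 ab' v0 H; rewrite densityK => /ltW.
have rr : r <= r ^+ 2 by rewrite expr2 ler_peMl// ltW.
have : r / (8 * t0) <= r ^+ 2 / (8 * t0).
  by rewrite ler_pM2r// invr_gt0 mulr_gt0.
have -> : r / (8 * t0) = (`|Z| + `|pressure a' (-1 * u x0 t0 + 0)| + 1) + (8 * t0)^-1.
  by rewrite /r; field; rewrite gt_eqF.
have -> : - r ^+ 2 / (4 * (2 * t0)) = - (r ^+ 2 / (8 * t0)) by field; rewrite gt_eqF.
have : 0 < (8 * t0)^-1 by rewrite invr_gt0 mulr_gt0.
have := ler_norm Z; have := ler_norm (- pressure a' (-1 * u x0 t0 + 0)).
rewrite normrN; move: (pressure _ _) => p h1 h2 h3 h4 h5.
by lra.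
Qed.

(** Where the initial datum is 1, upper_estimate applies to 1 - u and shows
    that it becomes small at short times. This stands in for the boundary
    values in the Cauchy problem. *)
Lemma exterior_ge_half (y : 'rV[R]_n) (rho M : R) u :
  0 < rho -> flux_solution a (sqball y rho) u ->
  continuous_cyl (closure (sqball y rho)) u -> 0 < M ->
  (forall x t, sqball y rho x -> 0 < t -> `|u x t| <= M) ->
  vanishes_initially (sqball y rho) (fun x t => -1 * u x t + 1) ->
  exists2 T : R, 0 < T & forall x t, sqdist y x <= (rho / 4) ^+ 2 -> 0 < t < T ->
    1 / 2 <= u x t.
Proof.
move=> rho0 su cu M0 uM L1.
have sg1 : -1 * -1 = 1 :> R by rewrite mulrNN mulr1.
have ca' := @continuous_affine _ a (-1) 1 ca.
have ab' s : d1 <= a (-1 * (s - 1)) <= d2 by exact: ab.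
have aL' := locally_lipschitz_affine 1 (normrN1 R) aL.
pose a' s := a (-1 * (s - 1)).
have su' := flux_solution_affine 1 sg1 su.
have cu' := @continuous_cyl_affine _ _ (-1) 1 _ _ cu.
pose Z := `|pressure a' (M + 1 + 1)| + k * ln 2 + `|pressure a' (1 / 2)|.
have Z0 : 0 <= Z by rewrite /Z !addr_ge0// mulr_ge0// ln_ge0// ler1n.
exists ((rho / 4) ^+ 2 / (8 * (Z + 1))).
  by rewrite !(divr_gt0, exprn_gt0, mulr_gt0)// ltr_wpDl.
move=> x t yx /andP[t0 tZ].
have r0 : 0 < rho / 4 by rewrite divr_gt0.
have Bx : sqball y rho x.
  rewrite /sqball /=; apply: le_lt_trans yx _.
  by rewrite ltrXn2r ?nnegrE ?(ltW rho0) ?(ltW r0)// ltr_pdivrMr// ltr_pMr// (ltr_nat _ 1 4).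
have M10 : 0 < M + 1 by rewrite ltr_wpDr// ltW.
have := @upper_estimate _ _ _ _ _ ca' d10 ab' aL' _ _ x (rho / 4) (M + 1) (2 * t) t
  (@open_sqball _ _ y rho) su' cu' M10.
have H1 x' t' : sqball y rho x' -> 0 < t' -> -1 * u x' t' + 1 <= M + 1.
  move=> Dx tp; rewrite lerD2r mulN1r; apply: le_trans (uM x' t' Dx tp).
  by rewrite -normrN; exact: ler_norm.
have H2 x' t' : boundary (sqball y rho) x' -> sqdist x x' <= (rho / 4) ^+ 2 -> 0 < t' ->
    -1 * u x' t' + 1 <= 0.
  move=> /(boundary_notin (@open_sqball _ _ y rho)) nB xx'; exfalso; apply: nB; rewrite /sqball /=.
  have := sqdist_triangle y x x' ltr01; rewrite invr1 => h.
  have := exprn_gt0 2 rho0; move: h yx xx'; rewrite expr_div_n => h h1 h2 h3.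
  by lra.
have H3 : 0 < t < 2 * t by rewrite t0/=; lra.
move=> /(_ H1 Bx r0 H2 L1 H3); rewrite -/k -/a'.
have -> : ln (2 * t) - ln (2 * t - t) = ln 2.
  have -> : 2 * t - t = t by ring.
  by rewrite lnM ?posrE// addrK.
move=> H; suff : -1 * u x t + 1 < 1 / 2 by rewrite mulN1r; lra.
apply: le_lt_trans H _.
rewrite -[ltRHS](pressureK ca' d10 ab'); last by lra.
apply: density_homo.
have h1 : Z + 1 < (rho / 4) ^+ 2 / (8 * t).
  rewrite ltr_pdivlMr ?mulr_gt0//; move: tZ; rewrite ltr_pdivlMr ?mulr_gt0 ?ltr_wpDl//.
  by apply: le_lt_trans; rewrite le_eqVlt; apply/orP; left; apply/eqP; ring.
have -> : - (rho / 4) ^+ 2 / (4 * (2 * t)) = - ((rho / 4) ^+ 2 / (8 * t)) by field; rewrite gt_eqF.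
have := ler_norm (pressure a' (M + 1 + 1)); have := ler_norm (- pressure a' (1 / 2)).
rewrite normrN; move: h1; rewrite /Z; move: ((rho / 4) ^+ 2 / _) (k * _) => A B.
rewrite -/a'; move: (pressure a' _) (pressure a' _) => p q h1 h2 h3.
by lra.
Qed.

(** As lower_estimate needs a positive lower bound, it is applied to u + e,
    whose diffusivity is a (s - e). Since a (s - e) and a are close to a 0 up
    to a multiple of s, both pressures are a 0 times a logarithm up to L,
    uniformly in e. So u + e >= exp ((p - L) / a 0), where e can tend to 0,
    and going back to the pressure of u costs L once more. *)
Lemma pressure_lower_bound D u (y : 'rV[R]_n) (rho T L : R) :
  open D -> flux_solution a D u -> continuous_cyl (closure D) u ->
  (forall x t, D x -> 0 < t -> 0 <= u x t) ->
  0 < rho -> (forall x, closure D x -> rho ^+ 2 <= sqdist y x) ->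
  0 < T -> (forall x t, boundary D x -> 0 < t < T -> 1 / 2 <= u x t) ->
  0 <= L -> (forall s, 0 <= s <= 1 -> `|a s - a 0| <= L * s) ->
  exists2 T1 : R, 0 < T1 & forall x t, D x -> 0 < t < T1 ->
    0 < u x t /\ - sqdist y x / (4 * t) - 2 * L <= pressure a (u x t).
Proof.
move=> oD su cu u0 rho0 rhoD T0 ub L0 HL.
have a00 : 0 < a 0 := flux_gt0 d10 ab 0.
have h2 : 0 < 1 / 2 :> R by rewrite divr_gt0.
have l2 : ln (1 / 2) <= 0 :> R by rewrite ln_le0// ler_pdivrMr// mul1r ler1n.
have [s0 s00 Hs0] := gaussian_tail n d10 ab (d2 * ln (1 / 2)) rho0.
pose T1 := Num.min (Num.min T s0) 1.
have T10 : 0 < T1 by rewrite !lt_min T0 s00 ltr01.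
have T1P t : t < T1 -> [/\ t < T, t < s0 & t < 1] by rewrite !lt_min => /andP[/andP[]].
exists T1 => // x t Dx /[dup] tT /andP[t0 tT1].
have [tT' ts0 t1] := T1P t tT1.
pose p := - sqdist y x / (4 * t) - k * ln t.
have p0 : p < 0.
  have : p <= - rho ^+ 2 / (4 * t) - k * ln t.
    rewrite /p lerD2r ler_pM2r ?invr_gt0 ?mulr_gt0// lerN2.
    by apply: rhoD; exact: subset_closure.
  move/le_lt_trans; apply; apply: lt_le_trans (Hs0 t _) _; first by rewrite t0.
  by rewrite mulr_ge0_le0// ltW.
have key e : 0 < e -> e < 1 / 2 -> expR ((p - L) / a 0) <= u x t + e.
  move=> e0 e12.
  have sg1 : 1 * 1 = 1 :> R by rewrite mulr1.
  have ca' := @continuous_affine _ a 1 e ca.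
  have ab' s : d1 <= a (1 * (s - e)) <= d2 by exact: ab.
  have aL' := locally_lipschitz_affine e (normr1 R) aL.
  pose a' s := a (1 * (s - e)).
  have su' := flux_solution_affine e sg1 su.
  have cu' := @continuous_cyl_affine _ _ 1 e _ _ cu.
  have := @lower_estimate _ _ _ _ _ ca' d10 ab' aL' D _ y x rho (1 / 2) T1 e t oD su' cu' e0.
  have H1 x' t' : D x' -> 0 < t' -> e <= 1 * u x' t' + e.
    by move=> Dx' tp; rewrite mul1r lerDr; exact: u0.
  have H2 x' t' : boundary D x' -> 0 < t' < T1 -> 1 / 2 <= 1 * u x' t' + e.
    move=> bx /andP[tp /T1P[h _ _]]; rewrite [1 * u _ _]mul1r.
    by apply: le_trans (ub x' t' bx _) _; rewrite ?tp// lerDl ltW.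
  have H3 s : 0 < s < T1 -> - rho ^+ 2 / (4 * s) - n%:R * d2 / 2 * ln s < pressure a' (1 / 2).
    move=> /andP[sp /T1P[_ h _]]; apply: lt_le_trans (Hs0 s _) _; first by rewrite sp.
    apply: (pressure_lower ca' ab') => //.
    by rewrite ler_pdivrMr// mul1r ler1n.
  move=> /(_ H1 rho0 rhoD h2 H2 H3 Dx tT); rewrite -/k -/p mul1r => H.
  have r0 : 0 < u x t + e by rewrite ltr_wpDl// u0.
  suff Hl : (p - L) / a 0 <= ln (u x t + e).
    by rewrite -[leRHS]lnK ?posrE// ler_expR.
  rewrite ler_pdivrMr// mulrC.
  have [r1|r1] := leP (u x t + e) 1; last first.
    have : 0 <= a 0 * ln (u x t + e) by rewrite mulr_ge0 ?(ltW a00)// ln_ge0// ltW.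
    by lra.
  have pr : p <= pressure a' (u x t + e).
    move: H; rewrite le_eqVlt => /predU1P[<-|H]; first by rewrite densityK.
    by have := pressure_homo ca' d10 ab' (density_gt0 _ _ _ _) H; rewrite densityK => /ltW.
  have : `|pressure a' (u x t + e) - a 0 * ln (u x t + e)| <= L.
    apply: (pressure_ln ca') => // z /andP[rz z1].
    have ez : e <= z by apply: le_trans rz; rewrite lerDr u0.
    rewrite /a' mul1r; apply: le_trans (HL _ _) _.
      by rewrite subr_ge0 ez/=; lra.
    by rewrite ler_wpM2l//; lra.
  by rewrite ler_norml => /andP[_]; lra.
have uexp : expR ((p - L) / a 0) <= u x t.
  apply/ler_addgt0Pr => e e0; have [e12|e12] := ltP e (1 / 2); first exact: key.
  by apply: le_trans (key (1 / 4) _ _) _; lra.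
have up : 0 < u x t by apply: lt_le_trans uexp; exact: expR_gt0.
split => //.
have pk : - sqdist y x / (4 * t) - 2 * L <= p - 2 * L.
  by rewrite lerD2r /p lerDl oppr_ge0 mulr_ge0_le0// ln_le0// ltW.
apply: le_trans pk _.
have [u1|u1] := leP (u x t) 1; last first.
  have : 0 <= pressure a (u x t).
    by apply: le_trans (pressure_ge ca ab (ltW u1)); rewrite mulr_ge0 ?(ltW d10)// ln_ge0// ltW.
  by lra.
have : `|pressure a (u x t) - a 0 * ln (u x t)| <= L.
  apply: (pressure_ln ca) => // z /andP[uz z1]; apply: HL.
  by rewrite z1 andbT; apply: le_trans uz; exact: ltW.
have : (p - L) / a 0 <= ln (u x t) by rewrite -ler_expR lnK// posrE.
rewrite ler_pdivrMr// mulrC => h; rewrite ler_norml => /andP[h' _].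
by lra.
Qed.

End bounds.

(** * Euclidean distance and exterior points *)

Section distance.
Context {R : realType} (n : nat).
Implicit Types (A D K : set 'rV[R]_n) (x y z : 'rV[R]_n).

Lemma sqdist_sym x y : sqdist x y = sqdist y x.
Proof. by apply: eq_bigr => i _; rewrite -opprB sqrrN. Qed.

Lemma enormE x z : enorm (x - z) = Num.sqrt (sqdist x z).
Proof.
rewrite sqdist_sym /enorm /sqdist; congr Num.sqrt.
by apply: eq_bigr => i _; rewrite !mxE.
Qed.

Lemma normr_sqdist x z : `|x - z| <= Num.sqrt (sqdist z x).
Proof.
apply/ler_rV_norm; first exact: sqrtr_ge0.
by move=> i; rewrite !mxE; exact: sqdist_coord.
Qed.

Lemma edistance_ge0 x A : A !=set0 -> 0 <= edistance x A.
Proof.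
move=> [z Az]; apply: lb_le_inf; first by exists (enorm (x - z)), z.
by move=> _ [z' _ <-]; exact: sqrtr_ge0.
Qed.

Lemma edistance_sqr_le x z A : A z -> edistance x A ^+ 2 <= sqdist x z.
Proof.
move=> Az; rewrite -(sqr_sqrtr (sqdist_ge0 x z)).
have A0 : A !=set0 by exists z.
rewrite ler_sqr ?nnegrE ?sqrtr_ge0 ?edistance_ge0// -enormE.
apply: ge_inf; last by exists z.
by exists 0 => _ [z' _ <-]; exact: sqrtr_ge0.
Qed.

Lemma edistance_sqr_approx x A (e : R) : A !=set0 -> 0 < e ->
  exists2 z, A z & sqdist x z < edistance x A ^+ 2 + e.
Proof.
move=> A0 e0; have d0 := edistance_ge0 x A0.
have lt_d : edistance x A < Num.sqrt (edistance x A ^+ 2 + e).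
  rewrite -[ltLHS]ger0_norm// -sqrtr_sqr ltr_sqrt ?ltrDl//.
  by rewrite ltr_wpDl// sqr_ge0.
have ne : [set enorm (x - y) | y in A] !=set0.
  by case: A0 => z Az; exists (enorm (x - z)), z.
have [_ [z Az <-]] := inf_lt ne lt_d.
rewrite enormE => H; exists z => //.
by move: H; rewrite ltr_sqrt// ltr_wpDl// sqr_ge0.
Qed.

Lemma edistance_gt0 x A D : open D -> D x -> A !=set0 -> A `<=` ~` D ->
  0 < edistance x A.
Proof.
move=> oD Dx [z0 Az0] AD.
have /nbhs_ballP[d /= d0 Hd] := open_nbhs_nbhs (conj oD Dx).
apply: (lt_le_trans d0); apply: lb_le_inf; first by exists (enorm (x - z0)), z0.
move=> _ [z Az <-]; rewrite enormE leNgt; apply/negP => H.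
apply: (AD z Az); apply: Hd; rewrite -ball_normE /=; apply: le_lt_trans H.
by rewrite sqdist_sym; exact: normr_sqdist.
Qed.

Lemma nbhs_sqball D y : nbhs y D -> exists2 rho : R, 0 < rho & sqball y rho `<=` D.
Proof.
move=> /nbhs_ballP[d /= d0 Hd]; exists d => // x xd; apply: Hd.
rewrite -ball_normE /= distrC; apply: le_lt_trans (normr_sqdist _ _) _.
by rewrite -[ltRHS]gtr0_norm// -sqrtr_sqr ltr_sqrt// exprn_gt0.
Qed.

Lemma closure_sqdist_ge D y (rho : R) : sqball y rho `<=` ~` D ->
  forall x, closure D x -> rho ^+ 2 <= sqdist y x.
Proof.
move=> BD x cx.
have : closure [set x | rho ^+ 2 <= sqdist y x] x.
  move: x cx; apply: closure_subset => x Dx /=; rewrite leNgt; apply/negP => h.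
  exact: (BD x h Dx).
rewrite -(closure_id _).1//.
rewrite (_ : [set x | _] = sqdist y @^-1` [set t | rho ^+ 2 <= t])//.
by apply: closed_comp; [move=> z _; exact: continuous_sqdist|exact: closed_ge].
Qed.

Lemma continuous_col' (i : 'I_n) : continuous (fun x : 'rV[R]_n => col' i x).
Proof.
move=> x P /nbhs_ballP[e /= e0 He]; apply/nbhs_ballP; exists e => // y.
rewrite -ball_normE /= => xy; apply: He; rewrite -ball_normE /=.
apply: le_lt_trans xy; apply/ler_rV_norm => // j; rewrite !mxE.
by have := ler_coord_norm (x - y) (lift i j); rewrite !mxE.
Qed.

(** The set is locally an epigraph, so moving p by s against the axis brings
    it strictly below the graph, where a whole neighbourhood lies outside D.
    *)
Lemma boundary_exterior D p (V : set 'rV[R]_n) :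
  open D -> boundary_classC2 D -> boundary D p -> nbhs p V ->
  exists y, V y /\ exists2 rho : R, 0 < rho & sqball y rho `<=` ~` D.
Proof.
move=> oD bC2 bp Vp.
have [i [b [g [[[cg _] _] nearp]]]] := bC2 p bp.
have nDp := boundary_notin oD bp.
pose sg : R := (-1) ^+ b.
have sg2 : sg * sg = 1 by rewrite -expr2 sqrr_sign.
have : nbhs p (V `&` [set x | D x <-> g (col' i x) < sg * x 0 i]) by exact: filterI.
move=> /nbhs_ballP[d /= d0 Hd].
have gp : sg * p 0 i <= g (col' i p).
  by rewrite leNgt; apply/negP => /(nbhs_singleton nearp).
pose s := d / 2.
have s0 : 0 < s by rewrite divr_gt0.
have sd : s < d by rewrite /s ltr_pdivrMr// ltr_pMr// (ltr_nat _ 1 2).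
pose y : 'rV[R]_n := p - (s * sg) *: delta_mx 0 i.
have yd : ball p d y.
  rewrite -ball_normE /= /y opprB addrC subrK normrZ.
  apply: le_lt_trans sd; rewrite normrM (gtr0_norm s0) normr_sign mulr1.
  by rewrite -[leRHS]mulr1 ler_pM2l//; exact: normr_delta_mx.
have cy : col' i y = col' i p.
  apply/rowP => j; rewrite !mxE eqxx /= [lift i j == i]eq_sym (negbTE (neq_lift _ _)).
  by rewrite mulr0 subr0.
have yi : sg * y 0 i = sg * p 0 i - s.
  by rewrite !mxE !eqxx mulr1 mulrBr mulrCA sg2 mulr1.
exists y; split; first by have [] := Hd y yd.
apply: nbhs_sqball.
have near1 : nbhs y [set x : 'rV[R]_n | sg * x 0 i < g (col' i x)].
  have cf : {for y, continuous (fun x : 'rV[R]_n => g (col' i x) - sg * x 0 i)}.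
    apply: continuousB.
      by apply: (@continuous_comp _ _ _ (col' i) g y); [exact: continuous_col'|exact: cg].
    by apply: continuousM; [exact: cst_continuous|exact: coord_continuous].
  have y0 : 0 < g (col' i y) - sg * y 0 i by rewrite cy yi; lra.
  rewrite (_ : [set x | _] = (fun x : 'rV[R]_n => g (col' i x) - sg * x 0 i) @^-1` [set t | 0 < t]).
    exact: (cf _ (open_nbhs_nbhs (conj (@open_gt R 0) y0))).
  by apply/seteqP; split => x /=; rewrite subr_gt0.
have near2 : nbhs y (ball p d).
  apply: open_nbhs_nbhs; split => //.
  exact: ball_open.
apply: filterS2 near1 near2 => x h /Hd[_ Dx] /Dx.
by rewrite ltNge (ltW h).
Qed.

End distance.

(** * Short-time asymptotics *)

Section asymptotics.
Context {R : realType} (n : nat).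
Variables (a : R -> R) (d1 d2 : R).
Hypothesis ca : continuous a.
Hypothesis d10 : 0 < d1.
Hypothesis ab : forall s, d1 <= a s <= d2.
Hypothesis aL : locally_lipschitz a.
Implicit Types (D K : set 'rV[R]_n) (u : 'rV[R]_n -> R -> R).

(** In upper_estimate the radius (1 - h) d(x) keeps the ball off the boundary
    and the focusing time (1 + h) t is close to t. The leading term is (1 - h)
    ^ 2 / (1 + h) >= 1 - 3 h times d ^ 2, and what remains is t times the
    constant Z. The choices of h and Z depend on x only through a local bound
    D0 for d ^ 2. *)
Lemma upper_asymptotics D u (M : R) x0 (e : R) :
  open D -> boundary D !=set0 -> flux_solution a D u ->
  continuous_cyl (closure D) u -> 0 < M ->
  (forall x t, D x -> 0 < t -> u x t <= M) ->
  vanishes_initially D u -> D x0 -> 0 < e ->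
  exists V T, [/\ nbhs x0 V, 0 < T & forall x t, V x -> D x -> 0 < t < T -> 0 < u x t ->
    edistance x (boundary D) ^+ 2 - e <= - 4 * t * pressure a (u x t)].
Proof.
move=> oD [p bp] su cu M0 uM L1 Dx0 e0.
pose D0 := sqdist x0 p + 1.
have D00 : 0 < D0 by rewrite /D0 ltr_wpDl// sqdist_ge0.
pose V := [set x | sqdist p x < D0].
have oV : open V.
  rewrite (_ : V = sqdist p @^-1` [set t | t < D0])//.
  by apply: open_comp; [move=> x _; exact: continuous_sqdist|exact: open_lt].
have Vx0 : V x0 by rewrite /V /= sqdist_sym /D0 ltrDl.
pose h := Num.min (1 / 2) (e / (6 * D0)).
have h0 : 0 < h by rewrite lt_min !divr_gt0// mulr_gt0.
have h12 : h <= 1 / 2 by rewrite ge_min lexx.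
have hD : 3 * h * D0 <= e / 2.
  have : h <= e / (6 * D0) by rewrite ge_min lexx orbT.
  by rewrite ler_pdivlMr ?mulr_gt0//; lra.
pose Z := pressure a (M + 1) + n%:R * d2 / 2 * (ln (1 + h) - ln h).
pose T := e / (8 * (`|Z| + 1)).
have Z1 : 0 < `|Z| + 1 by rewrite ltr_wpDl.
exists V, T; split.
- exact: open_nbhs_nbhs.
- by rewrite divr_gt0// mulr_gt0.
move=> x t Vx Dx /andP[t0 tT] u0.
have bD : boundary D !=set0 by exists p.
have dp : 0 < edistance x (boundary D).
  by apply: (edistance_gt0 oD Dx bD) => z /(boundary_notin oD).
set d := edistance x (boundary D) in dp *.
have dD0 : d ^+ 2 <= D0.
  apply: le_trans (edistance_sqr_le x bp) _.
  by rewrite sqdist_sym; exact: ltW.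
pose r := (1 - h) * d.
have r0 : 0 < r by rewrite mulr_gt0// subr_gt0; lra.
have H2 z s : boundary D z -> sqdist x z <= r ^+ 2 -> 0 < s -> u z s <= 0.
  move=> bz xz _; exfalso.
  have := le_trans (edistance_sqr_le x bz) xz; rewrite -/d.
  rewrite leNgt => /negP; apply; rewrite ltrXn2r// ?nnegrE ?(ltW r0) ?(ltW dp)//.
  by rewrite /r gtr_pMl// gtrBl.
have H3 : 0 < t < (1 + h) * t by rewrite t0/= ltr_pMl// ltrDl.
have := @upper_estimate _ _ _ _ _ ca d10 ab aL D u x r M ((1 + h) * t) t
  oD su cu M0 uM Dx r0 H2 L1 H3.
have -> : (1 + h) * t - t = h * t by ring.
have h1 : 0 < 1 + h by rewrite ltr_pwDr.
have -> : ln ((1 + h) * t) - ln (h * t) = ln (1 + h) - ln h.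
  by rewrite !lnM ?posrE//; ring.
rewrite -addrA -/Z => H.
have Pu : pressure a (u x t) <= - r ^+ 2 / (4 * ((1 + h) * t)) + Z.
  move: H; rewrite le_eqVlt => /predU1P[->|H]; first by rewrite densityK.
  by have := pressure_homo ca d10 ab u0 H; rewrite densityK => /ltW.
have t4 : 0 < 4 * t by rewrite mulr_gt0.
have := ler_wpM2l (ltW t4) Pu.
have -> : 4 * t * (- r ^+ 2 / (4 * ((1 + h) * t)) + Z) = - (r ^+ 2 / (1 + h)) + 4 * t * Z.
  by field; rewrite !gt_eqF.
have Zt : 4 * t * Z <= e / 2.
  apply: (@le_trans _ _ (4 * t * (`|Z| + 1))).
    by rewrite ler_wpM2l ?(ltW t4)//; have := ler_norm Z; lra.
  by move: tT; rewrite /T ltr_pdivlMr ?mulr_gt0// => /ltW; lra.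
have rd : (1 - 3 * h) * d ^+ 2 <= r ^+ 2 / (1 + h).
  rewrite ler_pdivlMr// /r exprMn mulrAC ler_pM2r ?exprn_gt0//.
  by have := sqr_ge0 h; lra.
have hd : 3 * h * d ^+ 2 <= e / 2.
  by apply: le_trans hD; rewrite ler_pM2l// mulr_gt0.
rewrite mulNr mulNr; move: rd hd Zt.
move: (r ^+ 2 / _) (4 * t * pressure _ _) => A B.
by move=> *; lra.
Qed.

(** The pressure is bounded below by a Gaussian centred at any exterior point
    y. One y, exterior and close to an almost nearest boundary point of x0,
    serves for all x near x0, because |x - y| ^ 2 and d(x) ^ 2 are both close
    to d(x0) ^ 2. *)
Lemma lower_asymptotics D u x0 (L e : R) :
  open D -> boundary_classC2 D -> boundary D !=set0 -> D x0 -> 0 < e -> 0 <= L ->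
  (forall y (rho : R), 0 < rho -> sqball y rho `<=` ~` D ->
    exists2 T : R, 0 < T & forall x t, D x -> 0 < t < T ->
      0 < u x t /\ - sqdist y x / (4 * t) - L <= pressure a (u x t)) ->
  exists V T, [/\ nbhs x0 V, 0 < T & forall x t, V x -> D x -> 0 < t < T -> 0 < u x t /\
    - 4 * t * pressure a (u x t) <= edistance x (boundary D) ^+ 2 + e].
Proof.
move=> oD bC2 bD Dx0 e0 L0 lowb.
set d := fun x => edistance x (boundary D) ^+ 2.
have e4 : 0 < e / 4 by rewrite divr_gt0.
have [p bp xp] := edistance_sqr_approx x0 bD e4.
have osq (z : 'rV[R]_n) (s : R) : open [set x | sqdist z x < s].
  rewrite (_ : [set x | _] = sqdist z @^-1` [set t | t < s])//.
  by apply: open_comp; [move=> x _; exact: continuous_sqdist|exact: open_lt].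
have [y [xy [rho rho0 BD]]] := boundary_exterior oD bC2 bp
  (open_nbhs_nbhs (conj (osq x0 _) xp)).
have [T1 T10 HT1] := lowb y rho rho0 BD.
pose D0 := sqdist p x0 + 1.
have D00 : 0 < D0 by rewrite /D0 ltr_wpDl// sqdist_ge0.
(* The weight h in sqdist_triangle makes h d(x) ^ 2 small for x near x0; s is
   then the size of the neighbourhood that keeps the other term small. *)
pose h := e / (16 * (D0 + e)).
have De : 0 < D0 + e by rewrite addr_gt0.
have h0 : 0 < h by rewrite divr_gt0// mulr_gt0.
have hE : h * (D0 + e) = e / 16 by rewrite /h; field; rewrite gt_eqF.
pose s := e / (16 * (1 + h^-1)).
have h1 : 0 < 1 + h^-1 by rewrite ltr_pwDl// invr_ge0 ltW.
have s0 : 0 < s by rewrite divr_gt0// mulr_gt0.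
have sE : (1 + h^-1) * s = e / 16 by rewrite /s; field; rewrite !gt_eqF// ltr_wpDr// ltW.
pose V := [set x | sqdist y x < d x0 + e / 4] `&`
  ([set x | sqdist p x < D0] `&` [set x | sqdist x0 x < s]).
pose T := Num.min T1 (e / (16 * (L + 1))).
have L1 : 0 < L + 1 by rewrite ltr_wpDl.
exists V, T; split.
- apply: open_nbhs_nbhs; split; first by do 2 apply: openI => //.
  split; first by rewrite /= sqdist_sym.
  split; first by rewrite /= /D0 ltrDl.
  by rewrite /= /sqdist big1// => i _; rewrite subrr expr0n.
- by rewrite lt_min T10 divr_gt0// mulr_gt0.
move=> x t [Vy [Vp Vx]] Dx /andP[t0]; rewrite lt_min => /andP[tT1 tL].
have [u0 Pu] := HT1 x t Dx (introT andP (conj t0 tT1)); split => //.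
have dx : d x <= D0.
  by apply: le_trans (edistance_sqr_le x bp) _; rewrite sqdist_sym; exact: ltW.
have e16 : 0 < e / 16 by rewrite divr_gt0.
have [z bz xz] := edistance_sqr_approx x bD e16.
have h_le1 : h <= 1.
  rewrite /h ler_pdivrMr ?mulr_gt0// mul1r.
  by lra.
have dx0 : d x0 <= d x + e / 4.
  apply: le_trans (edistance_sqr_le x0 bz) _.
  apply: le_trans (sqdist_triangle x0 x z h0) _.
  have k1 : (1 + h) * sqdist x z <= (1 + h) * (d x + e / 16).
    by rewrite ler_pM2l ?(ltW xz)// ltr_pwDl// ltW.
  have k2 : (1 + h^-1) * sqdist x0 x <= (1 + h^-1) * s by rewrite ler_pM2l// ltW.
  have k3 : h * (d x + e / 16) <= h * (D0 + e).
    by rewrite ler_pM2l// lerD// ; lra.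
  by move: k1 k2 k3; rewrite sE hE mulrDl mul1r => k1 k2 k3; lra.
have t4 : 0 < 4 * t by rewrite mulr_gt0.
have := ler_wpM2l (ltW t4) Pu.
have -> : 4 * t * (- sqdist y x / (4 * t) - L) = - sqdist y x - 4 * t * L.
  by field; rewrite gt_eqF.
have tL' : 4 * t * L <= e / 4.
  apply: (@le_trans _ _ (4 * t * (L + 1))); first by rewrite ler_wpM2l ?(ltW t4)//; lra.
  by move: tL; rewrite ltr_pdivlMr ?mulr_gt0// => /ltW; lra.
rewrite -/(d x) mulNr mulNr; move: Vy => /= Vy.
move: (4 * t * pressure _ _) => A h2.
by lra.
Qed.

End asymptotics.

Section problems.
Context {R : realType} (n : nat).
Variables (phi : R -> R) (d1 d2 : R).
Hypothesis phi_C2 : classC2_line phi.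
Hypothesis d10 : 0 < d1.
Hypothesis ab : forall s, d1 <= derive1 phi s <= d2.
Local Notation a := (derive1 phi).

Let ca : continuous a. Proof. by case: phi_C2 => -[]. Qed.

Let aL : locally_lipschitz a.
Proof. by apply: classC1_locally_lipschitz; case: phi_C2. Qed.

(** The two problems have in common the properties from which the asymptotics
    follow. The lower bound is obtained on D itself when u = 1 on the boundary
    of D. In the Cauchy problem it is obtained on the complement of a small
    ball around y, where u >= 1 / 2 for short times. *)
Lemma solution_bounds (D : set 'rV[R]_n) (u : 'rV[R]_n -> R -> R) (L : R) :
  open D -> IBVP_solution phi D u \/ CP_solution phi D u ->
  0 <= L -> (forall s, 0 <= s <= 1 -> `|a s - a 0| <= L * s) ->
  exists2 M : R, 0 < M & [/\ flux_solution a D u, continuous_cyl (closure D) u,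
    (forall x t, D x -> 0 < t -> u x t <= M), vanishes_initially D u &
    forall y (rho : R), 0 < rho -> sqball y rho `<=` ~` D ->
      exists2 T : R, 0 < T & forall x t, D x -> 0 < t < T ->
      0 < u x t /\ - sqdist y x / (4 * t) - 2 * L <= pressure a (u x t)].
Proof.
move=> oD sol L0 HL.
have cflux (A : set 'rV[R]_n) : flux_solution a A u ->
    forall x t, A x -> 0 < t -> {for x, continuous (u ^~ t)}.
  move=> [ut [ui [zi [ru _]]]] x t Ax t0; apply: continuous_slicel.
  by apply: (flux_continuous (ru (t + 1))) => //; rewrite t0 ltrDl ltr01.
have posE (A : set 'rV[R]_n) : vanishes_initially A (fun x t => 1 * u x t + 0) ->
    vanishes_initially A u.
  move=> H K cK KA; have := H K cK KA.
  by under eq_fun do under eq_integral do rewrite mul1r addr0.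
case: sol => [[bu cu ub L1]|[bu L1]].
- have su := flux_solution_of_bounded_solution phi_C2 oD bu.
  have [M0 uM0] : exists M, forall x t, D x -> 0 < t -> `|u x t| <= M by case: bu.
  have M10 : 0 < `|M0| + 1 by rewrite ltr_wpDl.
  have uM x t : D x -> 0 < t -> `|u x t| <= `|M0| + 1.
    move=> Dx t0; apply: le_trans (uM0 x t Dx t0) _.
    by apply: le_trans (ler_norm _) _; rewrite lerDl.
  have van (sg : R) : `|sg| = 1 -> vanishes_initially D (fun x t => sg * u x t + 0).
    move=> sg1 K cK KD; apply: (pos_L1_cvg (g := fun=> 0) oD (cflux _ su) cK KD) => //.
    + exact: measurable_cst.
    + move=> x t _ t0; rewrite subr0 addr0 -[leRHS]mul1r -sg1 -normrM.
      by rewrite /pos ge_max normr_ge0 ler_norm.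
    + exact: L1.
  have u0 := solution_ge0 ca d10 ab aL oD su cu M10 uM _ (van _ (normrN1 R)).
  have {}u0 : forall x t, D x -> 0 < t -> 0 <= u x t.
    by apply: u0 => x t bx t0; rewrite ub.
  exists (`|M0| + 1) => //; split => //.
  + by move=> x t Dx t0; apply: le_trans (ler_norm _) (uM x t Dx t0).
  + exact/posE/van/normr1.
  + move=> y rho rho0 BD.
    apply: (pressure_lower_bound ca d10 ab aL oD su cu u0 rho0 _ (ltr01 : 0 < 1 :> R)) => //.
      exact: closure_sqdist_ge.
    by move=> x t bx /andP[t0 _]; rewrite ub//; lra.
- have suT := flux_solution_of_bounded_solution phi_C2 openT bu.
  have su (A : set 'rV[R]_n) : open A -> flux_solution a A u.
    by move=> oA; apply: flux_solution_of_bounded_solution => //; exact: bounded_solutionW bu.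
  have cuT : continuous_cyl setT u by case: bu => -[].
  have cu (A : set 'rV[R]_n) : continuous_cyl A u by exact: continuous_cylW cuT.
  have [M0 uM0] : exists M, forall x t, setT x -> 0 < t -> `|u x t| <= M by case: bu.
  have M10 : 0 < `|M0| + 1 by rewrite ltr_wpDl.
  have uM x t : setT x -> 0 < t -> `|u x t| <= `|M0| + 1.
    move=> Dx t0; apply: le_trans (uM0 x t Dx t0) _.
    by apply: le_trans (ler_norm _) _; rewrite lerDl.
  have mD : measurable (@row_of_tuple R n @^-1` (~` D)).
    by apply: measurable_closed_row_of_tuple; exact: open_closedC.
  have mg (K : set 'rV[R]_n) : measurable_fun (@row_of_tuple R n @^-1` K)
      ((\1_(~` D) : 'rV[R]_n -> R) \o @row_of_tuple R n).
    apply: measurable_funTS.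
    rewrite (_ : _ \o _ = \1_(@row_of_tuple R n @^-1` (~` D)) :> (_ -> R)).
      exact: measurable_indic.
    by apply/funext => v; rewrite /= !indicE.
  have van (A : set 'rV[R]_n) (sg b : R) :
      (forall x t, A x -> 0 < t -> pos (sg * u x t + b) <= `|u x t - \1_(~` D) x|) ->
      vanishes_initially A (fun x t => sg * u x t + b).
    move=> H K cK KA; apply: (pos_L1_cvg openT (cflux _ suT) cK _ (mg K)) => //.
    + by move=> x t Kx t0; apply: H => //; exact: KA.
    + exact: L1.
  have u0 : forall x t, setT x -> 0 < t -> 0 <= u x t.
    apply: (solution_ge0 ca d10 ab aL openT suT (cu _) M10 uM) => [x t|].
      by move=> /(boundary_notin openT)/(_ Logic.I).
    apply: van => x t _ t0; rewrite /pos ge_max normr_ge0 /= addr0 mulN1r.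
    have : 0 <= \1_(~` D) x :> R by rewrite indicE.
    move=> h; apply: (@le_trans _ _ (- (u x t - \1_(~` D) x))); first by lra.
    by rewrite -normrN ler_norm.
  exists (`|M0| + 1) => //; split => //.
  + exact: su.
  + by move=> x t Dx t0; apply: le_trans (ler_norm _) (uM x t Logic.I t0).
  + apply/posE/van => x t Dx t0; rewrite mul1r addr0 indicE memNset ?subr0.
      by rewrite /pos ge_max normr_ge0 ler_norm.
    by move=> /(_ Dx).
  + move=> y rho rho0 BD.
    have van1 : vanishes_initially (sqball y rho) (fun x t => -1 * u x t + 1).
      apply: van => x t Bx t0; rewrite indicE mem_set; last exact: BD.
      rewrite /pos ge_max normr_ge0 /= mulN1r -normrN.
      by apply: le_trans (ler_norm _); lra.
    have [T T0 HT] := exterior_ge_half ca d10 ab aL rho0 (su _ (@open_sqball _ _ y rho))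
      (cu _) M10 (fun x t _ => uM x t Logic.I) van1.
    have r0 : 0 < rho / 4 by rewrite divr_gt0.
    pose A := [set x : 'rV[R]_n | (rho / 4) ^+ 2 < sqdist y x].
    have oA : open A.
      rewrite (_ : A = sqdist y @^-1` [set t | (rho / 4) ^+ 2 < t])//.
      by apply: open_comp; [move=> x _; exact: continuous_sqdist|exact: open_gt].
    have [T1 T10 HT1] : exists2 T1 : R, 0 < T1 & forall x t, A x -> 0 < t < T1 ->
        0 < u x t /\ - sqdist y x / (4 * t) - 2 * L <= pressure a (u x t).
      apply: (pressure_lower_bound ca d10 ab aL oA (su _ oA) (cu _) _ r0 _ T0) => //.
      * by move=> x t _; exact: u0.
      * by apply: closure_sqdist_ge => x /= Bx; rewrite /A /= ltNge (ltW Bx).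
      * move=> x t /(boundary_notin oA) nAx tT; apply: HT => //.
        by rewrite leNgt; apply/negP.
    exists T1 => // x t Dx; apply: HT1; rewrite /A /=.
    apply: (@lt_le_trans _ _ (rho ^+ 2)).
      by rewrite ltrXn2r ?nnegrE ?(ltW rho0) ?(ltW r0)// ltr_pdivrMr// ltr_pMr// (ltr_nat _ 1 4).
    by apply: (closure_sqdist_ge BD); exact: subset_closure.
Qed.

End problems.

Theorem theorem2p1 (R : realType) (N : nat) (N_ge2 : (2 <= N)%N)
  (phi : R -> R) (delta1 delta2 : R)
  (phi_C2 : classC2_line phi) (phi0 : phi 0 = 0) (delta1_gt0 : 0 < delta1)
  (phi'_bounds : forall s, delta1 <= derive1 phi s <= delta2)
  (Omega : set 'rV[R]_N)
  (Omega_open : open Omega) (Omega_connected : connected Omega)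
  (boundary_neq0 : boundary Omega !=set0)
  (boundary_C2 : boundary_classC2 Omega)
  (u : 'rV[R]_N -> R -> R)
  (u_sol : IBVP_solution phi Omega u \/ CP_solution phi Omega u)
  (K : set 'rV[R]_N) (K_compact : compact K) (K_sub : K `<=` Omega) :
  {uniform K, (fun t x => - 4 * t * Phi phi (u x t)) @ 0^'+ -->
              (fun x => edistance x (boundary Omega) ^+ 2)}.
Proof.
have ca : continuous (derive1 phi) by case: phi_C2 => -[].
have aL : locally_lipschitz (derive1 phi).
  by apply: classC1_locally_lipschitz; case: phi_C2.
have [L L0 HL] : exists2 L : R, 0 <= L & forall s, 0 <= s <= 1 ->
    `|derive1 phi s - derive1 phi 0| <= L * s.
  have [L L0 HL] := aL 1; exists L => // s /andP[s0 s1].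
  by rewrite -[X in L * X](ger0_norm s0) -{2}[s]subr0; apply: HL; rewrite ?normr0// ger0_norm.
have [M M0 [su cu uM van lowb]] := solution_bounds phi_C2 delta1_gt0 phi'_bounds
  Omega_open u_sol L0 HL.
move=> Q /uniform_nbhs[E [entE EQ]].
move: entE; rewrite -entourage_ballE => -[e /= e0 He].
have e2 : 0 < e / 2 by rewrite divr_gt0.
have L20 : 0 <= 2 * L by rewrite mulr_ge0.
have near_t : \forall t \near (0 : R)^'+, K `<=` [set x |
    `|edistance x (boundary Omega) ^+ 2 - - 4 * t * Phi phi (u x t)| < e].
  move/compact_near_coveringP : K_compact.
  move=> /(_ R (0 : R)^'+ (fun t x =>
    `|edistance x (boundary Omega) ^+ 2 - - 4 * t * Phi phi (u x t)| < e)).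
  apply => x0 Kx0; have Ox0 := K_sub _ Kx0.
  have [V1 [T1 [nV1 T10 H1]]] := upper_asymptotics ca delta1_gt0 phi'_bounds aL
    Omega_open boundary_neq0 su cu M0 uM van Ox0 e2.
  have [V2 [T2 [nV2 T20 H2]]] := lower_asymptotics (a := derive1 phi)
    Omega_open boundary_C2 boundary_neq0 Ox0 e2 L20 lowb.
  exists (V1 `&` V2 `&` Omega, [set t | 0 < t < Num.min T1 T2]).
    split => /=.
      by apply: filterI; [exact: filterI|exact: open_nbhs_nbhs].
    near=> t; rewrite /=; apply/andP; split; near: t; first exact: nbhs_right_gt.
    by apply: nbhs_right_lt; rewrite lt_min T10.
  move=> [x t] [/= [[V1x V2x] Ox]]; rewrite lt_min => /and3P[t0 tT1 tT2].
  have [|u0 h2] := H2 x t V2x Ox; first by rewrite t0.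
  have h1 := H1 x t V1x Ox (introT andP (conj t0 tT1)) u0.
  rewrite -[Phi phi (u x t)]/(pressure (derive1 phi) (u x t)).
  rewrite ltr_norml; apply/andP; move: h1 h2.
  move: (- 4 * t * _) (edistance _ _ ^+ 2) => A B h1 h2.
  by split; lra.
apply: filterS near_t => t Kt; apply: EQ => x Kx.
by apply: He; exact: Kt.
Unshelve. all: by end_near. Qed.
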